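(* Let $\sigma\in C([0,\infty);\mathbb{R}^{d\times r})$ and let $A$ be a $d\times d$ real matrix all of whose eigenvalues have negative real parts. For $\xi\in\mathbb{R}^d$ let $X(\cdot,\xi)$ be the unique continuous adapted process obeying \[ dX(t)=AX(t)\,dt+\sigma(t)\,dB(t),\quad t\ge 0;\quad X(0)=\xi. \] Let $c>0$, and define \[ \varsigma_c(t)=\left(\int_t^{t+c}\|\sigma(s)\|_F^2\,ds\right)^{1/2},\quad t\ge 0, \] \[ I_c(\epsilon)=\int_0^\infty \varsigma_c(t)\exp\left(-\frac{\epsilon^2/2}{\varsigma_c(t)^2}\right)\chi_{(0,\infty)}(\varsigma_c(t))\,dt,\quad \epsilon>0. \] Suppose finally that $\varsigma_c(t)\to 0$ as $t\to\infty$. (A) If $I_c(\epsilon)<+\infty$ for all $\epsilon>0$, then $\lim_{t\to\infty}X(t,\xi)=0$ a.s. for each $\xi\in\mathbb{R}^d$. (B) If there exists $\epsilon'>0$ such that $I_c(\epsilon)<+\infty$ for all $\epsilon>\epsilon'$ and $I_c(\epsilon)=+\infty$ for all $0<\epsilon<\epsilon'$, then there exist deterministic $0<c_1\le c_2<+\infty$, independent of $\xi$, such that for each $\xi\in\mathbb{R}^d$ \[ c_1\le\limsup_{t\to\infty}\|X(t,\xi)\|\le c_2,\quad\text{a.s.} \] Moreover, for each $\xi\in\mathbb{R}^d$, \[ \liminf_{t\to\infty}\|X(t,\xi)\|=0,\quad \lim_{t\to\infty}\frac1t\int_0^t\|X(s,\xi)\|^2\,ds=0,\quad\text{a.s.}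 \] (C) If $I_c(\epsilon)=+\infty$ for all $\epsilon>0$, then for each $\xi\in\mathbb{R}^d$, $\limsup_{t\to\infty}\|X(t,\xi)\|=+\infty$ a.s. Moreover, for each $\xi\in\mathbb{R}^d$, \[ \liminf_{t\to\infty}\|X(t,\xi)\|=0,\quad \lim_{t\to\infty}\frac1t\int_0^t\|X(s,\xi)\|^2\,ds=0,\quad\text{a.s.} \]
   Context: $d,r$ are positive integers, $B$ is an $r$-dimensional standard Brownian motion, $\sigma$ is deterministic, $\|\cdot\|$ is the Euclidean norm on $\mathbb{R}^d$, $\|\cdot\|_F$ is the Frobenius norm on $\mathbb{R}^{d\times r}$, and $\chi_{(0,\infty)}$ is the indicator function of $(0,\infty)$, so the integrand of $I_c(\epsilon)$ is $0$ where $\varsigma_c(t)=0$. *)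

(* Defs.v *)
From HB Require Import structures.
From mathcomp Require Import all_boot all_order all_algebra complex.
From mathcomp Require Import all_classical all_reals all_analysis.

Set Implicit Arguments.
Unset Strict Implicit.
Unset Printing Implicit Defensive.

Import Order.TTheory GRing.Theory Num.Theory numFieldNormedType.Exports.
Local Open Scope classical_set_scope.
Local Open Scope ring_scope.

(* Processes are indexed by all of R, but only times t >= 0 are ever
   constrained or used. *)

Section deterministic.
Context {R : realType}.
Local Notation mu := (@lebesgue_measure R).

Definition euclidean_norm n (x : 'cV[R]_n) : R :=
  Num.sqrt (\sum_i x i ord0 ^+ 2).

Definition frobenius_norm m n (M : 'M[R]_(m, n)) : R :=
  Num.sqrt (\sum_i \sum_j M i j ^+ 2).

Definition stable_mx n (A : 'M[R]_n) : Prop :=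
  forall a : complex R,
    eigenvalue (map_mx (real_complex R) A) a -> complex.Re a < 0.

Definition varsigma m n (sigma : R -> 'M[R]_(m, n)) (c t : R) : R :=
  Num.sqrt (Rintegral mu `[t, t + c] (fun s => frobenius_norm (sigma s) ^+ 2)).

Definition Ic m n (sigma : R -> 'M[R]_(m, n)) (c eps : R) : \bar R :=
  (\int[mu]_(t in `[0%R, +oo[)
     (varsigma sigma c t
      * expR (- (eps ^+ 2 / 2 / varsigma sigma c t ^+ 2))
      * \1_(`]0%R, +oo[) (varsigma sigma c t))%:E)%E.

End deterministic.

Section stochastic.
Context {R : realType} {dT : measure_display} {T : measurableType dT}.
Variable P : probability T R.
Local Notation mu := (@lebesgue_measure R).

Definition is_filtration (F : R -> set (set T)) : Prop :=
  [/\ forall t, 0 <= t -> sigma_algebra setT (F t),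
      forall t, 0 <= t -> F t `<=` measurable
    & forall s t, 0 <= s -> s <= t -> F s `<=` F t].

Definition adapted (F : R -> set (set T)) n (Y : R -> T -> 'cV[R]_n) : Prop :=
  forall t, 0 <= t -> forall (i : 'I_n) (U : set R), measurable U ->
    F t ((fun w => Y t w i ord0) @^-1` U).

Definition continuous_paths n (Y : R -> T -> 'cV[R]_n) : Prop :=
  {ae P, forall w, {within `[0, +oo[, continuous (fun t => Y t w)}}.

Definition increment n (Y : R -> T -> 'cV[R]_n) (s t : R) (j : 'I_n) (w : T) : R :=
  Y t w j ord0 - Y s w j ord0.

Definition increment_sigma n (Y : R -> T -> 'cV[R]_n) (s t : R) : set (set T) :=
  <<s [set D | exists j (U : set R),
                 measurable U /\ D = increment Y s t j @^-1` U] >>.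

(* Standard n-dimensional Brownian motion relative to F; the last clause says
   that B t - B s has law N(0, (t - s) I_n), i.e. the product of n copies of
   N(0, t - s) (the second parameter of normal_prob is the standard
   deviation). *)
Definition brownian_motion (F : R -> set (set T)) n
    (B : R -> T -> 'cV[R]_n) : Prop :=
  [/\ adapted F B,
      continuous_paths B,
      {ae P, forall w, B 0 w = 0},
      (forall s t, 0 <= s -> s < t -> forall G D,
         F s G -> increment_sigma B s t D -> P (G `&` D) = (P G * P D)%E)
    & (forall s t, 0 <= s -> s < t -> forall U : 'I_n -> set R,
         (forall j, measurable (U j)) ->
         P (\bigcap_j (increment B s t j @^-1` U j)) =
         (\prod_j normal_prob 0 (Num.sqrt (t - s)) (U j))%E)].

(* A list of triples (a, (u, v)) encodes the step function
   \sum a \1_]u, v]; the intervals may overlap. *)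
Definition step := seq (R * (R * R)).

Definition step_on (t : R) (phi : step) : bool :=
  all (fun p => (0 <= p.2.1) && (p.2.1 <= p.2.2) && (p.2.2 <= t)) phi.

Definition step_fun (phi : step) (s : R) : R :=
  \sum_(p <- phi) p.1 * \1_(`]p.2.1, p.2.2]) s.

Definition step_integral (W : R -> T -> R) (phi : step) (w : T) : R :=
  \sum_(p <- phi) p.1 * (W p.2.2 w - W p.2.1 w).

(* Y is a version of the Ito (Wiener) integral over [0, t] of the deterministic
   function f against the scalar Brownian motion W: the L^2(P)-limit of the
   integrals of step functions that converge to f in L^2([0, t]).  By the Ito
   isometry Y is unique up to a null set and does not depend on phi. *)
Definition is_ito_integral (W : R -> T -> R) (f : R -> R) (t : R)
    (Y : T -> R) : Prop :=
  measurable_fun setT Y /\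
  exists phi : nat -> step,
    [/\ forall n, step_on t (phi n),
        ((\int[mu]_(s in `[0%R, t]) ((step_fun (phi n) s - f s) ^+ 2)%:E)%E
           @[n --> \oo] --> 0%E)
      & ('E_P[(fun w => ((step_integral W (phi n) w - Y w) ^+ 2)%R)]%E
           @[n --> \oo] --> 0%E)].

(* X is a continuous adapted process obeying dX = A X dt + sigma dB, X(0) = xi,
   in integrated form; M i j t is \int_0^t sigma_ij dB_j. *)
Definition sde_solution (F : R -> set (set T)) m n (B : R -> T -> 'cV[R]_n)
    (A : 'M[R]_m) (sigma : R -> 'M[R]_(m, n)) (xi : 'cV[R]_m)
    (X : R -> T -> 'cV[R]_m) : Prop :=
  [/\ adapted F X,
      continuous_paths X
    & exists M : 'I_m -> 'I_n -> R -> T -> R,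
        (forall i j t, 0 <= t ->
           is_ito_integral (fun s w => B s w j ord0) (fun s => sigma s i j) t
             (M i j t)) /\
        (forall t, 0 <= t -> {ae P, forall w, forall i,
           X t w i ord0 = xi i ord0
             + Rintegral mu `[0, t] (fun s => (A *m X s w) i ord0)
             + \sum_j M i j t w})].

End stochastic.

(* Main.v *)
Require Import Defs.
From HB Require Import structures.
From mathcomp Require Import all_boot all_order all_algebra complex.
From mathcomp Require Import all_classical all_reals all_analysis.
From mathcomp Require Import measurable_realfun ring lra.

Set Implicit Arguments.
Unset Strict Implicit.
Unset Printing Implicit Defensive.

Import Order.TTheory GRing.Theory Num.Theory numFieldNormedType.Exports HBNNSimple.
Local Open Scope classical_set_scope.
Local Open Scope ring_scope.

(** Fix h = c / 2, cut time into the blocks [n h, (n + 1) h], and let th_n be the integral of the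
    squared Frobenius norm of sigma over block n.  A window [t, t + c] contains a whole block and
    is covered by three.  Hence, up to constant factors in eps, I_c(eps) is finite if and only if
    the series with terms exp (- eps^2 / th_n), or 0 if th_n = 0, converges ([tail_sum_fin],
    [tail_sum_inf]).  The theorem becomes a statement about that series.

    The noise.  Let W be the integral of sigma dB.  Given the past, an increment of a coordinate of
    W has the exponential moments of a Gaussian variable whose variance is the energy of the
    corresponding row of sigma; this is exact for step functions ([step_mgf]) and passes to the
    limit as a Gaussian upper bound for the tail ([wiener_tail]) and a lower bound of the same form
    ([wiener_anticoncentration]).  A maximal inequality extends the upper bound to the squared
    oscillation of W over a block ([ottaviani], [block_max_tail]).  It follows that almost surely
    - if the series with terms exp (- y / (96 d th_n)) converges, the squared oscillations are
      eventually below y ([blocks_small], by Borel-Cantelli);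
    - if the series with terms exp (- 256 d e^2 / th_n) diverges, infinitely many increments over a
      block are at least e ([large_increments], by a conditional Borel-Cantelli lemma);
    - in all cases the squared oscillations tend to 0 in mean over the blocks, because th_n tends
      to 0 and makes their conditional exponential moments close to 1 ([blocks_average]).

    The dynamics.  A stable matrix has a quadratic Lyapunov function V ([stable_lyapunov]).  On each
    block, subtracting from X the increment of W since the start of the block leaves a solution of a
    linear differential equation driven by that increment.  Hence, with u_n the squared oscillation
    of W over block n, V at the end of the block is at most rho V + K u_n for V at its start, where
    rho < 1 ([block_contraction]).  Therefore X is eventually at most of the size of the
    oscillations ([path_eventually_bounded]) and inherits their vanishing averages
    ([path_average_small]), which also force the lower limit 0 ([average_liminf]).  Conversely, an
    increment of W over a block is a difference of two values of X minus a drift, so X cannot stay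
    small when the increments do not ([noise_increment_small]).

    These deterministic estimates have constants that depend on A and h only.  In case (A) every
    threshold y is allowed; in case (B) some y is allowed for the upper bound and some e for the
    lower one; in case (C) every e is allowed. *)

(** * Integration against weighted image measures *)

Section transfer.
Local Open Scope ereal_scope.

(** Both integrals are limits of integrals of the same simple functions, for
    which the inequality is a finite sum. *)
Lemma le_measure_integral d (T : measurableType d) (R : realType)
    (m1 m2 : {measure set T -> \bar R})
    (f : T -> \bar R) :
  (forall U, measurable U -> m1 U <= m2 U) ->
  measurable_fun setT f -> (forall x, 0 <= f x) ->
  \int[m1]_x f x <= \int[m2]_x f x.
Proof.
move=> m12 mf f0.
pose g := nnsfun_approx measurableT mf.
have cvg_g (m : {measure set T -> \bar R}) :
    \int[m]_x (g n x)%:E @[n --> \oo] --> \int[m]_x f x.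
  rewrite [X in _ --> X](_ : _ = \int[m]_x limn (fun n => (g n x)%:E)).
    apply: cvg_monotone_convergence => //.
    - by move=> n; exact/measurable_EFinP.
    - by move=> n x _; rewrite lee_fin.
    - by move=> t _ n n' nn'; rewrite lee_fin; exact/lefP/nd_nnsfun_approx.
  apply: eq_integral => t _.
  by apply/esym/cvg_lim => //; exact/cvg_nnsfun_approx.
rewrite -(cvg_lim _ (cvg_g m1))// -(cvg_lim _ (cvg_g m2))//.
apply: lee_lim; [by apply/cvg_ex; exists (\int[m1]_x f x)|by apply/cvg_ex; exists (\int[m2]_x f x)|].
apply: nearW => n; rewrite !integralT_nnsfun !sintegralE.
apply: lee_fsum => // y [t _ <-]; apply: lee_wpmul2l; rewrite ?lee_fin//.
exact: m12.
Qed.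

Context d d' (T : measurableType d) (T' : measurableType d') (R : realType).
Variables (P : {measure set T -> \bar R}) (H : T -> T') (W : T -> R).
Hypothesis mH : measurable_fun setT H.
Hypothesis mW : measurable_fun setT W.
Hypothesis W0 : forall x, (0 <= W x)%R.

(** The image under H of the measure with density W with respect to P.  It turns
    statements about W known only on the events H^-1 U into statements about
    integrals of functions of H. *)
Definition weighted_image (U : set T') : \bar R :=
  \int[P]_(x in H @^-1` U) (W x)%:E.

Let mpre U : measurable U -> measurable (H @^-1` U).
Proof. by move=> mU; rewrite -[X in measurable X]setTI; exact: mH. Qed.

Let mEW : measurable_fun setT (fun x => (W x)%:E).
Proof. exact/measurable_EFinP. Qed.

Let wi0 : weighted_image set0 = 0.
Proof. by rewrite /weighted_image preimage_set0 integral_set0. Qed.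

Let wi_ge0 U : 0 <= weighted_image U.
Proof. by apply: integral_ge0 => x _; rewrite lee_fin. Qed.

Let wi_additive : semi_sigma_additive weighted_image.
Proof.
move=> F mF tF mUF; rewrite /weighted_image preimage_bigcup.
rewrite ge0_integral_bigcup//; last 4 first.
- by move=> k; exact: mpre.
- exact: measurable_funTS.
- by move=> x _; rewrite lee_fin.
- apply/trivIsetP => i j _ _ ij; rewrite -preimage_setI.
  by move/trivIsetP : tF => /(_ i j I I ij) ->; rewrite preimage_set0.
by apply: is_cvg_ereal_nneg_natsum => n _; exact: wi_ge0.
Qed.

HB.instance Definition _ := isMeasure.Build _ _ _ weighted_image
  wi0 wi_ge0 wi_additive.

(** Change of variables with a weight: approximate f from below by simple
    functions, for which both sides unfold to the same finite sum. *)
Lemma integral_weighted_image (f : T' -> \bar R) :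
  measurable_fun setT f -> (forall x, 0 <= f x) ->
  \int[weighted_image]_y f y = \int[P]_x (f (H x) * (W x)%:E).
Proof.
move=> mf f0.
pose g := nnsfun_approx measurableT mf.
have -> : \int[weighted_image]_y f y =
    \int[weighted_image]_y limn (fun n => (g n y)%:E).
  apply: eq_integral => t _.
  by apply/esym/cvg_lim => //; exact/cvg_nnsfun_approx.
rewrite monotone_convergence//; last 3 first.
- by move=> n; exact/measurable_EFinP.
- by move=> n x _; rewrite lee_fin.
- by move=> t _ n n' nn'; rewrite lee_fin; exact/lefP/nd_nnsfun_approx.
have -> : \int[P]_x (f (H x) * (W x)%:E) =
    \int[P]_x limn (fun n => (g n (H x))%:E * (W x)%:E).
  apply: eq_integral => t _; apply/esym/cvg_lim => //.
  by apply: cvgeZr => //; exact: cvg_nnsfun_approx.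
rewrite monotone_convergence//; last 3 first.
- move=> n; apply: emeasurable_funM => //.
  apply/measurable_EFinP.
  exact: (measurableT_comp _ mH).
- by move=> n x _; rewrite mule_ge0// lee_fin.
- move=> t _ n n' nn'; apply: lee_wpmul2r; rewrite ?lee_fin//.
  exact/lefP/nd_nnsfun_approx.
congr (limn _); apply/funext => n.
rewrite integralT_nnsfun sintegralE.
have gE x : (g n (H x))%:E * (W x)%:E =
    \sum_(y \in range (g n))
      (y * \1_(g n @^-1` [set y]) (H x))%:E * (W x)%:E.
  by rewrite {1}fimfunE -fsumEFin// ge0_mule_fsuml// => y; exact: nnfun_muleindic_ge0.
under [RHS]eq_integral do rewrite gE.
rewrite ge0_integral_fsum//; last 2 first.
- move=> y; apply: emeasurable_funM => //; apply/measurable_EFinP.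
  apply: measurable_funM => //; apply: (measurableT_comp _ mH) => //.
- by move=> y x _; rewrite mule_ge0// ?lee_fin// -lee_fin EFinM nnfun_muleindic_ge0.
apply: eq_fsbigr => y /set_mem[t _ <-].
under [RHS]eq_integral do rewrite EFinM -muleA.
rewrite ge0_integralZl//=; last 3 first.
- by apply: emeasurable_funM => //; apply/measurable_EFinP; apply: (measurableT_comp _ mH).
- by move=> x _; rewrite mule_ge0// lee_fin.
- by rewrite lee_fin.
rewrite /weighted_image [in LHS]integral_mkcond; congr (_ * _).
apply: eq_integral => x _; rewrite patchE indicE.
have -> : (H x \in g n @^-1` [set g n t]) = (x \in H @^-1` (g n @^-1` [set g n t])) by [].
by case: ifPn => _; rewrite ?mul1e ?mul0e.
Qed.

Lemma integral_comp_weighted (N : {measure set T' -> \bar R}) (f : T' -> \bar R) :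
  (forall U, measurable U -> \int[P]_(x in H @^-1` U) (W x)%:E = N U) ->
  measurable_fun setT f -> (forall x, 0 <= f x) ->
  \int[P]_x (f (H x) * (W x)%:E) = \int[N]_y f y.
Proof.
move=> WN mf f0; rewrite -integral_weighted_image//.
by apply: eq_measure_integral => U mU _; exact: WN.
Qed.

End transfer.

(** * Exponential moments of Gaussian vectors *)

Section gaussian_mgf.
Context (R : realType).

Lemma integral_mul_indic d (T : measurableType d) (P : {measure set T -> \bar R})
    (A : set T) (f : T -> R) :
  (\int[P]_(x in A) (f x)%:E = \int[P]_x (\1_A x * f x)%:E)%E.
Proof.
rewrite integral_mkcond; apply: eq_integral => x _.
by rewrite patchE indicE; case: ifPn => _; rewrite ?mul1r ?mul0r.
Qed.

(** Completing the square turns the tilted density into the density of a normal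
    law with shifted mean, whose integral is one. *)
Lemma normal_mgf (s a : R) : 0 < s ->
  (\int[normal_prob 0 s]_x (expR (a * x))%:E)%E = (expR (a ^+ 2 * s ^+ 2 / 2))%:E.
Proof.
move=> s0; have sn0 : s != 0 by rewrite gt_eqF.
rewrite -(@integral_comp_weighted _ _ _ _ _ lebesgue_measure idfun (normal_pdf 0 s))//; last 4 first.
- exact: measurable_id.
- exact: measurable_normal_pdf.
- by move=> x; exact: normal_pdf_ge0.
- apply/measurable_EFinP; apply: measurableT_comp => //.
have complete_square (x : R) : expR (a * x) * normal_pdf 0 s x =
    expR (a ^+ 2 * s ^+ 2 / 2) * normal_pdf (a * s ^+ 2) s x.
  rewrite !normal_pdfE// /normal_fun mulrCA [RHS]mulrCA; congr (_ * _).
  by rewrite -!expRD; congr expR; field.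
transitivity (\int[lebesgue_measure]_x
    ((expR (a ^+ 2 * s ^+ 2 / 2))%:E * (normal_pdf (a * s ^+ 2) s x)%:E))%E.
  by apply: eq_integral => x _; rewrite -!EFinM complete_square.
rewrite ge0_integralZl ?integral_normal_pdf ?mule1 ?lee_fin ?expR_ge0//.
- by apply/measurable_EFinP; exact: measurable_normal_pdf.
- by move=> x _; rewrite lee_fin normal_pdf_ge0.
Qed.
End gaussian_mgf.

Section independent_gaussian_mgf.
Context d (T : measurableType d) (R : realType) (P : probability T R).
Context (n : nat) (D : 'I_n -> T -> R) (s : R) (G : set T).
Hypothesis mD : forall j, measurable_fun setT (D j).
Hypothesis s0 : 0 < s.
Hypothesis mG : measurable G.
Hypothesis lawD : forall U : 'I_n -> set R, (forall j, measurable (U j)) ->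
  P (G `&` \bigcap_j (D j @^-1` U j)) =
  (P G * \prod_j normal_prob 0 s (U j))%E.

Let mpre j U : measurable U -> measurable (D j @^-1` U).
Proof. by move=> mU; rewrite -[X in measurable X]setTI; exact: mD. Qed.

Let N (U : set R) := fine (normal_prob 0 s U).

Let NE U : measurable U -> (N U)%:E = normal_prob 0 s U.
Proof. by move=> mU; apply: fineK; exact: (fin_num_measure (normal_prob 0 s)). Qed.

(** The product formula for probabilities is upgraded one coordinate at a time:
    coordinates below k carry an exponential, the others are still confined to
    the sets U j.  Letting U k vary over the measurable sets identifies a
    weighted image of P under D k with a multiple of the normal law, so that
    the exponential of D k can be integrated. *)
Let mgf_ind (a : 'I_n -> R) k (U : 'I_n -> set R) : (k <= n)%N ->
  (forall j, measurable (U j)) -> (forall j : 'I_n, (j < k)%N -> U j = setT) ->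
  (\int[P]_(x in G `&` \bigcap_j (D j @^-1` U j))
     (expR (\sum_(j < n) (if (j < k)%N then a j else 0) * D j x))%:E)%E =
  (fine (P G) * \prod_(j < n) (if (j < k)%N then expR (a j ^+ 2 * s ^+ 2 / 2)
                         else N (U j)))%:E.
Proof.
elim: k U => [|k IH] U kn mU UT.
  rewrite (eq_integral (cst 1%E)); last first.
    by move=> x _; rewrite big1 ?expR0// => j _; rewrite mul0r.
  rewrite integral_cst//; last first.
    apply: measurableI => //; apply: fin_bigcap_measurable => [|j _]; [exact: finite_finset|exact: mpre].
  rewrite mul1e [LHS](lawD mU) EFinM -prodEFin fineK ?fin_num_measure//.
  congr (_ * _)%E; apply: eq_bigr => j _.
  by rewrite NE.
pose j0 := Ordinal kn.
have ltS (j : 'I_n) : j != j0 -> (j < k.+1)%N = (j < k)%N.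
  by rewrite -val_eqE/= ltnS leq_eqVlt => /negbTE ->.
pose E := G `&` \bigcap_(j in [set j | j != j0]) (D j @^-1` U j).
have mE : measurable E.
  apply: measurableI => //; apply: fin_bigcap_measurable => [|j _]; [exact: finite_finset|exact: mpre].
pose S x := expR (\sum_(j < n) (if (j < k)%N then a j else 0) * D j x).
have mS : measurable_fun setT S.
  apply: measurableT_comp => //; apply: measurable_sum => j.
  exact: measurable_funM.
pose W x := \1_E x * S x.
pose kap := fine (P G) * \prod_(j < n | j != j0) (if (j < k)%N then expR (a j ^+ 2 * s ^+ 2 / 2)
                         else N (U j)).
have kap0 : 0 <= kap.
  rewrite mulr_ge0 ?fine_ge0// prodr_ge0// => j _.
  by case: ifP => _; rewrite ?expR_ge0// fine_ge0.
have WN V : measurable V -> (\int[P]_(x in D j0 @^-1` V) (W x)%:E)%E =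
    mscale (NngNum kap0) (normal_prob 0 s) V.
  move=> mV.
  pose U' j := if j == j0 then V else U j.
  have mU' j : measurable (U' j) by rewrite /U'; case: ifP.
  have UT' (j : 'I_n) : (j < k)%N -> U' j = setT.
    move=> jk; rewrite /U' ifF ?UT//; first exact: ltnW.
    by apply/negbTE; rewrite -val_eqE/= ltn_eqF.
  have := IH U' (ltnW kn) mU' UT'.
  rewrite (bigD1 j0)//= ltnn {2}/U' eqxx.
  rewrite (eq_bigr (fun j : 'I_n => if (j < k)%N then expR (a j ^+ 2 * s ^+ 2 / 2)
                         else N (U j))); last first.
    by move=> j jj0; rewrite /U' (negbTE jj0).
  rewrite mulrCA -/kap mulrC EFinM NE//.
  rewrite /mscale/= => <-.
  rewrite [LHS]integral_mul_indic [RHS]integral_mul_indic; apply: eq_integral => x _; congr EFin.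
  rewrite /W mulrA -/(S x); congr (_ * _).
  rewrite -[LHS]/((\1_(D j0 @^-1` V) \* \1_E) x) -indicI; congr (\1_ _ x).
  rewrite /E setICA; congr (_ `&` _).
  apply/seteqP; split => y /=.
    move=> [Vy Uy] j _; rewrite /U'; have [->//|jj0] := eqVneq j j0.
    exact: Uy.
  move=> H; split; first by have := H j0 I; rewrite /U' eqxx.
  by move=> j /= jj0; have := H j I; rewrite /U' (negbTE jj0).
have mW : measurable_fun setT W by exact: measurable_funM.
have W0 x : 0 <= W x by rewrite mulr_ge0 ?expR_ge0// indicE.
have mexp : measurable_fun setT (fun y => (expR (a j0 * y))%:E).
  by apply/measurable_EFinP; apply: measurableT_comp.
have := @integral_comp_weighted _ _ _ (measurableTypeR R) _ P _ _ (mD j0) mW W0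
  (mscale (NngNum kap0) (normal_prob 0 s) : {measure set _ -> \bar R}) _ WN mexp (fun x => expR_ge0 _).
rewrite ge0_integral_mscale//= normal_mgf//.
rewrite -EFinM => H.
transitivity ((kap * expR (a j0 ^+ 2 * s ^+ 2 / 2))%:E); last first.
  congr EFin; rewrite (bigD1 j0)//= leqnn mulrC mulrCA; congr (_ * (_ * _)).
  by apply: eq_bigr => j jj0; rewrite [in RHS]ltS.
rewrite -H [LHS]integral_mul_indic; apply: eq_integral => x _; congr EFin.
rewrite /W mulrCA; congr (_ * _).
  congr (\1_ _ x); rewrite /E; congr (_ `&` _).
  apply/seteqP; split => y /= Uy j; first by move=> _; exact: Uy.
  move=> _; have [->|jj0] := eqVneq j j0; last exact: Uy.
  by rewrite UT.
rewrite /S -expRD; congr expR; rewrite (bigD1 j0)//= leqnn.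
rewrite [in RHS](bigD1 j0)//= ltnn mul0r add0r; congr (_ + _).
by apply: eq_bigr => j jj0; rewrite [in LHS]ltS.
Qed.

Lemma independent_gaussian_mgf (a : 'I_n -> R) :
  (\int[P]_(x in G) (expR (\sum_j a j * D j x))%:E)%E =
  (P G * (expR ((\sum_j a j ^+ 2) * s ^+ 2 / 2))%:E)%E.
Proof.
have := @mgf_ind a n (fun=> setT) (leqnn _) (fun=> measurableT) (fun _ _ => erefl).
rewrite (_ : \bigcap_j _ = setT) ?setIT; last first.
  by apply/seteqP; split => // x _ j _.
rewrite (eq_integral (fun x => (expR (\sum_j a j * D j x))%:E)); last first.
  by move=> x _; under eq_bigr do rewrite ltn_ord.
move=> ->; under eq_bigr do rewrite ltn_ord.
rewrite EFinM fineK ?fin_num_measure//; congr (_ * _%:E)%E.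
by rewrite -expR_sum -!mulr_suml.
Qed.

End independent_gaussian_mgf.

(** * Exponential moments along a deterministic grid *)

Section sub_sigma_algebra.
Context d (T : measurableType d) (R : realType).
Variables (S : set (set T)) (sS : sigma_algebra setT S) (mS : S `<=` measurable).

(** A filtration is a family of sets of events rather than of measurable types;
    this is measurability of Y with respect to such a set of events. *)
Definition sub_measurable (Y : T -> R) :=
  forall U : set R, measurable U -> S (Y @^-1` U).

Let TS := g_sigma_algebraType S.

Lemma sub_measurableP (Y : T -> R) :
  sub_measurable Y <-> measurable_fun (setT : set TS) (Y : TS -> R).
Proof.
split=> [SY _ U mU|mY U mU].
  by rewrite setTI; apply: sub_sigma_algebra; exact: SY.
have := mY measurableT U mU; rewrite setTI.
by rewrite /measurable/= (sigma_algebra_id sS).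
Qed.

Let measurable_fun_idS : measurable_fun (setT : set T) (idfun : T -> TS).
Proof.
move=> _ U; rewrite setTI preimage_id /measurable/= (sigma_algebra_id sS).
exact: mS.
Qed.

Lemma sub_measurable_fun Y : sub_measurable Y -> measurable_fun setT Y.
Proof. by move=> SY _ U mU; rewrite setTI; apply: mS; exact: SY. Qed.

Variables (P : {measure set T -> \bar R}) (W1 W2 : T -> R).
Hypotheses (mW1 : measurable_fun setT W1) (mW2 : measurable_fun setT W2).
Hypotheses (W10 : forall x, 0 <= W1 x) (W20 : forall x, 0 <= W2 x).

Let integral_sub (W : T -> R) (mW : measurable_fun setT W) (W0 : forall x, 0 <= W x)
    (Z : T -> R) : sub_measurable Z -> (forall x, 0 <= Z x) ->
  (\int[weighted_image P (idfun : T -> TS) W]_x (Z x)%:E = 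
  \int[P]_x (Z x * W x)%:E)%E.
Proof.
move=> /sub_measurableP mZ Z0.
rewrite integral_weighted_image//.
by apply/measurable_EFinP.
Qed.

(** If two weights compare on every event of S, so they do against every
    nonnegative S-measurable Z.  This replaces conditional expectation: the
    hypothesis says that E[W1 | S] <= E[W2 | S]. *)
Lemma sub_integral_mul_le (Z : T -> R) :
  (forall G, S G -> \int[P]_(x in G) (W1 x)%:E <= \int[P]_(x in G) (W2 x)%:E)%E ->
  sub_measurable Z -> (forall x, 0 <= Z x) ->
  (\int[P]_x (Z x * W1 x)%:E <= \int[P]_x (Z x * W2 x)%:E)%E.
Proof.
move=> W12 SZ Z0; rewrite -!integral_sub//.
apply: le_measure_integral.
- by move=> U; rewrite /measurable/= (sigma_algebra_id sS) => SU; exact: W12.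
- by apply/measurable_EFinP; exact/sub_measurableP.
- by move=> x; rewrite lee_fin.
Qed.

Lemma sub_integral_mul_eq (Z : T -> R) :
  (forall G, S G -> \int[P]_(x in G) (W1 x)%:E = \int[P]_(x in G) (W2 x)%:E)%E ->
  sub_measurable Z -> (forall x, 0 <= Z x) ->
  (\int[P]_x (Z x * W1 x)%:E = \int[P]_x (Z x * W2 x)%:E)%E.
Proof.
move=> W12 SZ Z0; rewrite -!integral_sub//.
apply: eq_measure_integral => U + _.
by rewrite /measurable/= (sigma_algebra_id sS) => SU; exact: W12.
Qed.

End sub_sigma_algebra.

Section grid.
Context (R : realType) d (T : measurableType d) (P : probability T R)
  (F : R -> set (set T)) (n : nat) (B : R -> T -> 'cV[R]_n).
Hypotheses (FF : is_filtration F) (BB : brownian_motion P F B).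

(** The integrand is evaluated at the right end of each cell, because the step
    functions to be integrated are combinations of indicators of intervals
    open on the left and closed on the right. *)
Fixpoint grid_integral (f : 'I_n -> R -> R) (s : R) (ts : seq R) (w : T) : R :=
  if ts is t :: ts' then
    \sum_j f j t * increment B s t j w + grid_integral f t ts' w
  else 0.

Fixpoint grid_energy (f : 'I_n -> R -> R) (s : R) (ts : seq R) : R :=
  if ts is t :: ts' then
    (\sum_j f j t ^+ 2) * (t - s) + grid_energy f t ts'
  else 0.

Let sF (t : R) : 0 <= t -> sigma_algebra setT (F t). Proof. by case: FF => + _ _; apply. Qed.
Let mF (t : R) : 0 <= t -> F t `<=` measurable. Proof. by case: FF => _ + _; apply. Qed.
Let leF (s t : R) : 0 <= s -> s <= t -> F s `<=` F t. Proof. by case: FF => _ _; apply. Qed.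

Lemma sub_measurable_le (s t : R) (Y : T -> R) : 0 <= s -> s <= t ->
  sub_measurable (F s) Y -> sub_measurable (F t) Y.
Proof. by move=> s0 st FY U mU; apply: (leF s0 st); exact: FY. Qed.

Lemma increment_sub_measurable (s t : R) j : 0 <= s -> s <= t ->
  sub_measurable (F t) (increment B s t j).
Proof.
move=> s0 st; have t0 := le_trans s0 st.
case: BB => aB _ _ _ _.
apply/(sub_measurableP (sF t0)); apply: measurable_funB.
  by apply/(sub_measurableP (sF t0)) => U mU; exact: aB.
apply/(sub_measurableP (sF t0)); apply: (sub_measurable_le s0 st) => U mU.
exact: aB.
Qed.

Lemma measurable_increment (s t : R) j : 0 <= s -> s <= t ->
  measurable_fun setT (increment B s t j).
Proof.
move=> s0 st; have t0 := le_trans s0 st.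
exact: (sub_measurable_fun (mF t0) (increment_sub_measurable j s0 st)).
Qed.

Lemma measurable_grid f (s : R) (ts : seq R) : 0 <= s -> path <%R s ts ->
  measurable_fun setT (grid_integral f s ts).
Proof.
elim: ts s => [|t ts IH] s s0 //= /andP[st pt].
apply: measurable_funD; last by apply: IH => //; exact: le_trans (ltW st).
apply: measurable_sum => j; apply: measurable_funM => //.
by apply: measurable_increment => //; exact: ltW.
Qed.

(** Independence of the past is used here, through the event G: the increment is
    still Gaussian on every G of the past. *)
Lemma increment_mgf (s t : R) (G : set T) (a : 'I_n -> R) : 0 <= s -> s < t -> F s G ->
  (\int[P]_(w in G) (expR (\sum_j a j * increment B s t j w))%:E =
   P G * (expR ((\sum_j a j ^+ 2) * (t - s) / 2))%:E)%E.
Proof.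
move=> s0 st FG; have ts0 : 0 <= t - s by rewrite subr_ge0 ltW.
case: BB => _ _ _ indep law.
rewrite (@independent_gaussian_mgf _ _ _ _ _ _ (Num.sqrt (t - s))) ?sqr_sqrtr//.
- by move=> j; apply: measurable_increment => //; exact: ltW.
- by rewrite sqrtr_gt0 subr_gt0.
- exact: (mF s0 FG).
move=> U mU; rewrite (indep s t)// ?law//.
rewrite /increment_sigma; set E := [set _ | _].
apply: (@fin_bigcap_measurable _ (g_sigma_algebraType E)) => [|j _].
  exact: finite_finset.
by apply: sub_sigma_algebra; exists j, (U j).
Qed.

(** The first increment is known to the past of the later ones, so the later
    factor can be replaced by its constant conditional expectation. *)
Lemma grid_mgf f (s : R) (ts : seq R) (G : set T) : 0 <= s -> path <%R s ts -> F s G ->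
  (\int[P]_(w in G) (expR (grid_integral f s ts w))%:E =
   P G * (expR (grid_energy f s ts / 2))%:E)%E.
Proof.
elim: ts s G => [|t ts IH] s G s0 /=.
  move=> _ FG; rewrite mul0r expR0 mule1 integral_cst ?mul1e//.
  exact: (mF s0 FG).
move=> /andP[st pt] FG; have t0 : 0 <= t by rewrite (le_trans s0)// ltW.
pose Z w := \1_G w * expR (\sum_j f j t * increment B s t j w).
rewrite integral_mul_indic.
under eq_integral do rewrite expRD mulrA -/(Z _).
rewrite (@sub_integral_mul_eq _ _ _ _ (sF t0) (mF t0) _ _
  (cst (expR (grid_energy f t ts / 2))))//; last 5 first.
- by apply: measurableT_comp => //; exact: measurable_grid.
- by move=> w; exact: expR_ge0.
- move=> G' FG'; rewrite IH// muleC; apply/esym.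
  exact: (integral_cst P (mF t0 FG') (_)%:E).
- apply/(sub_measurableP (sF t0)); apply: measurable_funM.
    apply: measurable_indic; rewrite /measurable/= (sigma_algebra_id (sF t0)).
    exact: (leF s0 (ltW st) FG).
  apply: measurableT_comp => //; apply: measurable_sum => j.
  apply: measurable_funM => //; apply/(sub_measurableP (sF t0)).
  by apply: increment_sub_measurable => //; exact: ltW.
- by move=> w; rewrite mulr_ge0 ?expR_ge0// indicE.
rewrite (eq_integral (fun w => (expR (grid_energy f t ts / 2))%:E * (Z w)%:E)%E);
  last by move=> w _; rewrite -EFinM mulrC.
rewrite ge0_integralZl ?lee_fin ?expR_ge0//; last 2 first.
- apply/measurable_EFinP; apply: measurable_funM.
    by apply: measurable_indic; exact: (mF s0 FG).
  apply: measurableT_comp => //; apply: measurable_sum => j.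
  by apply: measurable_funM => //; apply: measurable_increment => //; exact: ltW.
- by move=> w _; rewrite lee_fin mulr_ge0 ?expR_ge0// indicE.
rewrite -integral_mul_indic increment_mgf// muleCA -EFinM -expRD.
by rewrite addrC mulrDl.
Qed.
End grid.

(** * Step functions on a grid that resolves them *)

Section riemann_stieltjes_sums.
Context (R : realType).
Local Notation mu := (@lebesgue_measure R).

Fixpoint grid_sum (g W : R -> R) (s : R) (ts : seq R) : R :=
  if ts is t :: ts' then g t * (W t - W s) + grid_sum g W t ts' else 0.

(** A point u that is not strictly inside a cell of the grid that starts at s and
    continues with ts; points to the left of s do no harm. *)
Definition resolved (s : R) (ts : seq R) (u : R) : bool := (u <= s) || (u \in ts).

(** A resolved point is outside the interior of the first cell. *)
Lemma resolved_cons s t ts u : s < t -> path <%R t ts -> resolved s (t :: ts) u ->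
  ((u <= s) || (t <= u)) && resolved t ts u.
Proof.
move=> st pt /orP[us|]; first by rewrite us /= /resolved (le_trans us (ltW st)).
rewrite inE => /orP[/eqP->|uts]; first by rewrite lexx orbT /resolved lexx.
rewrite /resolved uts orbT andbT.
have /(order_path_min lt_trans)/allP/(_ _ uts)/ltW -> := pt.
by rewrite orbT.
Qed.

(** Telescoping: the cells inside the interval are consecutive, and clamping
    u and v to the range of the grid covers intervals that stick out of it. *)
Lemma grid_sum_indic (W : R -> R) u v s ts : u <= v -> path <%R s ts ->
  resolved s ts u -> resolved s ts v ->
  grid_sum \1_(`]u, v]) W s ts =
  W (Num.min (Num.max (last s ts) u) v) - W (Num.min (Num.max s u) v).
Proof.
move=> uv; elim: ts s => [|t ts IH] s /=; first by rewrite subrr.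
move=> /andP[st pt] /(resolved_cons st pt)/andP[us ru] /(resolved_cons st pt)/andP[vs rv].
rewrite IH//.
suff -> : \1_(`]u, v]) t * (W t - W s) =
  W (Num.min (Num.max t u) v) - W (Num.min (Num.max s u) v) by ring.
rewrite indicE mem_setE in_itv/=.
case/orP: us => us.
  rewrite (max_idPl us) (max_idPl (le_trans us (ltW st))) (le_lt_trans us st)/=.
  case/orP: vs => vs.
    by rewrite (min_idPr vs) (min_idPr (le_trans vs (ltW st))) leNgt (le_lt_trans vs st) mul0r subrr.
  by rewrite (min_idPl vs) (min_idPl (le_trans (ltW st) vs)) vs mul1r.
rewrite (max_idPr us) (max_idPr (le_trans (ltW st) us)).
by rewrite ltNge us mul0r subrr.
Qed.

(** The same combination of intervals, cut to the right of s: an interval that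
    ends before s degenerates to an empty one. *)
Definition clip_step (s : R) (phi : @step R) : @step R :=
  [seq (p.1, (Num.max p.2.1 s, Num.max p.2.2 s)) | p <- phi].

Lemma grid_sum_step (W : R -> R) t phi s ts : step_on t phi -> path <%R s ts ->
  last s ts = t -> s <= t ->
  (forall p, p \in phi -> resolved s ts p.2.1 && resolved s ts p.2.2) ->
  grid_sum (step_fun phi) W s ts =
  \sum_(p <- clip_step s phi) p.1 * (W p.2.2 - W p.2.1).
Proof.
move=> /allP on_phi pts lts st rphi.
transitivity (\sum_(p <- phi) p.1 * grid_sum \1_(`]p.2.1, p.2.2]) W s ts).
  elim: ts s {pts lts st rphi} => [|u ts IH] s /=.
    by rewrite big1// => p _; rewrite mulr0.
  rewrite IH /step_fun mulr_suml -big_split/=; apply: eq_bigr => p _.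
  by rewrite [in RHS]mulrDr [in RHS]mulrA.
rewrite big_map big_seq [RHS]big_seq; apply: eq_bigr => p pphi /=.
have /andP[/andP[u0 uv] vt] := on_phi _ pphi.
have /andP[ru rv] := rphi _ pphi.
rewrite grid_sum_indic// lts (max_idPl (le_trans uv vt)) (min_idPr vt).
congr (_ * _); have [vs|sv] := leP p.2.2 s.
  rewrite (max_idPr (le_trans uv vs)) (max_idPl (le_trans uv vs)).
  by rewrite (min_idPr vs) !subrr.
by rewrite [Num.max s _]maxC (min_idPl _)// ge_max uv ltW.
Qed.

Lemma step_fun_cell (phi : @step R) s t ts x : s < t -> path <%R t ts ->
  (forall p, p \in phi -> resolved s (t :: ts) p.2.1 && resolved s (t :: ts) p.2.2) ->
  s < x -> x <= t -> step_fun phi x = step_fun phi t.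
Proof.
move=> st pt rphi sx xt; rewrite /step_fun big_seq [RHS]big_seq.
apply: eq_bigr => p pphi; congr (_ * _).
have /andP[/(resolved_cons st pt)/andP[us _] /(resolved_cons st pt)/andP[vs _]] := rphi _ pphi.
rewrite !indicE !mem_setE !in_itv/=; congr (nat_of_bool _)%:R; congr andb.
  case/orP: us => us; first by rewrite (le_lt_trans us sx) (le_lt_trans us st).
  by rewrite !ltNge us (le_trans xt us).
case/orP: vs => vs; last by rewrite vs (le_trans xt vs).
by rewrite !leNgt (le_lt_trans vs sx) (le_lt_trans vs st).
Qed.

Lemma measurable_step_fun (phi : @step R) : measurable_fun setT (step_fun phi).
Proof.
apply: measurable_sum => p; apply: measurable_funM => //.
Qed.

(** A step function is constant on the cells of a grid that resolves it, so its
    energy is a finite sum. *)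
Lemma grid_energy_step phi s ts : path <%R s ts ->
  (forall p, p \in phi -> resolved s ts p.2.1 && resolved s ts p.2.2) ->
  ((grid_sum (fun x => step_fun phi x ^+ 2) idfun s ts)%:E =
  \int[mu]_(x in `]s, last s ts]) (step_fun phi x ^+ 2)%:E)%E.
Proof.
elim: ts s => [|t ts IH] s /=.
  by rewrite set_itvoc0 integral_set0.
move=> /andP[st pt] rphi.
have tl : t <= last t ts.
  have := mem_last t ts; rewrite inE => /orP[/eqP -> //|].
  by move/(order_path_min lt_trans)/allP : (pt) => H /H /ltW.
rewrite EFinD IH//; last first.
  move=> p pphi; have /andP[ru rv] := rphi _ pphi.
  by have /andP[_ ->] := resolved_cons st pt ru; have /andP[_ ->] := resolved_cons st pt rv.
rewrite (@itv_bndbnd_setU _ _ (BRight s) (BRight t))//; last by rewrite bnd_simp ltW.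
rewrite ge0_integral_setU//=; last 3 first.
- by apply/measurable_EFinP/measurable_funTS/measurable_funX; exact: measurable_step_fun.
- by move=> x _; rewrite lee_fin sqr_ge0.
- apply/disj_setPS => x /=; rewrite !in_itv/= => -[/andP[_ xt] /andP[tx _]].
  by have := lt_le_trans tx xt; rewrite ltxx.
congr (_ + _)%E; rewrite (eq_integral (cst (step_fun phi t ^+ 2)%:E)).
  by rewrite integral_cst//= lebesgue_measure_itv/= lte_fin st EFinM.
move=> x /set_mem/=; rewrite in_itv/= => /andP[sx xt].
by rewrite (step_fun_cell st pt rphi sx xt).
Qed.

End riemann_stieltjes_sums.

(** * Exponential moments of integrals of step functions *)

Section step_mgf.
Context (R : realType) d (T : measurableType d) (P : probability T R)
  (F : R -> set (set T)) (n : nat) (B : R -> T -> 'cV[R]_n).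
Hypotheses (FF : is_filtration F) (BB : brownian_motion P F B).
Local Notation mu := (@lebesgue_measure R).

(** The sorted end points between s and t of all intervals that occur. *)
Lemma common_grid (phi : 'I_n -> @step R) (s t : R) : s <= t ->
  (forall j, step_on t (phi j)) ->
  exists ts, [/\ path <%R s ts, last s ts = t &
    forall j p, p \in phi j -> resolved s ts p.2.1 && resolved s ts p.2.2].
Proof.
move=> st on_phi.
have [->|snt] := eqVneq s t.
  exists [::]; split => // j p pphi; rewrite /resolved/= !orbF.
  have /allP/(_ _ pphi)/andP[/andP[_ uv] vt] := on_phi j.
  by rewrite vt (le_trans uv vt).
have {}st : s < t by rewrite lt_neqAle snt.
pose ends := flatten [seq flatten [seq [:: p.2.1; p.2.2] | p <- phi j] | j <- enum 'I_n].
pose ts := sort <=%R (undup [seq x <- ends | s < x < t]).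
have tsP x : (x \in ts) = (s < x < t) && (x \in ends).
  by rewrite mem_sort mem_undup mem_filter.
exists (rcons ts t); split; last 2 first.
- by rewrite last_rcons.
- move=> j p pphi.
  have /allP/(_ _ pphi)/andP[/andP[_ uv] vt] := on_phi j.
  have resP x : x \in [:: p.2.1; p.2.2] -> x <= t -> resolved s (rcons ts t) x.
    move=> xp xt; rewrite /resolved mem_rcons inE tsP.
    have -> : x \in ends.
      apply/flattenP; exists (flatten [seq [:: p.2.1; p.2.2] | p <- phi j]).
        by apply: map_f; rewrite mem_enum.
      by apply/flattenP; exists [:: p.2.1; p.2.2] => //; exact: map_f.
    by rewrite andbT; have [//|sx] := leP x s; rewrite /= -le_eqVlt.
  by rewrite !resP ?inE ?eqxx ?orbT// (le_trans uv).
rewrite rcons_path; apply/andP; split.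
  rewrite lt_path_sortedE lt_sorted_uniq_le sort_uniq undup_uniq sort_le_sorted !andbT.
  by apply/allP => x; rewrite tsP => /andP[/andP[]].
by have := mem_last s ts; rewrite inE tsP => /orP[/eqP->//|/andP[/andP[]]].
Qed.

Definition step_sum (phi : 'I_n -> @step R) (w : T) : R :=
  \sum_j step_integral (fun t w => B t w j ord0) (phi j) w.

Lemma grid_integralE f s ts w :
  grid_integral B f s ts w =
  \sum_j grid_sum (f j) (fun t => B t w j ord0) s ts.
Proof.
elim: ts s => [|t ts IH] s /=; first by rewrite big1.
by rewrite IH -big_split.
Qed.

Lemma grid_energyE (f : 'I_n -> R -> R) (s : R) ts :
  grid_energy f s ts = \sum_j grid_sum (fun x => f j x ^+ 2) idfun s ts.
Proof.
elim: ts s => [|t ts IH] s /=; first by rewrite big1.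
by rewrite IH mulr_suml -big_split.
Qed.

Lemma grid_sumZ (k : R) g W s ts :
  grid_sum (fun x => k * g x) W s ts = k * grid_sum g W s ts.
Proof.
elim: ts s => [|t ts IH] s /=; first by rewrite mulr0.
by rewrite IH [in RHS]mulrDr [in RHS]mulrA.
Qed.

Definition step_energy (phi : 'I_n -> @step R) (s t : R) : \bar R :=
  (\sum_j \int[mu]_(x in `]s, t]) (step_fun (phi j) x ^+ 2)%:E)%E.

(** On a common grid the sum of the integrals is a grid integral, up to the part
    before s, which clipping removes.  Hence it has the exponential moments of
    a centred Gaussian variable of variance v, on every event of the past. *)
Lemma step_mgf (phi : 'I_n -> @step R) (s t v k : R) (G : set T) :
  0 <= s -> s <= t -> (forall j, step_on t (phi j)) -> F s G ->
  step_energy phi s t = v%:E ->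
  (\int[P]_(w in G) (expR (k * step_sum (fun j => clip_step s (phi j)) w))%:E =
   P G * (expR (k ^+ 2 * v / 2))%:E)%E.
Proof.
move=> s0 st on_phi FG phiv.
have [ts [pts lts rphi]] := common_grid st on_phi.
have := grid_mgf FF BB (fun j x => k * step_fun (phi j) x) s0 pts FG.
under eq_integral do rewrite grid_integralE.
rewrite grid_energyE.
under [in RHS]eq_bigr do under eq_fun do rewrite exprMn.
under [in RHS]eq_bigr do rewrite grid_sumZ.
rewrite -mulr_sumr.
have -> : \sum_j grid_sum (fun x => step_fun (phi j) x ^+ 2) idfun s ts = v.
  apply: EFin_inj; rewrite -phiv -sumEFin; apply: eq_bigr => j _.
  by rewrite (grid_energy_step pts)//; [rewrite lts|move=> p; exact: rphi].
move=> <-; apply: eq_integral => w _; congr (expR _)%:E.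
rewrite mulr_sumr; apply: eq_bigr => j _.
rewrite grid_sumZ (grid_sum_step _ (on_phi j) pts lts st)//.
by move=> p; exact: rphi.
Qed.

(** The factor (p \in phi)%:R makes the summand measurable for every p, since
    increments are adapted only when their end points are in range. *)
Lemma step_integral_sub_measurable (phi : @step R) t j : 0 <= t -> step_on t phi ->
  sub_measurable (F t) (step_integral (fun t w => B t w j ord0) phi).
Proof.
move=> t0 on_phi; have sF : sigma_algebra setT (F t) by case: FF => + _ _; apply.
apply/(sub_measurableP sF).
rewrite (_ : step_integral _ _ =
  fun w => \sum_(p <- phi) (p \in phi)%:R * (p.1 * increment B p.2.1 p.2.2 j w)).
  apply: measurable_sum => p; have [pphi|_] := boolP (p \in phi); last first.
    under eq_fun do rewrite mul0r.
    exact: measurable_cst.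
  apply: measurable_funM => //; apply: measurable_funM => //.
  have /allP/(_ _ pphi)/andP[/andP[u0 uv] vt] := on_phi.
  apply/(sub_measurableP sF).
  apply: (sub_measurable_le FF (le_trans u0 uv) vt).
  exact: (increment_sub_measurable FF BB).
apply/funext => w; rewrite /step_integral big_seq [RHS]big_seq.
by apply: eq_bigr => p ->; rewrite mul1r.
Qed.

Lemma clip_step_on s t (phi : @step R) : s <= t -> step_on t phi ->
  step_on t (clip_step s phi).
Proof.
move=> st /allP on_phi; apply/allP => _ /mapP[p pphi ->] /=.
have /andP[/andP[u0 uv] vt] := on_phi _ pphi.
by rewrite le_max u0/= ge_max !le_max uv lexx orbT/= ge_max vt.
Qed.

End step_mgf.

(** * Tail bounds in both directions from an exponential moment *)

Section gaussian_tails.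
Context d (T : measurableType d) (R : realType) (P : probability T R).
Variables (G : set T) (v : R).
Hypothesis mG : measurable G.

(** On the event G, the law of Y has the exponential moments of a centred
    normal law of variance v. *)
Definition conditional_mgf (Y : T -> R) := forall k : R,
  (\int[P]_(w in G) (expR (k * Y w))%:E = P G * (expR (k ^+ 2 * v / 2))%:E)%E.

Lemma measurable_geset (Y : T -> R) e : measurable_fun setT Y ->
  measurable [set w | e <= Y w].
Proof.
move=> mY; have := mY measurableT _ (measurable_itv `[e, +oo[).
rewrite setTI (_ : _ @^-1` _ = [set w | e <= Y w])//.
by apply/seteqP; split => w /=; rewrite in_itv/= andbT.
Qed.

Let mexp (Y : T -> R) k : measurable_fun setT Y ->
  measurable_fun G (fun w => (expR (k * Y w))%:E).
Proof.
move=> mY; apply/measurable_EFinP/measurable_funTS; apply: measurableT_comp => //.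
exact: measurable_funM.
Qed.

Lemma chernoff_ge (Y : T -> R) (k e : R) : measurable_fun setT Y ->
  conditional_mgf Y -> 0 < k ->
  (P (G `&` [set w | (e <= Y w)%R]) <= P G * (expR (k ^+ 2 * v / 2 - k * e))%:E)%E.
Proof.
move=> mY mgfY k0; have mgeY := measurable_geset e mY.
rewrite setIC -integral_indic// expRD EFinM muleA -mgfY muleC -ge0_integralZl ?lee_fin ?expR_ge0//; last 1 first.
- exact: mexp.
apply: ge0_le_integral => //=.
- by apply/measurable_EFinP; exact: measurable_indic.
- apply: emeasurable_funM; last exact: mexp.
  exact: measurable_cst.
move=> w _; rewrite -EFinM -expRD lee_fin indicE.
have [|_] := boolP (w \in _); last exact: expR_ge0.
rewrite inE/= => eY; rewrite -[leLHS]expR0 ler_expR addrC -mulrBr.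
by rewrite mulr_ge0// ?subr_ge0// ltW.
Qed.

(** The optimal exponent for variance v' is e / v'; a smaller variance only
    improves the bound. *)
Lemma chernoff_norm (Y : T -> R) (e v' : R) : measurable_fun setT Y ->
  conditional_mgf Y -> 0 < e -> v <= v' -> 0 < v' ->
  (P (G `&` [set w | (e <= `|Y w|)%R]) <=
   P G * (2 * expR (- (e ^+ 2 / (2 * v'))))%:E)%E.
Proof.
move=> mY mgfY e0 vv' v'0.
have k0 : 0 < e / v' by rewrite divr_gt0.
have mNY : measurable_fun setT (fun w => - Y w) by exact: measurableT_comp.
have mgfNY : conditional_mgf (fun w => - Y w).
  move=> k; rewrite -[in RHS](sqrrN k) -mgfY; apply: eq_integral => w _.
  by rewrite mulNr mulrN.
have tail : expR ((e / v') ^+ 2 * v / 2 - e / v' * e) <= expR (- (e ^+ 2 / (2 * v'))).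
  rewrite ler_expR.
  have -> : - (e ^+ 2 / (2 * v')) = (e / v') ^+ 2 * v' / 2 - e / v' * e.
    by field; rewrite gt_eqF.
  by rewrite lerD2r ler_wpM2r// ler_wpM2l// sqr_ge0.
have half Z : measurable_fun setT Z -> conditional_mgf Z ->
    (P (G `&` [set w | (e <= Z w)%R]) <= P G * (expR (- (e ^+ 2 / (2 * v'))))%:E)%E.
  move=> mZ mgfZ; apply: (le_trans (chernoff_ge e mZ mgfZ k0)).
  by rewrite lee_wpmul2l// lee_fin.
apply: (@le_trans _ _ (P (G `&` [set w | (e <= Y w)%R]) +
                      P (G `&` [set w | (e <= - Y w)%R]))%E).
  rewrite (_ : [set w | (e <= `|Y w|)%R] =
      [set w | (e <= Y w)%R] `|` [set w | (e <= - Y w)%R]); last first.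
    apply/seteqP; split => w /=.
      by rewrite real_ler_normr ?num_real//; case/orP; [left|right].
    by rewrite real_ler_normr ?num_real// => -[->|->]//; rewrite orbT.
  rewrite setIUr; apply: measureU2; apply: measurableI => //;
    exact: measurable_geset.
rewrite mulr2n mulrDl mul1r EFinD ge0_muleDr ?lee_fin ?expR_ge0//.
by apply: leeD; exact: half.
Qed.

(** A second moment argument for the exponential of k Y, whose first and second
    moments m and b are explicit: an exponential variable cannot have mean m
    without exceeding m / 2 on a set of probability of order m^2 / b.  The
    exponent k is so large that Y >= e there. *)
Lemma paley_zygmund (Y : T -> R) (e : R) : measurable_fun setT Y ->
  conditional_mgf Y -> 0 < e -> 0 < v -> v <= 4 * e ^+ 2 ->
  (P G * (expR (- (16 * e ^+ 2 / v)) / 4)%:E <=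
   P (G `&` [set w | (e <= Y w)%R]))%E.
Proof.
move=> mY mgfY e0 v_gt0 ve; have mgeY := measurable_geset e mY.
(* With this k, exp (k e) <= m / 2: what Y < e contributes to the mean is at most half. *)
pose k := 4 * e / v.
have k0 : 0 < k by rewrite divr_gt0// mulr_gt0.
pose m := expR (k ^+ 2 * v / 2).
have m0 : 0 < m by rewrite expR_gt0.
pose b := expR ((2 * k) ^+ 2 * v / 2).
have b0 : 0 < b by rewrite expR_gt0.
pose c := m / (2 * b).
have c0 : 0 < c by rewrite divr_gt0// mulr_gt0.
have key : 2 * expR (k * e) <= m.
  have -> : m = expR (k * e) * expR (4 * (e ^+ 2 / v)).
    rewrite /m -expRD; congr expR; rewrite /k; field; rewrite gt_eqF//.
  rewrite mulrC ler_pM2l ?expR_gt0//.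
  apply: le_trans (expR_ge1Dx _).
  have : 1 <= 4 * (e ^+ 2 / v) by rewrite mulrA ler_pdivlMr// mul1r.
  lra.
pose E := [set w | e <= Y w].
have c20 : 0 <= c / 2 by rewrite divr_ge0// ltW.
have c2V0 : 0 <= (2 * c)^-1 by rewrite invr_ge0 mulr_ge0// ltW.
(* On Y >= e this is z <= c z^2 / 2 + 1 / (2 c) for z = exp (k Y); the weight c is chosen
   so that the quadratic term has integral m / 4. *)
have pw w : expR (k * Y w) <= m / 2 + (c / 2 * expR (2 * k * Y w) + (2 * c)^-1 * \1_E w).
  have [eY|Ye] := leP e (Y w).
    rewrite indicE mem_set// mulr1.
    rewrite (_ : 2 * k * Y w = k * Y w + k * Y w); last by ring.
    rewrite expRD -expr2.
    set z := expR (k * Y w).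
    apply: (@le_trans _ _ (c / 2 * z ^+ 2 + (2 * c)^-1)); last first.
      by rewrite lerDr divr_ge0// ltW.
    rewrite -subr_ge0.
    have -> : c / 2 * z ^+ 2 + (2 * c)^-1 - z = (c * z - 1) ^+ 2 / (2 * c).
      by field; rewrite gt_eqF.
    by rewrite divr_ge0// ?sqr_ge0// mulr_ge0// ltW.
  apply: (@le_trans _ _ (m / 2)); last first.
    by rewrite lerDl addr_ge0// mulr_ge0// expR_ge0.
  rewrite ler_pdivlMr// mulrC; apply: le_trans key.
  by rewrite ler_pM2l// ler_expR ler_pM2l// ltW.
have pE : P G = (fine (P G))%:E by rewrite fineK// fin_num_measure.
have : (P G * m%:E <= P G * (m / 2 + c / 2 * b)%:E +
    (2 * c)^-1%:E * P (G `&` E))%E.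
  rewrite -mgfY.
  have -> : (P G * (m / 2 + c / 2 * b)%:E + (2 * c)^-1%:E * P (G `&` E) =
      \int[P]_(w in G) ((m / 2)%:E + ((c / 2)%:E * (expR (2 * k * Y w))%:E +
         (2 * c)^-1%:E * (\1_E w)%:E)))%E.
    have mE : measurable_fun G (fun w => (\1_E w)%:E : \bar R).
      by apply/measurable_EFinP; exact: measurable_indic.
    rewrite ge0_integralD//; last 3 first.
    - by move=> w _; rewrite lee_fin divr_ge0// ltW.
    - move=> w _; rewrite adde_ge0// -EFinM lee_fin mulr_ge0// ?expR_ge0//.
    - apply: emeasurable_funD; apply: emeasurable_funM => //; exact: mexp.
    rewrite ge0_integralD//; last 4 first.
    - by move=> w _; rewrite -EFinM lee_fin mulr_ge0// expR_ge0.
    - by apply: emeasurable_funM => //; exact: mexp.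
    - by move=> w _; rewrite -EFinM lee_fin mulr_ge0.
    - by apply: emeasurable_funM.
    rewrite ge0_integralZl ?lee_fin//; last exact: mexp.
    rewrite ge0_integralZl ?lee_fin// mgfY integral_indic// integral_cst//.
    rewrite setIC addeA; congr (_ + _)%E.
    rewrite [in LHS]pE [X in (_ * X + _)%E]pE [X in (_ + _ * (X * _))%E]pE.
    by rewrite -!EFinM -!EFinD; congr EFin; rewrite /b; ring.
  apply: ge0_le_integral => //.
  - exact: mexp.
  - apply: emeasurable_funD => //; apply: emeasurable_funD;
      apply: emeasurable_funM => //; first exact: mexp.
    by apply/measurable_EFinP; exact: measurable_indic.
  - by move=> w _; rewrite -!EFinM -!EFinD lee_fin.
have mGE : measurable (G `&` E) by exact: measurableI.
rewrite -(fineK (fin_num_measure P _ mG)) -(fineK (fin_num_measure P _ mGE)).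
rewrite -!EFinM -!EFinD !lee_fin.
set p := fine _; set q := fine _.
have cb : c * b = m / 2 by rewrite /c; field; rewrite gt_eqF.
have -> : p * (m / 2 + c / 2 * b) = p * (m / 2) + p * (c * b) / 2 by field.
rewrite cb => H.
have H' : p * m / 4 <= (2 * c)^-1 * q by lra.
have c20' : 0 < 2 * c by rewrite mulr_gt0.
move: H'; rewrite ler_pdivlMl// => H''; apply: le_trans H''.
rewrite le_eqVlt; apply/orP; left; apply/eqP.
have -> : expR (- (16 * e ^+ 2 / v)) = m ^+ 2 / b.
  rewrite /m /b -expRM_natl -expRB; congr expR.
  by rewrite /k; field; rewrite gt_eqF.
by rewrite /c; field; rewrite gt_eqF.
Qed.

End gaussian_tails.

(** * Convergence in probability *)

Section convergence_in_probability.
Context d (T : measurableType d) (R : realType) (P : probability T R).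

Lemma cvge0_near_le (u : nat -> \bar R) (dl : R) :
  (u q @[q --> \oo] --> 0)%E -> 0 < dl -> \forall q \near \oo, (u q <= dl%:E)%E.
Proof.
move=> u0 dl0.
have : \forall q \near \oo, (u q < dl%:E)%E.
  exact: (u0 _ (@nbhs_open_ereal_lt R 0 (fun=> dl) dl0)).
by apply: filterS => q; exact: ltW.
Qed.

Definition prob_cvg0 (X : nat -> T -> R) := forall e dl : R, 0 < e -> 0 < dl ->
  \forall q \near \oo, (P [set w | (e <= `|X q w|)%R] <= dl%:E)%E.

Lemma measurable_norm_ge (X : T -> R) e : measurable_fun setT X ->
  measurable [set w | e <= `|X w|].
Proof.
move=> mX; apply: (@measurable_geset _ _ _ (fun w => `|X w|)).
exact: measurableT_comp.
Qed.

Lemma prob_cvg0D (X Y : nat -> T -> R) :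
  (forall q, measurable_fun setT (X q)) -> (forall q, measurable_fun setT (Y q)) ->
  prob_cvg0 X -> prob_cvg0 Y -> prob_cvg0 (fun q w => X q w + Y q w).
Proof.
move=> mX mY X0 Y0 e dl e0 dl0.
have e20 : 0 < e / 2 by rewrite divr_gt0.
have dl20 : 0 < dl / 2 by rewrite divr_gt0.
near=> q.
have mXe := measurable_norm_ge (e / 2) (mX q).
have mYe := measurable_norm_ge (e / 2) (mY q).
apply: (@le_trans _ _ (P ([set w | (e / 2 <= `|X q w|)%R] `|`
                          [set w | (e / 2 <= `|Y q w|)%R]))).
  apply: le_measure; rewrite ?inE//.
  - by apply: measurable_norm_ge; exact: measurable_funD.
  - exact: measurableU.
  move=> w /= eXY; have [?|Xe] := leP (e / 2) `|X q w|; [by left|right].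
  have [//|Ye] := leP (e / 2) `|Y q w|.
  have := ler_normD (X q w) (Y q w); lra.
apply: (le_trans (measureU2 _ mXe mYe)).
rewrite [dl]splitr EFinD; apply: leeD.
- by near: q; exact: X0.
- by near: q; exact: Y0.
Unshelve. all: by end_near. Qed.

Lemma prob_cvg0_sum n (X : 'I_n -> nat -> T -> R) :
  (forall j q, measurable_fun setT (X j q)) ->
  (forall j, prob_cvg0 (X j)) -> prob_cvg0 (fun q w => \sum_j X j q w).
Proof.
move=> mX X0.
suff : forall s : seq 'I_n, prob_cvg0 (fun q w => \sum_(j <- s) X j q w) by apply.
elim=> [|j s IH].
  move=> e dl e0 dl0; near=> q.
  rewrite (_ : [set w | _] = set0) ?measure0 ?lee_fin ?ltW//.
  by apply/seteqP; split => w //=; rewrite big_nil normr0 leNgt e0.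
rewrite (_ : (fun q w => _) = (fun q w => X j q w + \sum_(j <- s) X j q w)); last first.
  by apply/funext => q; apply/funext => w; rewrite big_cons.
apply: prob_cvg0D => // q; exact: measurable_sum.
Unshelve. all: by end_near. Qed.

Lemma prob_cvg0N (X : nat -> T -> R) : prob_cvg0 X -> prob_cvg0 (fun q w => - X q w).
Proof.
move=> X0 e dl e0 dl0; have := X0 e dl e0 dl0.
by apply: filterS => q; under [in X in _ -> X]eq_fun do rewrite normrN.
Qed.

(** Chebyshev's inequality. *)
Lemma prob_cvg0_L2 (X : nat -> T -> R) : (forall q, measurable_fun setT (X q)) ->
  ('E_P[(fun w => (X q w ^+ 2)%R)] @[q --> \oo] --> 0)%E -> prob_cvg0 X.
Proof.
move=> mX X0 e dl e0 dl0.
have ede : (0 < (e ^+ 2 * dl)%:E)%E by rewrite lte_fin mulr_gt0// exprn_gt0.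
have : \forall q \near \oo, ('E_P[(fun w => (X q w ^+ 2)%R)] <= (e ^+ 2 * dl)%:E)%E.
  exact: cvge0_near_le.
apply: filterS => q; rewrite unlock => Xq.
have me := measurable_norm_ge e (mX q).
rewrite -(@lee_pmul2l _ (e ^+ 2)%:E)// -?EFinM; last by rewrite lte_fin exprn_gt0.
apply: le_trans Xq.
rewrite -(setIT [set w | _]) -integral_indic// -ge0_integralZl//.
- apply: ge0_le_integral => //.
  + by move=> w _; rewrite -EFinM lee_fin mulr_ge0// ?sqr_ge0// indicE.
  + apply: emeasurable_funM => //; apply/measurable_EFinP; exact: measurable_indic.
  + by apply/measurable_EFinP; exact: measurable_funX.
  move=> w _; rewrite -EFinM lee_fin indicE.
  have [|_] := boolP (w \in _); last by rewrite mulr0 sqr_ge0.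
  rewrite inE/= mulr1 => eX; rewrite -[leRHS]real_normK ?num_real//.
  by rewrite ler_sqr ?nnegrE// ltW.
- apply/measurable_EFinP; exact: measurable_indic.
- by rewrite lee_fin sqr_ge0.
Qed.

Section tail_limits.
Variables (G : set T) (Y : T -> R) (X : nat -> T -> R).
Hypotheses (mG : measurable G) (mY : measurable_fun setT Y).
Hypothesis mX : forall q, measurable_fun setT (X q).
Hypothesis XY : prob_cvg0 (fun q w => X q w - Y w).

(** Halving the threshold absorbs the error of approximation. *)
Lemma tail_limit_le (e : R) (C : \bar R) : 0 < e ->
  (\forall q \near \oo, P (G `&` [set w | (e / 2 <= `|X q w|)%R]) <= C)%E ->
  (P (G `&` [set w | (e <= `|Y w|)%R]) <= C)%E.
Proof.
move=> e0 XC; have e20 : 0 < e / 2 by rewrite divr_gt0.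
apply/lee_addgt0Pr => dl dl0; near \oo => q.
have mXe := measurable_norm_ge (e / 2) (mX q).
have mXY : measurable_fun setT (fun w => X q w - Y w) by exact: measurable_funB.
have mXYe := measurable_norm_ge (e / 2) mXY.
apply: (@le_trans _ _ (P ((G `&` [set w | (e / 2 <= `|X q w|)%R]) `|`
                          [set w | (e / 2 <= `|X q w - Y w|)%R]))).
  apply: le_measure; rewrite ?inE//.
  - by apply: measurableI => //; exact: measurable_norm_ge.
  - by apply: measurableU => //; exact: measurableI.
  move=> w /= [Gw eY]; have [?|Xe] := leP (e / 2) `|X q w|; [by left|right].
  have := ler_normD (X q w) (Y w - X q w); rewrite subrKC distrC; lra.
apply: (le_trans (measureU2 _ _ _)) => //; first exact: measurableI.
apply: leeD; first by near: q.
by near: q; exact: XY.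
Unshelve. all: by end_near. Qed.

Lemma tail_limit_ge (e : R) (C : \bar R) : 0 < e ->
  (\forall q \near \oo, C <= P (G `&` [set w | (2 * e <= `|X q w|)%R]))%E ->
  (C <= P (G `&` [set w | (e <= `|Y w|)%R]))%E.
Proof.
move=> e0 CX.
apply/lee_addgt0Pr => dl dl0; near \oo => q.
have mXe := measurable_norm_ge (2 * e) (mX q).
have mYe := measurable_norm_ge e mY.
have mXY : measurable_fun setT (fun w => X q w - Y w) by exact: measurable_funB.
have mXYe := measurable_norm_ge e mXY.
apply: (@le_trans _ _ (P (G `&` [set w | (2 * e <= `|X q w|)%R]))); first by near: q.
apply: (@le_trans _ _ (P ((G `&` [set w | (e <= `|Y w|)%R]) `|`
                          [set w | (e <= `|X q w - Y w|)%R]))).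
  apply: le_measure; rewrite ?inE//.
  - exact: measurableI.
  - by apply: measurableU => //; exact: measurableI.
  move=> w /= [Gw eX]; have [?|Ye] := leP e `|Y w|; [by left|right].
  have := ler_normD (Y w) (X q w - Y w); rewrite subrKC; lra.
apply: (le_trans (measureU2 _ _ _)) => //; first exact: measurableI.
apply: leeD => //.
by near: q; exact: XY.
Unshelve. all: by end_near. Qed.
End tail_limits.
End convergence_in_probability.

(** * Increments of Wiener integrals *)

Section step_algebra.
Context (R : realType).

Definition neg_step (phi : @step R) : @step R := [seq (- p.1, p.2) | p <- phi].

Lemma neg_step_on t (phi : @step R) : step_on t phi -> step_on t (neg_step phi).
Proof.
by move=> /allP phiP; apply/allP => _ /mapP[p pphi ->]; exact: phiP pphi.
Qed.

Lemma cat_step_on t (phi psi : @step R) :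
  step_on t phi -> step_on t psi -> step_on t (phi ++ psi).
Proof. by rewrite /step_on all_cat => -> ->. Qed.

Lemma step_fun_cat (phi psi : @step R) x :
  step_fun (phi ++ psi) x = step_fun phi x + step_fun psi x.
Proof. exact: big_cat. Qed.

Lemma step_fun_neg (phi : @step R) x : step_fun (neg_step phi) x = - step_fun phi x.
Proof.
by rewrite /step_fun big_map -sumrN; apply: eq_bigr => p _; rewrite mulNr.
Qed.

Lemma step_fun_clip (s x : R) (phi : @step R) :
  step_fun (clip_step s phi) x = if s < x then step_fun phi x else 0.
Proof.
rewrite /step_fun big_map; case: ifPn => [sx|]; last first.
  move=> /negbTE sx; rewrite big1// => p _.
  by rewrite indicE mem_setE in_itv/= gt_max sx andbF mulr0.
apply: eq_bigr => p _; rewrite !indicE !mem_setE !in_itv/= gt_max le_max.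
by rewrite sx andbT (leNgt x s) sx orbF.
Qed.

Lemma step_fun_gt (t x : R) (phi : @step R) : step_on t phi -> t < x ->
  step_fun phi x = 0.
Proof.
move=> /allP phiP tx; rewrite /step_fun big_seq big1// => p /phiP/andP[_ vt].
by rewrite indicE mem_setE in_itv/= [x <= _]leNgt (le_lt_trans vt tx) andbF mulr0.
Qed.

Context d (T : measurableType d).

Lemma step_integral_cat (W : R -> T -> R) (phi psi : @step R) w :
  step_integral W (phi ++ psi) w = step_integral W phi w + step_integral W psi w.
Proof. exact: big_cat. Qed.

Lemma step_integral_neg (W : R -> T -> R) (phi : @step R) w :
  step_integral W (neg_step phi) w = - step_integral W phi w.
Proof.
by rewrite /step_integral big_map -sumrN; apply: eq_bigr => p _; rewrite mulNr.
Qed.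

Lemma clip_step0 t (phi : @step R) : step_on t phi -> clip_step 0 phi = phi.
Proof.
move=> /allP phiP; rewrite -[RHS]map_id; apply/eq_in_map => -[a [u v]] /phiP/=.
by move=> /andP[/andP[u0 uv] _]; rewrite !max_l// (le_trans u0).
Qed.
End step_algebra.

Section square_integrals.
Context (R : realType).
Local Notation mu := (@lebesgue_measure R).

(** Stated with two domains since the energy of f is needed on A only, while the
    error g is controlled on a larger D. *)
Lemma sqr_integral_comparison (A D : set R) (f g h : R -> R) :
  measurable A -> measurable D -> A `<=` D ->
  measurable_fun D f -> measurable_fun D g -> measurable_fun A h ->
  (forall x, A x -> `|h x| <= `|f x| + `|g x|) ->
  (\int[mu]_(x in A) (h x ^+ 2)%:E <=
   2%:E * \int[mu]_(x in A) (f x ^+ 2)%:E + 2%:E * \int[mu]_(x in D) (g x ^+ 2)%:E)%E.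
Proof.
move=> mA mD AD mf mg mh hfg.
have msq E (k : R -> R) : measurable_fun E k -> measurable_fun E (fun x => (k x ^+ 2)%:E).
  by move=> mk; apply/measurable_EFinP; exact: measurable_funX.
have mfA := measurable_funS mD AD mf.
have mgA := measurable_funS mD AD mg.
have sq0 (k : R -> R) x : (0 <= (k x ^+ 2)%:E)%E by rewrite lee_fin sqr_ge0.
apply: (@le_trans _ _ (\int[mu]_(x in A) (2%:E * (f x ^+ 2)%:E + 2%:E * (g x ^+ 2)%:E)))%E.
  apply: ge0_le_integral => //.
  - exact: msq.
  - by apply: emeasurable_funD; apply: emeasurable_funM => //; exact: msq.
  move=> x Ax; rewrite -!EFinM -EFinD lee_fin.
  rewrite -(real_normK (num_real (h x))) -(real_normK (num_real (f x))) -(real_normK (num_real (g x))).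
  apply: (@le_trans _ _ ((`|f x| + `|g x|) ^+ 2)).
    by rewrite ler_sqr ?nnegrE ?addr_ge0//; exact: hfg.
  rewrite -subr_ge0.
  have -> : 2 * `|f x| ^+ 2 + 2 * `|g x| ^+ 2 - (`|f x| + `|g x|) ^+ 2 =
     (`|f x| - `|g x|) ^+ 2 by ring.
  exact: sqr_ge0.
rewrite ge0_integralD//; last 4 first.
- by move=> x _; rewrite mule_ge0.
- by apply: emeasurable_funM => //; exact: msq.
- by move=> x _; rewrite mule_ge0.
- by apply: emeasurable_funM => //; exact: msq.
rewrite !ge0_integralZl//; try exact: msq.
apply: leeD => //; apply: lee_wpmul2l => //.
by apply: ge0_subset_integral => //; exact: msq.
Qed.

End square_integrals.

Section wiener_integrals.
Context (R : realType) d (T : measurableType d) (P : probability T R)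
  (F : R -> set (set T)) (n : nat) (B : R -> T -> 'cV[R]_n).
Hypotheses (FF : is_filtration F) (BB : brownian_motion P F B).
Local Notation mu := (@lebesgue_measure R).
Variables (f : 'I_n -> R -> R) (M : 'I_n -> R -> T -> R).
Hypothesis mf : forall j (t : R), 0 <= t -> measurable_fun `[0, t] (f j).
Hypothesis itoM : forall j (t : R), 0 <= t ->
  is_ito_integral P (fun s w => B s w j ord0) (f j) t (M j t).

(** One coordinate of the integral of sigma against the Brownian vector: f j and
    M j are the j-th entries of a row of sigma and their integrals. *)
Definition wiener (t : R) (w : T) : R := \sum_j M j t w.

(** The variance of the increment of the integral from s to t. *)
Definition energy (s t : R) : \bar R :=
  (\sum_j \int[mu]_(x in `]s, t]) (f j x ^+ 2)%:E)%E.

Lemma measurable_wiener (t : R) : 0 <= t -> measurable_fun setT (wiener t).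
Proof. by move=> t0; apply: measurable_sum => j; case: (itoM j t0). Qed.

Let sF (t : R) : 0 <= t -> sigma_algebra setT (F t). Proof. by case: FF => + _ _; apply. Qed.
Let mF (t : R) : 0 <= t -> F t `<=` measurable. Proof. by case: FF => _ + _; apply. Qed.

Lemma measurable_step_sum (t : R) (phi : 'I_n -> @step R) : 0 <= t ->
  (forall j, step_on t (phi j)) -> measurable_fun setT (step_sum B phi).
Proof.
move=> t0 on_phi; apply: measurable_sum => j.
apply: (sub_measurable_fun (mF t0)).
exact: (step_integral_sub_measurable FF BB).
Qed.

Lemma step_energy_fin (phi : 'I_n -> @step R) (s t : R) : s <= t ->
  (forall j, step_on t (phi j)) ->
  exists2 v : R, 0 <= v & step_energy phi s t = v%:E.
Proof.
move=> st on_phi.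
have [ts [pts lts rphi]] := common_grid st on_phi.
have E : step_energy phi s t =
    (\sum_j grid_sum (fun x => step_fun (phi j) x ^+ 2) idfun s ts)%:E.
  rewrite -sumEFin; apply: eq_bigr => j _.
  by rewrite (grid_energy_step pts)//; [rewrite lts|move=> p; exact: rphi].
exists (\sum_j grid_sum (fun x => step_fun (phi j) x ^+ 2) idfun s ts) => //.
rewrite -lee_fin -E; apply: sume_ge0 => j _; apply: integral_ge0 => x _.
by rewrite lee_fin sqr_ge0.
Qed.

(** Small energy forces a small integral, by the Gaussian tail bound. *)
Lemma step_sum_prob_cvg0 (phi : nat -> 'I_n -> @step R) (t : R) : 0 <= t ->
  (forall q j, step_on t (phi q j)) ->
  (forall dl : R, 0 < dl -> \forall q \near \oo, (step_energy (phi q) 0 t <= dl%:E)%E) ->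
  prob_cvg0 P (fun q => step_sum B (phi q)).
Proof.
move=> t0 on_phi phi0 e dl e0 dl0.
have v'0 : 0 < dl * e ^+ 2 / 4 by rewrite divr_gt0// mulr_gt0// exprn_gt0.
near=> q.
have [v v0 vE] := step_energy_fin t0 (on_phi q).
have vv' : v <= dl * e ^+ 2 / 4 by rewrite -lee_fin -vE; near: q; exact: phi0.
have mgf : conditional_mgf P setT v (step_sum B (phi q)).
  move=> k; have := step_mgf FF BB k (lexx 0) t0 (on_phi q) _ vE.
  rewrite (_ : (fun j => clip_step 0 (phi q j)) = phi q).
    by apply; case: (sF (lexx 0)) => h0 hC _; rewrite -(setD0 setT); exact: hC.
  by apply/funext => j; exact: clip_step0 (on_phi q j).
have := chernoff_norm measurableT (measurable_step_sum t0 (on_phi q)) mgf e0 vv' v'0.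
rewrite setTI => /le_trans; apply.
rewrite probability_setT mul1e lee_fin.
set x := e ^+ 2 / (2 * _).
have x0 : 0 < x by rewrite divr_gt0 ?exprn_gt0// mulr_gt0.
rewrite expRN -ler_pdivlMl// invf_ple ?posrE ?expR_gt0//; last by rewrite mulr_gt0// invr_gt0.
apply: (le_trans _ (expR_ge1Dx x)).
suff -> : (2^-1 * dl)^-1 = x by rewrite lerDr.
by rewrite /x; field; rewrite !gt_eqF.
Unshelve. all: by end_near. Qed.

Let l2_error (phi : 'I_n -> nat -> @step R) (t : R) q : \bar R :=
  (\sum_j \int[mu]_(x in `[0%R, t]) ((step_fun (phi j q) x - f j x) ^+ 2)%:E)%E.

Let l2_error_near (phi : 'I_n -> nat -> @step R) (t : R) :
  (forall j, ((\int[mu]_(x in `[0%R, t]) ((step_fun (phi j q) x - f j x) ^+ 2)%:E)%E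
     @[q --> \oo] --> 0%E)) ->
  forall dl : R, 0 < dl -> \forall q \near \oo, (l2_error phi t q <= dl%:E)%E.
Proof.
move=> phi0 dl dl0.
have dln0 : 0 < dl / n.+1%:R by rewrite divr_gt0.
have : \forall q \near \oo, forall j, (\int[mu]_(x in `[0%R, t])
    ((step_fun (phi j q) x - f j x) ^+ 2)%:E <= (dl / n.+1%:R)%:E)%E.
  by apply: filter_forall => j; exact: cvge0_near_le.
apply: filterS => q errq.
apply: (@le_trans _ _ (\sum_(j < n) (dl / n.+1%:R)%:E)%E).
  by apply: lee_sum => j _; exact: errq.
rewrite sumEFin lee_fin sumr_const card_ord -[leLHS]mulr_natr mulrAC.
by rewrite ler_pdivrMr// ler_wpM2l ?ler_nat// ltW.
Qed.

(** The steps phit approximating the integral up to t also approximate its increment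
    from s once they are clipped at s.  The difference is the integral of the
    step function chi below, which vanishes after s and whose energy before s
    is at most twice the sum of the errors of two approximations of f on [0, s]: the
    one from phit and the one from the steps phis that approximate up to s. *)
Lemma wiener_approx (s t : R) : 0 <= s -> s <= t ->
  exists psi : nat -> 'I_n -> @step R,
  [/\ forall q j, step_on t (psi q j),
      prob_cvg0 P (fun q w => step_sum B (fun j => clip_step s (psi q j)) w -
        (wiener t w - wiener s w)) &
      forall dl : R, 0 < dl -> \forall q \near \oo,
        (step_energy (psi q) s t <= 2%:E * energy s t + dl%:E)%E /\
        (energy s t <= 2%:E * step_energy (psi q) s t + dl%:E)%E].
Proof.
move=> s0 st; have t0 := le_trans s0 st.
have /choice[phit phitP] : forall j, exists phi : nat -> @step R, _ :=
  fun j => (itoM j t0).2.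
have /choice[phis phisP] : forall j, exists phi : nat -> @step R, _ :=
  fun j => (itoM j s0).2.
have on_t j q : step_on t (phit j q) by have [] := phitP j.
have on_s j q : step_on s (phis j q) by have [] := phisP j.
have on_st j q : step_on t (phis j q).
  apply/allP => p pphi; have /allP/(_ _ pphi)/andP[/andP[-> ->] vs] := on_s j q.
  exact: le_trans st.
have err_t : forall dl : R, 0 < dl -> \forall q \near \oo, (l2_error phit t q <= dl%:E)%E.
  by apply: l2_error_near => j; case: (phitP j).
have err_s : forall dl : R, 0 < dl -> \forall q \near \oo, (l2_error phis s q <= dl%:E)%E.
  by apply: l2_error_near => j; case: (phisP j).
have mphi (D : set R) (phi : @step R) : measurable_fun D (step_fun phi).
  by apply: measurable_funTS; exact: measurable_step_fun.
have sub_oc (a b : R) : 0 <= a -> `]a, b] `<=` (`[0, b] : set R).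
  move=> a0 x /=; rewrite !in_itv/= => /andP[ax ->]; rewrite andbT.
  by rewrite (le_trans a0)// ltW.
exists (fun q j => phit j q); split.
- by move=> q j; have [] := phitP j.
- pose chi q j := clip_step s (phit j q) ++ neg_step (phit j q) ++ phis j q.
  have on_chi q j : step_on t (chi q j).
    apply: cat_step_on; first by apply: clip_step_on => //; exact: on_t.
    apply: cat_step_on; last exact: on_st.
    by apply: neg_step_on; exact: on_t.
  (* chi is minus phit plus phis on ]0, s] and vanishes elsewhere. *)
  have chiE q j x : step_fun (chi q j) x =
      if s < x then 0 else step_fun (phis j q) x - step_fun (phit j q) x.
    rewrite !step_fun_cat step_fun_clip step_fun_neg; case: ifPn => sx.
      by rewrite (step_fun_gt (on_s j q))// addr0 subrr.
    by rewrite add0r addrC.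
  have chi_energy q : (step_energy (chi q) 0 t <=
      2%:E * l2_error phis s q + 2%:E * l2_error phit t q)%E.
    rewrite /step_energy /l2_error !ge0_sume_distrr; last 2 first.
    + by move=> j _; apply: integral_ge0 => x _; rewrite lee_fin sqr_ge0.
    + by move=> j _; apply: integral_ge0 => x _; rewrite lee_fin sqr_ge0.
    rewrite -big_split/=; apply: lee_sum => j _.
    apply: (@le_trans _ _ (\int[mu]_(x in `]0%R, s]) (step_fun (chi q j) x ^+ 2)%:E)%E).
      rewrite (@itv_bndbnd_setU _ _ (BRight 0) (BRight s) (BRight t))//.
      rewrite ge0_integral_setU//=; last 3 first.
      + by apply/measurable_EFinP; apply: measurable_funX; exact: mphi.
      + by move=> x _; rewrite lee_fin sqr_ge0.
      + apply/disj_setPS => x /=; rewrite !in_itv/= => -[/andP[_ xt] /andP[tx _]].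
        by have := lt_le_trans tx xt; rewrite ltxx.
      rewrite [X in (_ + X)%E](_ : _ = 0%E) ?adde0//.
      rewrite (eq_integral (cst 0%E)) ?integral0// => x /set_mem/=.
      by rewrite in_itv/= chiE => /andP[-> _]; rewrite expr0n.
    apply: (le_trans (@sqr_integral_comparison _ `]0, s] `[0, t]
      (fun x => step_fun (phis j q) x - f j x) (fun x => step_fun (phit j q) x - f j x)
      (step_fun (chi q j)) _ _ _ _ _ _ _)) => //.
    + apply: (subset_trans (sub_oc _ _ (lexx 0))).
      by apply: subset_itvl; rewrite bnd_simp.
    + by apply: measurable_funB; [exact: mphi|exact: mf].
    + by apply: measurable_funB; [exact: mphi|exact: mf].
    + move=> x /=; rewrite in_itv/= chiE => /andP[_ xs]; rewrite ltNge xs/=.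
      rewrite (_ : _ - _ = (step_fun (phis j q) x - f j x) - (step_fun (phit j q) x - f j x)).
        exact: ler_normB.
      by ring.
    apply: leeD => //; apply: lee_wpmul2l => //; apply: ge0_subset_integral => //.
    + apply/measurable_EFinP; apply: measurable_funX; apply: measurable_funB; [exact: mphi|exact: mf].
    + by move=> x _; rewrite lee_fin sqr_ge0.
    + exact: sub_oc.
  have chi0 : prob_cvg0 P (fun q => step_sum B (chi q)).
    apply: (step_sum_prob_cvg0 t0) => // dl dl0.
    have dl40 : 0 < dl / 4 by rewrite divr_gt0.
    near=> q; apply: (le_trans (chi_energy q)).
    rewrite (_ : dl%:E = 2%:E * (dl / 4)%:E + 2%:E * (dl / 4)%:E)%E; last first.
      by rewrite -!EFinM -EFinD; congr EFin; field.
    apply: leeD; apply: lee_wpmul2l => //; near: q; [exact: err_s|exact: err_t].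
  pose X u (phi : 'I_n -> nat -> @step R) j q w :=
    step_integral (fun t w => B t w j ord0) (phi j q) w - M j u w.
  have mX u phi (u0 : 0 <= u) (on_phi : forall j q, step_on u (phi j q)) j q :
      measurable_fun setT (X u phi j q).
    apply: measurable_funB; last by case: (itoM j u0).
    apply: (sub_measurable_fun (mF u0)).
    exact: (step_integral_sub_measurable FF BB).
  have X0t : prob_cvg0 P (fun q w => \sum_j X t phit j q w).
    apply: prob_cvg0_sum => [j q|j]; first exact: mX.
    by apply: prob_cvg0_L2 => [q|]; [exact: mX|case: (phitP j)].
  have X0s : prob_cvg0 P (fun q w => \sum_j X s phis j q w).
    apply: prob_cvg0_sum => [j q|j]; first exact: mX.
    by apply: prob_cvg0_L2 => [q|]; [exact: mX|case: (phisP j)].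
  have mXt q : measurable_fun setT (fun w => \sum_j X t phit j q w).
    by apply: measurable_sum => j; exact: mX.
  have mXs q : measurable_fun setT (fun w => \sum_j X s phis j q w).
    by apply: measurable_sum => j; exact: mX.
  have mchi q : measurable_fun setT (step_sum B (chi q)) by exact: measurable_step_sum t0 _.
  rewrite (_ : (fun q w => _) = (fun q w => step_sum B (chi q) w +
     (\sum_j X t phit j q w + - \sum_j X s phis j q w))); last first.
    apply/funext => q; apply/funext => w.
    rewrite /step_sum /wiener -!sumrB -big_split/=; apply: eq_bigr => j _.
    by rewrite !step_integral_cat step_integral_neg /X; ring.
  apply: prob_cvg0D => //.
    by move=> q; apply: measurable_funD => //; exact: measurableT_comp.
  apply: prob_cvg0D => //; last exact: prob_cvg0N.
  by move=> q; exact: measurableT_comp.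
- move=> dl dl0; have dl20 : 0 < dl / 2 by rewrite divr_gt0.
  have mfst j : measurable_fun `]s, t] (f j).
    by apply: measurable_funS (mf j t0) => //; exact: sub_oc.
  near=> q.
  have errq : (l2_error phit t q <= (dl / 2)%:E)%E by near: q; exact: err_t.
  have err2 : (2%:E * l2_error phit t q <= dl%:E)%E.
    rewrite (_ : dl%:E = 2%:E * (dl / 2)%:E)%E; first exact: lee_wpmul2l.
    by rewrite -EFinM; congr EFin; field.
  have cmp (g h : 'I_n -> R -> R) : (forall j, measurable_fun `]s, t] (h j)) ->
      (forall j, measurable_fun `[0, t] (g j)) ->
      (forall j x, `|h j x| <= `|g j x| + `|step_fun (phit j q) x - f j x|) ->
      (\sum_j \int[mu]_(x in `]s, t]) (h j x ^+ 2)%:E <=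
       2%:E * (\sum_j \int[mu]_(x in `]s, t]) (g j x ^+ 2)%:E) + dl%:E)%E.
    move=> mh mg hg.
    apply: (@le_trans _ _ (2%:E * (\sum_j \int[mu]_(x in `]s, t]) (g j x ^+ 2)%:E)
       + 2%:E * l2_error phit t q)%E); last exact: leeD.
    rewrite /l2_error !ge0_sume_distrr; last 2 first.
    + by move=> j _; apply: integral_ge0 => x _; rewrite lee_fin sqr_ge0.
    + by move=> j _; apply: integral_ge0 => x _; rewrite lee_fin sqr_ge0.
    rewrite -big_split/=; apply: lee_sum => j _.
    apply: sqr_integral_comparison => //; first exact: sub_oc.
    by apply: measurable_funB; [exact: mphi|exact: mf].
  split.
    apply: (cmp f (fun j => step_fun (phit j q))) => // [j|j x]; first exact: mf.
    have := ler_normD (f j x) (step_fun (phit j q) x - f j x).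
    by rewrite subrKC.
  apply: (cmp (fun j => step_fun (phit j q)) f) => // j x.
  have := ler_normB (step_fun (phit j q) x) (step_fun (phit j q) x - f j x).
  by rewrite subKr.
Unshelve. all: by end_near. Qed.

(** Shows that the integral up to t is, up to small probabilities, known at time t. *)
Lemma wiener_limit_of_steps (t : R) : 0 <= t ->
  exists psi : nat -> 'I_n -> @step R,
  (forall q j, step_on t (psi q j)) /\
  prob_cvg0 P (fun q w => step_sum B (psi q) w - wiener t w).
Proof.
move=> t0.
have /choice[phit phitP] : forall j, exists phi : nat -> @step R, _ :=
  fun j => (itoM j t0).2.
exists (fun q j => phit j q); split; first by move=> q j; case: (phitP j).
rewrite (_ : (fun q w => _) = (fun q w => \sum_j
    (step_integral (fun t w => B t w j ord0) (phit j q) w - M j t w))); last first.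
  by apply/funext => q; apply/funext => w; rewrite sumrB.
have mX j q : measurable_fun setT (fun w =>
    step_integral (fun t w => B t w j ord0) (phit j q) w - M j t w).
  apply: measurable_funB; last by case: (itoM j t0).
  apply: (sub_measurable_fun (mF t0)).
  by apply: (step_integral_sub_measurable FF BB) => //; case: (phitP j).
apply: (@prob_cvg0_sum _ _ _ _ _ (fun j q w =>
    step_integral (fun t w => B t w j ord0) (phit j q) w - M j t w)) => [j q|j] //.
by apply: prob_cvg0_L2 => //; case: (phitP j).
Qed.

(** The factor 24 is 2 * 3 * 4: the approximating steps have at most three times
    the energy, and the threshold is halved in the limit. *)
Lemma wiener_tail (s t v e : R) (G : set T) : 0 <= s -> s <= t -> F s G ->
  0 < e -> 0 < v -> (energy s t <= v%:E)%E ->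
  (P (G `&` [set w | (e <= `|wiener t w - wiener s w|)%R]) <=
   P G * (2 * expR (- (e ^+ 2 / (24 * v))))%:E)%E.
Proof.
move=> s0 st FG e0 v0 Ev; have t0 := le_trans s0 st.
have [psi [on_psi psi_cvg psi_energy]] := wiener_approx s0 st.
have mG : measurable G by exact: mF FG.
have mX q : measurable_fun setT (step_sum B (fun j => clip_step s (psi q j))).
  by apply: (measurable_step_sum t0) => j; exact: clip_step_on.
have mY : measurable_fun setT (fun w => wiener t w - wiener s w).
  by apply: measurable_funB; exact: measurable_wiener.
apply: (tail_limit_le mG mY mX psi_cvg e0); near=> q.
have [Eq _] : (step_energy (psi q) s t <= 2%:E * energy s t + v%:E)%E /\
    (energy s t <= 2%:E * step_energy (psi q) s t + v%:E)%E.
  by near: q; exact: psi_energy.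
have [vq vq0 vqE] := step_energy_fin st (on_psi q).
have vq3 : vq <= 3 * v.
  rewrite -lee_fin -vqE (le_trans Eq)//.
  rewrite (_ : 3 * v = 2 * v + v); last by ring.
  by rewrite [leRHS]EFinD; apply: leeD => //; rewrite [leRHS]EFinM; apply: lee_wpmul2l.
have mgf : conditional_mgf P G vq (step_sum B (fun j => clip_step s (psi q j))).
  by move=> k; exact: (step_mgf FF BB k s0 st (on_psi q) FG vqE).
have v30 : 0 < 3 * v by rewrite mulr_gt0.
have e20 : 0 < e / 2 by rewrite divr_gt0.
have := chernoff_norm mG (mX q) mgf e20 vq3 v30.
suff -> : (e / 2) ^+ 2 / (2 * (3 * v)) = e ^+ 2 / (24 * v) by [].
by field; rewrite gt_eqF.
Unshelve. all: by end_near. Qed.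

(** The factor 256 is 16 * 4 * 4: the threshold is doubled before passing to
    the limit, and the approximating steps have at least a quarter of the
    energy. *)
Lemma wiener_anticoncentration (s t v e : R) (G : set T) : 0 <= s -> s <= t ->
  F s G -> 0 < e -> 0 < v -> v <= e ^+ 2 -> energy s t = v%:E ->
  (P G * (expR (- (256 * e ^+ 2 / v)) / 4)%:E <=
   P (G `&` [set w | (e <= `|wiener t w - wiener s w|)%R]))%E.
Proof.
move=> s0 st FG e0 v0 ve Ev; have t0 := le_trans s0 st.
have [psi [on_psi psi_cvg psi_energy]] := wiener_approx s0 st.
have mG : measurable G by exact: mF FG.
have mX q : measurable_fun setT (step_sum B (fun j => clip_step s (psi q j))).
  by apply: (measurable_step_sum t0) => j; exact: clip_step_on.
have mY : measurable_fun setT (fun w => wiener t w - wiener s w).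
  by apply: measurable_funB; exact: measurable_wiener.
have v20 : 0 < v / 2 by rewrite divr_gt0.
apply: (tail_limit_ge mG mY mX psi_cvg e0); near=> q.
have [Eq1 Eq2] : (step_energy (psi q) s t <= 2%:E * energy s t + (v / 2)%:E)%E /\
    (energy s t <= 2%:E * step_energy (psi q) s t + (v / 2)%:E)%E.
  by near: q; exact: psi_energy.
have [vq vq0 vqE] := step_energy_fin st (on_psi q).
move: Eq1 Eq2; rewrite Ev vqE -!EFinM -!EFinD !lee_fin => Eq1 Eq2.
have vq_gt0 : 0 < vq by lra.
have mgf : conditional_mgf P G vq (step_sum B (fun j => clip_step s (psi q j))).
  by move=> k; exact: (step_mgf FF BB k s0 st (on_psi q) FG vqE).
have e20 : 0 < 2 * e by rewrite mulr_gt0.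
have vqe : vq <= 4 * (2 * e) ^+ 2.
  rewrite (_ : 4 * (2 * e) ^+ 2 = 16 * e ^+ 2); last by ring.
  have := sqr_ge0 e; lra.
have H := paley_zygmund mG (mX q) mgf e20 vq_gt0 vqe.
apply: (@le_trans _ _ (P G * (expR (- (16 * (2 * e) ^+ 2 / vq)) / 4)%:E)%E).
  apply: lee_wpmul2l => //; rewrite lee_fin ler_wpM2r// ler_expR lerN2.
  rewrite (_ : 16 * (2 * e) ^+ 2 = 64 * e ^+ 2); last by ring.
  rewrite ler_pdivrMr// mulrAC ler_pdivlMr//.
  have := sqr_ge0 e; nra.
apply: (le_trans H); apply: le_measure; rewrite ?inE.
- by apply: measurableI => //; exact: measurable_geset.
- by apply: measurableI => //; exact: measurable_norm_ge.
by apply: setIS => w /= /le_trans; apply; exact: ler_norm.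
Unshelve. all: by end_near. Qed.

End wiener_integrals.

(** * Completing the filtration *)

Section approximable_events.
Context d (T : measurableType d) (R : realType) (P : probability T R).

Lemma probabilityD_le (A B : set T) : measurable A -> measurable B ->
  `|fine (P A) - fine (P B)| <= fine (P (A `+` B)).
Proof.
move=> mA mB.
have mY : measurable (A `+` B) by apply: measurableU; exact: measurableD.
have half (C D : set T) : measurable C -> measurable D -> measurable (C `+` D) ->
    fine (P C) <= fine (P D) + fine (P (C `+` D)).
  move=> mC mD mCD; rewrite -lee_fin EFinD !fineK ?fin_num_measure//.
  apply: le_trans (measureU2 _ _ _) => //.
  apply: le_measure; rewrite ?inE//; first exact: measurableU.
  by move=> x Cx; have [Dx|nDx] := pselect (D x); [left|right; left].
have h1 := half A B mA mB mY.
have h2 : fine (P B) <= fine (P A) + fine (P (A `+` B)).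
  by rewrite setYC; apply: half => //; rewrite setYC.
by rewrite ler_norml; apply/andP; split; lra.
Qed.

Variable F : R -> set (set T).
Hypothesis FF : is_filtration F.

(** An integral that is a limit in probability of variables known at time t need
    not be measurable for F t, which contains no null sets beyond its own.
    Events that can be approximated in probability by events of F t form a
    sigma-algebra for which it is measurable, and for which B is still a
    Brownian motion. *)
Definition approximable (t : R) : set (set T) :=
  [set E | measurable E /\
    forall dl : R, 0 < dl -> exists2 G, F t G & (P (E `+` G) <= dl%:E)%E].

Let sF (t : R) : 0 <= t -> sigma_algebra setT (F t). Proof. by case: FF => + _ _; apply. Qed.
Let mF (t : R) : 0 <= t -> F t `<=` measurable. Proof. by case: FF => _ + _; apply. Qed.

Let mY (A B : set T) : measurable A -> measurable B -> measurable (A `+` B).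
Proof. by move=> mA mB; apply: measurableU; exact: measurableD. Qed.

Lemma sub_approximable (t : R) : 0 <= t -> F t `<=` approximable t.
Proof.
move=> t0 G FG; split; first exact: mF FG.
by move=> dl dl0; exists G => //; rewrite /setY setDv setU0 measure0 lee_fin ltW.
Qed.

Let approximableC (t : R) E : 0 <= t -> approximable t E -> approximable t (setT `\` E).
Proof.
move=> t0 [mE aE]; split; first exact: measurableD.
move=> dl /aE[G FG EG]; exists (setT `\` G); first by case: (sF t0) => _ + _; apply.
apply: le_trans EG; rewrite le_eqVlt; apply/orP; left; apply/eqP; congr (P _).
by apply/seteqP; split => x; rewrite /setY/=;
  have [|] := pselect (E x); have [|] := pselect (G x); tauto.
Qed.

Let approximableU (t : R) A B : 0 <= t -> approximable t A -> approximable t B ->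
  approximable t (A `|` B).
Proof.
move=> t0 [mA aA] [mB aB]; split; first exact: measurableU.
move=> dl dl0; have dl20 : 0 < dl / 2 by rewrite divr_gt0.
have [G FG AG] := aA _ dl20; have [H FH BH] := aB _ dl20.
exists (G `|` H).
  rewrite -(sigma_algebra_id (sF t0)).
  by apply: (@measurableU _ (g_sigma_algebraType (F t))); apply: sub_sigma_algebra.
have mG := mF t0 FG; have mH := mF t0 FH.
apply: (@le_trans _ _ (P ((A `+` G) `|` (B `+` H)))).
  apply: le_measure; rewrite ?inE; [by apply: mY; exact: measurableU|by apply: measurableU; exact: mY|].
  by move=> x /=; tauto.
apply: (le_trans (measureU2 _ (mY mA mG) (mY mB mH))).
by rewrite [dl]splitr EFinD; exact: leeD.
Qed.

(** A countable union differs little from a finite one, by continuity of P. *)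
Lemma sigma_algebra_approximable (t : R) : 0 <= t -> sigma_algebra setT (approximable t).
Proof.
move=> t0; split.
- by apply: sub_approximable => //; case: (sF t0).
- by move=> A; exact: approximableC.
move=> A aA; have mA k : measurable (A k) by case: (aA k).
have mUA : measurable (\bigcup_k A k) by exact: bigcup_measurable.
split => // dl dl0; have dl20 : 0 < dl / 2 by rewrite divr_gt0.
pose A' N := \big[setU/set0]_(k < N) A k.
have aA' N : approximable t (A' N).
  rewrite /A'; elim: N => [|N IH]; first by rewrite big_ord0; apply: sub_approximable => //; case: (sF t0).
  by rewrite big_ord_recr; exact: approximableU.
have mA' N : measurable (A' N) by case: (aA' N).
have cvgA' : (P (\bigcup_k A k `\` A' N) @[N --> \oo] --> 0)%E.
  have -> : 0%E = P (\bigcap_N (\bigcup_k A k `\` A' N)).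
    rewrite (_ : \bigcap_N _ = set0) ?measure0//.
    apply/seteqP; split => // x; move=> Hx; have [[k _ Akx] _] := Hx 0%N I.
    have [_ +] := Hx k.+1 I; apply; rewrite /A' -bigcup_mkord; exists k => //=.
  apply: (@nonincreasing_cvg_mu _ _ _ P (fun N => \bigcup_k A k `\` A' N)).
  - by rewrite -ge0_fin_numE// fin_num_measure//; exact: measurableD.
  - by move=> N; exact: measurableD.
  - by apply: bigcapT_measurable => N; exact: measurableD.
  - move=> m N mN; apply/subsetPset; apply: setDS.
    rewrite /A' -!bigcup_mkord; apply: bigcup_subset => k /= km.
    exact: leq_trans mN.
near \oo => N.
have [_ /(_ _ dl20)[G FG AG]] := aA' N.
exists G => //; have mG := mF t0 FG.
apply: (@le_trans _ _ (P ((\bigcup_k A k `\` A' N) `|` (A' N `+` G)))).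
  apply: le_measure; rewrite ?inE; [by exact: mY|by apply: measurableU; [exact: measurableD|exact: mY]|].
  have A'A : A' N `<=` \bigcup_k A k.
    by rewrite /A' -bigcup_mkord; apply: bigcup_subset.
  by move=> x /=; have := A'A x; have [|] := pselect (A' N x); tauto.
apply: (le_trans (measureU2 _ _ _)) => //; [exact: measurableD|exact: mY|].
rewrite [dl]splitr EFinD; apply: leeD => //.
by near: N; exact: cvge0_near_le.
Unshelve. all: by end_near. Qed.

Lemma is_filtration_approximable : is_filtration approximable.
Proof.
split; first exact: sigma_algebra_approximable.
- by move=> t t0 E [].
move=> s t s0 st E [mE aE]; split=> // dl /aE[G FG EG]; exists G => //.
by case: FF => _ _ FS; exact: (FS s t s0 st).
Qed.

Variables (n : nat) (B : R -> T -> 'cV[R]_n).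
Hypothesis BB : brownian_motion P F B.

Lemma increment_sigma_measurable (s t : R) : 0 <= s -> s <= t ->
  increment_sigma B s t `<=` measurable.
Proof.
move=> s0 st; apply: smallest_sub; first exact: sigma_algebra_measurable.
move=> _ [j [U [mU ->]]]; rewrite -[X in measurable X]setTI.
exact: (measurable_increment FF BB).
Qed.

(** Independence survives because both sides of the product formula are
    continuous with respect to the distance P (E `+` G). *)
Lemma brownian_motion_approximable : brownian_motion P approximable B.
Proof.
case: (BB) => aB cB B0 indep law; split => //.
- by move=> t t0 i U mU; apply: sub_approximable => //; exact: aB.
move=> s t s0 st E D [mE aE] incD.
have mD := increment_sigma_measurable s0 (ltW st) incD.
have mED : measurable (E `&` D) by exact: measurableI.
rewrite -(fineK (fin_num_measure P _ mED)) -(fineK (fin_num_measure P _ mE)).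
rewrite -(fineK (fin_num_measure P _ mD)) -EFinM; congr EFin.
apply/eqP; rewrite -subr_eq0 -normr_le0; apply/ler_addgt0Pr => dl dl0; rewrite add0r.
have dl20 : 0 < dl / 2 by rewrite divr_gt0.
have [G FG EG] := aE _ dl20; have mG := mF s0 FG.
have mGD : measurable (G `&` D) by exact: measurableI.
have mEG : measurable (E `+` G) by exact: mY.
have pEG : fine (P (E `+` G)) <= dl / 2 by rewrite -lee_fin fineK// fin_num_measure.
have GD : fine (P (G `&` D)) = fine (P G) * fine (P D).
  by rewrite (indep s t s0 st G D FG incD) fineM ?fin_num_measure.
have h1 := probabilityD_le mE mG.
have h2 : `|fine (P (E `&` D)) - fine (P (G `&` D))| <= dl / 2.
  apply: (le_trans (probabilityD_le mED mGD)); apply: le_trans pEG.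
  apply: fine_le; rewrite ?fin_num_measure//; first exact: mY.
  apply: le_measure; rewrite ?inE//; first exact: mY.
  by move=> x /=; tauto.
set p := fine (P D) in GD *.
have p01 : 0 <= p <= 1.
  rewrite fine_ge0//= -lee_fin fineK ?fin_num_measure//; exact: probability_le1.
rewrite (_ : _ - _ = (fine (P (E `&` D)) - fine (P (G `&` D))) +
  (fine (P G) - fine (P E)) * p); last by rewrite GD; ring.
apply: (le_trans (ler_normD _ _)); rewrite [dl]splitr; apply: lerD => //.
rewrite normrM distrC (ger0_norm (andP p01).1).
apply: le_trans (le_trans h1 pEG).
by rewrite ler_piMr// (andP p01).2.
Qed.

(** It suffices to approximate the events a < Y.  Such an event differs from
    a + e < X q only if a < Y <= a + 2 e or if X q is at distance e of Y, and
    both become improbable. *)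
Lemma sub_measurable_prob_limit (t : R) (X : nat -> T -> R) (Y : T -> R) : 0 <= t ->
  measurable_fun setT Y -> (forall q, sub_measurable (F t) (X q)) ->
  prob_cvg0 P (fun q w => X q w - Y w) -> sub_measurable (approximable t) Y.
Proof.
move=> t0 mY' FX XY.
have sA := sigma_algebra_approximable t0.
apply/(sub_measurableP sA).
apply: (measurability (RGenOInfty.G (R := R))); first exact: RGenOInfty.measurableE.
move=> _ [_ [a ->] <-]; rewrite setTI.
rewrite /measurable/= (sigma_algebra_id sA).
have -> : Y @^-1` `]a, +oo[ = [set w | a < Y w].
  by apply/seteqP; split => w /=; rewrite in_itv/= andbT.
have mitv b : measurable [set w | a < Y w <= b].
  rewrite (_ : [set _ | _] = Y @^-1` `]a, b]).
    by rewrite -[X in measurable X]setTI; exact: mY'.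
  by apply/seteqP; split => w /=; rewrite in_itv.
have mgt : measurable [set w | a < Y w].
  rewrite (_ : [set _ | _] = Y @^-1` `]a, +oo[).
    by rewrite -[X in measurable X]setTI; exact: mY'.
  by apply/seteqP; split => w /=; rewrite in_itv/= andbT.
split=> // dl dl0; have dl20 : 0 < dl / 2 by rewrite divr_gt0.
have cvg_itv : (P [set w | (a < Y w <= a + N.+1%:R^-1)%R] @[N --> \oo] --> 0)%E.
  have -> : 0%E = P (\bigcap_N [set w | (a < Y w <= a + N.+1%:R^-1)%R]).
    rewrite (_ : \bigcap_N _ = set0) ?measure0//.
    apply/seteqP; split => // w Hw /=.
    have /andP[aY _] := Hw 0%N I.
    have Ya : Y w <= a.
      apply/ler_addgt0Pr => e e0; near \oo => N.
      have /andP[_] := Hw N I; move=> /le_trans; apply; rewrite lerD2l.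
      apply/ltW; near: N; exact: (near_infty_natSinv_lt (PosNum e0)).
    by have := lt_le_trans aY Ya; rewrite ltxx.
  apply: (@nonincreasing_cvg_mu _ _ _ P (fun N => [set w | a < Y w <= a + N.+1%:R^-1])) => //.
  - by rewrite -ge0_fin_numE// fin_num_measure.
  - exact: bigcapT_measurable.
  - move=> m N mN; apply/subsetPset => w /= /andP[-> /=] /le_trans; apply.
    by rewrite lerD2l lef_pV2 ?posrE// ler_nat.
near \oo => N.
pose e : R := N.+1%:R^-1 / 2.
have e0 : 0 < e by rewrite divr_gt0.
near \oo => q.
have mX := sub_measurable_fun (mF t0) (FX q).
exists [set w | a + e < X q w].
  rewrite (_ : [set _ | _] = X q @^-1` `]a + e, +oo[).
    exact: FX.
  by apply/seteqP; split => w /=; rewrite in_itv/= andbT.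
have mXe : measurable [set w | a + e < X q w].
  rewrite (_ : [set _ | _] = X q @^-1` `]a + e, +oo[).
    by rewrite -[X in measurable X]setTI; exact: mX.
  by apply/seteqP; split => w /=; rewrite in_itv/= andbT.
have mXY := measurable_norm_ge e (measurable_funB mX mY').
apply: (@le_trans _ _ (P ([set w | a < Y w <= a + N.+1%:R^-1] `|` [set w | e <= `|X q w - Y w|]))).
  apply: le_measure; rewrite ?inE; [exact: mY|exact: measurableU|].
  move=> w /=; rewrite (_ : N.+1%:R^-1 = e + e :> R); last by rewrite -splitr.
  move=> [[aY /negP]|[aX /negP]]; rewrite -leNgt => h.
    have [Ye|Ye] := leP (Y w) (a + (e + e)); first by left; rewrite aY.
    by right; rewrite distrC ler_normr; apply/orP; left; lra.
  by right; rewrite ler_normr; apply/orP; left; lra.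
apply: (le_trans (measureU2 _ _ _)) => //.
rewrite [dl]splitr EFinD; apply: leeD.
  by near: N; exact: cvge0_near_le.
by near: q; exact: XY.
Unshelve. all: by end_near. Qed.
End approximable_events.

(** * A maximal inequality and exponential moments from tails *)

Section ottaviani.
Context d (T : measurableType d) (R : realType) (P : probability T R).
Variables (F : R -> set (set T)) (W : R -> T -> R).
Hypothesis FF : is_filtration F.
Hypothesis FW : forall t : R, 0 <= t -> sub_measurable (F t) (W t).
Variables (s t v : R).
Hypotheses (s0 : 0 <= s) (st : s <= t).
Hypothesis tail : forall u G (e : R), s <= u -> u <= t -> F u G -> 0 < e ->
  (P (G `&` [set w | (e <= `|W t w - W u w|)%R]) <=
   P G * (2 * expR (- (e ^+ 2 / (24 * v))))%:E)%E.

Let sF (u : R) : 0 <= u -> sigma_algebra setT (F u). Proof. by case: FF => + _ _; apply. Qed.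
Let mF (u : R) : 0 <= u -> F u `<=` measurable. Proof. by case: FF => _ + _; apply. Qed.
Let leF (u u' : R) : 0 <= u -> u <= u' -> F u `<=` F u'. Proof. by case: FF => _ _; apply. Qed.

Let F_measurable u (E : set T) : 0 <= u ->
  F u E <-> (measurable : set (set (g_sigma_algebraType (F u)))) E.
Proof. by move=> u0; rewrite /measurable/= (sigma_algebra_id (sF u0)). Qed.

Let F_norm_ge u1 u2 u (e : R) : 0 <= u -> 0 <= u1 -> u1 <= u -> 0 <= u2 -> u2 <= u ->
  F u [set w | e <= `|W u1 w - W u2 w|].
Proof.
move=> u0 u10 u1u u20 u2u; apply/(F_measurable _ u0).
apply: measurable_norm_ge; apply: measurable_funB; apply/(sub_measurableP (sF u0)).
- by apply: (sub_measurable_le FF u10 u1u); exact: FW.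
- by apply: (sub_measurable_le FF u20 u2u); exact: FW.
Qed.

Variables (tau : nat -> R) (e : R).
Hypotheses (tau_nd : {homo tau : k l / (k <= l)%N >-> k <= l}).
Hypotheses (tau_s : forall k, s <= tau k) (tau_t : forall k, tau k <= t) (e0 : 0 < e).

Let hit k := [set w | exists2 l, (l < k)%N & 2 * e <= `|W (tau l) w - W s w|].
Let now k := [set w | 2 * e <= `|W (tau k) w - W s w|].
Let final := [set w | e <= `|W t w - W s w|].

Let hitS k : hit k.+1 = hit k `|` (now k `\` hit k).
Proof.
apply/seteqP; split => w /=.
  move=> [l]; rewrite ltnS leq_eqVlt => /orP[/eqP-> h|lk h]; last by left; exists l.
  by have [|?] := pselect (hit k w); [left|right].
by case=> [[l lk h]|[h _]]; [exists l => //; exact: ltnW|exists k].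
Qed.

Let F_hit k : F (tau k) (hit k).
Proof.
have tau0 l : 0 <= tau l := le_trans s0 (tau_s l).
elim: k => [|k IH].
  rewrite (_ : hit 0 = set0); first by case: (sF (tau0 0%N)).
  by apply/seteqP; split => w // [].
apply: (leF (tau0 k) (tau_nd (leqnSn k))).
apply/(F_measurable _ (tau0 k)); rewrite hitS; apply: measurableU.
  exact/(F_measurable _ (tau0 k)).
apply: measurableD; apply/(F_measurable _ (tau0 k)) => //.
exact: F_norm_ge.
Qed.

(** At the first time at which the path is at distance 2 e from its start, the past
    is given and the rest of the path moves by more than e with probability at
    most one half; hence hitting distance 2 e at all is at most twice as likely
    as ending at distance e. *)
Lemma ottaviani G k : F s G ->
  (P (G `&` hit k) <= P G * (4 * expR (- (e ^+ 2 / (24 * v))))%:E)%E.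
Proof.
move=> FG; have t0 := le_trans s0 st.
have mG : measurable G := mF s0 FG.
have tau0 l : 0 <= tau l := le_trans s0 (tau_s l).
set q := 2 * expR (- (e ^+ 2 / (24 * v))).
have mhit l : measurable (hit l) := mF (tau0 l) (F_hit l).
have mfinal : measurable final by apply: (mF t0); apply: F_norm_ge.
(* If q > 1 / 2, the right-hand side is at least P G. *)
have [qhalf|qhalf] := leP q 2^-1; last first.
  apply: (@le_trans _ _ (P G)).
    by apply: le_measure; rewrite ?inE//; exact: measurableI.
  rewrite -[leLHS]mule1; apply: lee_wpmul2l => //; rewrite lee_fin.
  move: qhalf; rewrite /q; lra.
suff : (P (G `&` hit k) <= 2%:E * P (G `&` hit k `&` final))%E.
  move=> /le_trans; apply.
  apply: (@le_trans _ _ (2%:E * P (G `&` final))%E).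
    apply: lee_wpmul2l => //; apply: le_measure; rewrite ?inE.
    - by apply: measurableI => //; exact: measurableI.
    - exact: measurableI.
    - by apply: setSI; exact: subIsetl.
  apply: (@le_trans _ _ (2%:E * (P G * q%:E))%E).
    by apply: lee_wpmul2l => //; exact: tail.
  rewrite muleCA; apply: lee_wpmul2l => //; rewrite -EFinM lee_fin /q; lra.
elim: k => [|k IH].
  rewrite (_ : hit 0 = set0) ?setI0 ?measure0 ?mule_ge0//.
  by apply/seteqP; split => w // [].
pose A := G `&` (now k `\` hit k).
have FA : F (tau k) A.
  apply/(F_measurable _ (tau0 k)); apply: measurableI.
    by apply/(F_measurable _ (tau0 k)); exact: (leF s0 (tau_s k)).
  apply: measurableD; apply/(F_measurable _ (tau0 k)); first exact: F_norm_ge.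
  exact: F_hit.
have mA : measurable A := mF (tau0 k) FA.
have mGh : measurable (G `&` hit k) by exact: measurableI.
have PA : (P A <= 2%:E * P (A `&` final))%E.
  pose far := [set w | e <= `|W t w - W (tau k) w|].
  have mfar : measurable far by apply: (mF t0); exact: F_norm_ge.
  have h1 : (P (A `&` far) <= P A * q%:E)%E by exact: tail.
  have h2 : (P A <= P (A `&` far) + P (A `&` final))%E.
    apply: (@le_trans _ _ (P ((A `&` far) `|` (A `&` final)))).
      apply: le_measure; rewrite ?inE//; first by apply: measurableU; exact: measurableI.
      move=> w Aw; have [wfar|nfar] := leP e `|W t w - W (tau k) w|; [by left|right].
      split=> //; case: Aw => _ [+ _]; rewrite /final /now/= => h.
      have := ler_normD (W t w - W s w) (W (tau k) w - W t w).
      rewrite (_ : W t w - W s w + (W (tau k) w - W t w) = W (tau k) w - W s w).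
        by rewrite (distrC (W (tau k) w) (W t w)) => h3; lra.
      by ring.
    by apply: measureU2; exact: measurableI.
  have mAfar : measurable (A `&` far) by exact: measurableI.
  have mAfinal : measurable (A `&` final) by exact: measurableI.
  move: h1 h2; rewrite -(fineK (fin_num_measure P _ mA)).
  rewrite -(fineK (fin_num_measure P _ mAfar)) -(fineK (fin_num_measure P _ mAfinal)).
  rewrite -!EFinM -!EFinD !lee_fin.
  have : 0 <= fine (P A) by exact: fine_ge0.
  nra.
rewrite hitS setIUr -/A; apply: (le_trans (measureU2 _ mGh mA)).
apply: (le_trans (leeD IH PA)).
rewrite -ge0_muleDr//; apply: lee_wpmul2l => //.
rewrite setIUl measureU//.
- exact: measurableI.
- exact: measurableI.
apply/seteqP; split => w //=.
rewrite /A => -[[[_ hk] _] [[_ [_ nhk]] _]]; exact: nhk.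
Qed.

End ottaviani.

Section exponential_moment.
Context d (T : measurableType d) (R : realType) (P : probability T R).

Lemma geometric_partial_sum_le (q : R) N : 0 <= q -> q < 1 ->
  \sum_(0 <= m < N) q ^+ m.+1 <= q / (1 - q).
Proof.
move=> q0 q1; have q1' : 0 < 1 - q by rewrite subr_gt0.
rewrite ler_pdivlMr//; suff -> : (\sum_(0 <= m < N) q ^+ m.+1) * (1 - q) = q - q ^+ N.+1.
  by rewrite lerBlDr lerDl exprn_ge0.
elim: N => [|N IH]; first by rewrite big_geq// mul0r expr1 subrr.
by rewrite big_nat_recr//= mulrDl IH (exprS q N.+1); ring.
Qed.

(** Summing the tail over the levels m * dl shows that the part of V above dl
    contributes at most a fraction dl to the exponential moment, as soon as the
    rate 1 / kap of the tail is large. *)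
Lemma exp_moment_of_tail (G : set T) (V : T -> R) (C kap dl : R) : measurable G ->
  measurable_fun setT V -> (forall w, 0 <= V w) -> 0 < C -> 0 < kap -> 0 < dl ->
  (forall x, 0 < x -> (P (G `&` [set w | (x <= V w)%R]) <=
     P G * (C * expR (- (x / kap)))%:E)%E) ->
  expR (dl - dl / kap) <= dl / (C + dl) ->
  (\int[P]_(w in G) (expR (V w))%:E <= P G * (expR (2 * dl))%:E)%E.
Proof.
move=> mG mV V0 C0 kap0 dl0 tail small.
set q := expR (dl - dl / kap) in small.
have q0 : 0 < q by rewrite expR_gt0.
have q1 : q < 1.
  by apply: (le_lt_trans small); rewrite ltr_pdivrMr ?addr_gt0// mul1r ltrDr.
pose lev m := [set w | m.+1%:R * dl <= V w].
have mlev m : measurable (lev m) by exact: measurable_geset.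
pose a m : R := expR (m.+2%:R * dl).
have a0 m : 0 <= a m by rewrite expR_ge0.
have pw w : ((expR (V w))%:E <= (expR dl)%:E +
    \sum_(0 <= m <oo) (a m)%:E * (\1_(lev m) w)%:E)%E.
  have ser0 m : (0 <= (a m)%:E * (\1_(lev m) w)%:E)%E.
    by rewrite -EFinM lee_fin mulr_ge0.
  have [Vdl|dlV] := leP (V w) dl.
    apply: (@le_trans _ _ (expR dl)%:E); first by rewrite lee_fin ler_expR.
    by rewrite leeDl// nneseries_ge0.
  have Vd0 : 0 <= V w / dl by rewrite divr_ge0// ltW.
  have /andP[tl tu] := truncn_itv Vd0.
  set m := Num.truncn (V w / dl) in tl tu.
  have m_gt0 : (0 < m)%N.
    rewrite -ltnS -(ltr_nat R); apply: le_lt_trans tu.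
    by rewrite ler_pdivlMr// mul1r ltW.
  move: tl tu; rewrite -(prednK m_gt0) => tl tu.
  apply: (@le_trans _ _ (a m.-1)%:E).
    by rewrite lee_fin ler_expR -ler_pdivrMr// ltW.
  apply: (@le_trans _ _ (\sum_(0 <= m <oo) (a m)%:E * (\1_(lev m) w)%:E)%E); last first.
    by rewrite leeDr// lee_fin expR_ge0.
  apply: le_trans (nneseries_lim_ge m.-1.+1 (fun k _ _ => ser0 k)).
  rewrite big_nat_recr//= indicE mem_set ?mule1; last first.
    by rewrite /lev/= -ler_pdivlMr.
  by rewrite leeDr// sume_ge0.
apply: (@le_trans _ _ (\int[P]_(w in G) ((expR dl)%:E +
    \sum_(0 <= m <oo) (a m)%:E * (\1_(lev m) w)%:E))%E).
  apply: ge0_le_integral => //.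
  - by apply/measurable_EFinP/measurable_funTS; apply: measurableT_comp.
  - apply: emeasurable_funD => //; apply: ge0_emeasurable_sum.
      by move=> k w _ _; rewrite -EFinM lee_fin mulr_ge0.
    move=> k _; apply: emeasurable_funM => //.
    by apply/measurable_EFinP/measurable_funTS; exact: measurable_indic.
have mterm k : measurable_fun G (fun w => (a k)%:E * (\1_(lev k) w)%:E : \bar R)%E.
  apply: emeasurable_funM => //.
  by apply/measurable_EFinP/measurable_funTS; exact: measurable_indic.
have term0 k w : (0 <= (a k)%:E * (\1_(lev k) w)%:E :> \bar R)%E.
  by rewrite -EFinM lee_fin mulr_ge0.
rewrite ge0_integralD//; last 2 first.
- by move=> w _; apply: nneseries_ge0.
- by apply: ge0_emeasurable_sum => // k w _ _; exact: term0.
rewrite integral_cst// integral_nneseries// muleC.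
have pE : P G = (fine (P G))%:E by rewrite fineK// fin_num_measure.
have p0 : 0 <= fine (P G) by exact: fine_ge0.
have sum_le : (\sum_(0 <= k <oo) \int[P]_(w in G) ((a k)%:E * (\1_(lev k) w)%:E) <=
    P G * (expR dl * dl)%:E)%E.
  apply: lime_le.
    apply: is_cvg_nneseries => k _ _; apply: integral_ge0 => w _; exact: term0.
  apply: nearW => N.
  apply: (@le_trans _ _ (\sum_(0 <= k < N) P G * (expR dl * C * q ^+ k.+1)%:E)%E).
    apply: lee_sum => k _.
    rewrite ge0_integralZl ?lee_fin//; last first.
      by apply/measurable_EFinP/measurable_funTS; exact: measurable_indic.
    rewrite integral_indic// setIC.
    have k0 : 0 < k.+1%:R * dl by rewrite mulr_gt0.
    apply: (@le_trans _ _ ((a k)%:E * (P G * (C * expR (- (k.+1%:R * dl / kap)))%:E))%E).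
      by apply: lee_wpmul2l; [rewrite lee_fin|exact: tail].
    rewrite muleCA -EFinM; apply: lee_wpmul2l => //; rewrite lee_fin.
    rewrite (_ : a k * _ = expR dl * C * (expR (k.+1%:R * dl) * expR (- (k.+1%:R * dl / kap)))).
      rewrite -expRD /q -expRM_natl ler_wpM2l ?mulr_ge0 ?expR_ge0 ?(ltW C0)//.
      by rewrite ler_expR mulrBr mulrA.
    rewrite /a (_ : k.+2%:R = k.+1%:R + 1); last by rewrite -natr1.
    by rewrite mulrDl mul1r expRD; ring.
  rewrite -ge0_sume_distrr; last first.
    by move=> k _; rewrite lee_fin !mulr_ge0 ?expR_ge0// ?exprn_ge0// ltW.
  apply: lee_wpmul2l => //; rewrite sumEFin lee_fin -mulr_sumr -mulrA.
  apply: ler_wpM2l; first exact: expR_ge0.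
  apply: (@le_trans _ _ (C * (q / (1 - q)))).
    by apply: ler_wpM2l; [exact: ltW|exact: geometric_partial_sum_le (ltW q0) q1].
  have q1' : 0 < 1 - q by rewrite subr_gt0.
  rewrite mulrA ler_pdivrMr//.
  move: small; rewrite ler_pdivlMr ?addr_gt0//; lra.
apply: (@le_trans _ _ (P G * (expR dl)%:E + P G * (expR dl * dl)%:E)%E).
  exact: leeD.
rewrite pE -!EFinM -EFinD lee_fin -mulrDr; apply: ler_wpM2l => //.
rewrite (_ : 2 * dl = dl + dl); last by ring.
rewrite expRD -[X in X + _]mulr1 -mulrDr; apply: ler_wpM2l; first exact: expR_ge0.
exact: expR_ge1Dx.
Qed.
End exponential_moment.

(** * Maxima over the dyadic points of a block *)

Section borel_cantelli_ae.
Context d (T : measurableType d) (R : realType) (P : probability T R).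
Local Open Scope ereal_scope.

Lemma borel_cantelli_ae (E : nat -> set T) (a : nat -> R) :
  (forall n, measurable (E n)) -> (forall n, P (E n) <= (a n)%:E) ->
  \sum_(0 <= n <oo) (a n)%:E < +oo ->
  {ae P, forall w, \forall n \near \oo, ~ E n w}.
Proof.
move=> mE Ea afin.
have fin : \sum_(0 <= n <oo) P (E n) < +oo.
  by apply: le_lt_trans afin; apply: lee_nneseries.
have null := lim_sup_set_cvg0 mE fin.
exists (lim_sup_set E); split => //.
  by apply: bigcapT_measurable => n; exact: bigcup_measurable.
move=> w /= nfin n _; apply: contrapT => nE; apply: nfin.
exists n => // k /= nk Ekw; apply: nE; exists k => //=.
Qed.

Lemma measure_bigsetU_le (I : Type) (s : seq I) (A : I -> set T) :
  (forall i, measurable (A i)) ->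
  P (\big[setU/set0]_(i <- s) A i) <= \sum_(i <- s) P (A i).
Proof.
move=> mA; elim: s => [|i s IH]; first by rewrite !big_nil measure0.
rewrite !big_cons; apply: (le_trans (measureU2 _ _ _)) => //.
  by elim: s {IH} => [|j s IH]; rewrite ?big_nil// big_cons; exact: measurableU.
exact: leeD.
Qed.
End borel_cantelli_ae.

Section running_max.
Context (R : realType).

Fixpoint running_max (f : nat -> R) k : R :=
  if k is k'.+1 then Num.max (running_max f k') (f k') else 0.

Lemma running_max_ge0 f k : 0 <= running_max f k.
Proof. by elim: k => //= k IH; rewrite le_max IH. Qed.

Lemma running_max_ge f k l : (l < k)%N -> f l <= running_max f k.
Proof.
elim: k => //= k IH; rewrite ltnS leq_eqVlt => /orP[/eqP->|/IH lk].
  by rewrite le_max lexx orbT.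
by rewrite le_max lk.
Qed.

Lemma running_max_le f k x : 0 <= x -> (forall l, (l < k)%N -> f l <= x) ->
  running_max f k <= x.
Proof.
move=> x0; elim: k => //= k IH fx; rewrite ge_max fx// andbT; apply: IH => l lk.
by apply: fx; exact: ltnW.
Qed.

Lemma running_max_exists f k x : 0 < x -> x <= running_max f k ->
  exists2 l, (l < k)%N & x <= f l.
Proof.
move=> x0; elim: k => [|k IH] /=; first by move=> /(lt_le_trans x0); rewrite ltxx.
rewrite le_max => /orP[/IH[l lk xf]|xf]; [by exists l => //; exact: ltnW|by exists k].
Qed.

Lemma measurable_running_max d (T : measurableType d) (f : T -> nat -> R) k :
  (forall l, measurable_fun setT (f ^~ l)) ->
  measurable_fun setT (fun w => running_max (f w) k).
Proof.
by move=> mf; elim: k => [|k IH] //=; exact: measurable_maxr.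
Qed.

(** The k-th dyadic point of level K of [s, t]; the index is truncated so that every k
    gives a point of the interval. *)
Definition dyadic (s t : R) K k : R := s + (t - s) * ((minn k (2 ^ K))%:R / 2 ^+ K).

Lemma dyadic_nd (s t : R) K : s <= t ->
  {homo dyadic s t K : k l / (k <= l)%N >-> k <= l}.
Proof.
move=> st k l kl; rewrite lerD2l ler_wpM2l ?subr_ge0// ler_wpM2r ?invr_ge0 ?exprn_ge0//.
by rewrite ler_nat leq_min geq_minr andbT (leq_trans (geq_minl _ _)).
Qed.

Lemma dyadic_ge (s t : R) K k : s <= t -> s <= dyadic s t K k.
Proof. by move=> st; rewrite lerDl mulr_ge0 ?subr_ge0// divr_ge0// exprn_ge0. Qed.

Lemma dyadic_le (s t : R) K k : s <= t -> dyadic s t K k <= t.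
Proof.
move=> st; rewrite -lerBrDl ler_piMr ?subr_ge0// ler_pdivrMr ?exprn_gt0// mul1r.
by rewrite -natrX ler_nat geq_minr.
Qed.

Lemma dyadic_double (s t : R) K k : dyadic s t K k = dyadic s t K.+1 (2 * k)%N.
Proof.
rewrite /dyadic expnS -minnMr natrM exprS; congr (_ + _ * _).
by rewrite invfM mulrACA divff// mul1r.
Qed.
End running_max.

Section dyadic_maximum.
Context d (T : measurableType d) (R : realType) (P : probability T R).
Variables (F : R -> set (set T)) (m : nat) (W : 'I_m -> R -> T -> R).
Hypothesis FF : is_filtration F.
Hypothesis FW : forall i (t : R), 0 <= t -> sub_measurable (F t) (W i t).

Definition sq_increment (s u : R) w : R := \sum_i (W i u w - W i s w) ^+ 2.

(** The maximal squared distance from the start of the block over the dyadic points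
    of level K; it increases with K to the supremum over the block when the path
    is continuous. *)
Definition block_max (s t : R) K w : R :=
  running_max (fun k => sq_increment s (dyadic s t K k) w) (2 ^ K).+1.

Lemma block_max_ge0 s t K w : 0 <= block_max s t K w.
Proof. exact: running_max_ge0. Qed.

Lemma block_max_nd s t w : {homo block_max s t ^~ w : K L / (K <= L)%N >-> K <= L}.
Proof.
apply: homo_leq => // [|K]; first exact: le_trans.
apply: running_max_le; first exact: running_max_ge0.
move=> k kK; rewrite dyadic_double; apply: (@running_max_ge _ (fun k => sq_increment s (dyadic s t K.+1 k) w)).
by rewrite ltnS expnS leq_mul2l/=.
Qed.

Lemma sq_increment_sub_measurable (s u v : R) : 0 <= s -> s <= v -> 0 <= u -> u <= v ->
  sub_measurable (F v) (sq_increment s u).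
Proof.
move=> s0 sv u0 uv; have v0 := le_trans s0 sv.
have sF : sigma_algebra setT (F v) by case: FF => + _ _; apply.
apply/(sub_measurableP sF); apply: measurable_sum => i; apply: measurable_funX.
apply: measurable_funB; apply/(sub_measurableP sF).
- by apply: (sub_measurable_le FF u0 uv); exact: FW.
- by apply: (sub_measurable_le FF s0 sv); exact: FW.
Qed.

Lemma block_max_sub_measurable (s t : R) K : 0 <= s -> s <= t ->
  sub_measurable (F t) (block_max s t K).
Proof.
move=> s0 st; have t0 := le_trans s0 st.
have sF : sigma_algebra setT (F t) by case: FF => + _ _; apply.
apply/(sub_measurableP sF).
apply: (@measurable_running_max _ _ (g_sigma_algebraType (F t))) => l.
apply/(sub_measurableP sF); apply: sq_increment_sub_measurable => //.
- exact: le_trans s0 (dyadic_ge _ _ st).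
- exact: dyadic_le.
Qed.

Variables (s t v : R).
Hypotheses (m0 : (0 < m)%N) (s0 : 0 <= s) (st : s <= t) (v0 : 0 < v).
Hypothesis tail : forall i u G (e : R), s <= u -> u <= t -> F u G -> 0 < e ->
  (P (G `&` [set w | (e <= `|W i t w - W i u w|)%R]) <=
   P G * (2 * expR (- (e ^+ 2 / (24 * v))))%:E)%E.

(** If the squared distance reaches x, one of the m coordinates reaches
    sqrt (x / m) = 2 e, to which the maximal inequality applies.  The factor 96
    is 4 * 24. *)
Lemma block_max_tail G K (x : R) : F s G -> 0 < x ->
  (P (G `&` [set w | (x <= block_max s t K w)%R]) <=
   P G * (4 * m%:R * expR (- (x / (96 * m%:R * v))))%:E)%E.
Proof.
move=> FG x0.
have mF (u : R) : 0 <= u -> F u `<=` measurable by case: FF => _ + _; apply.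
have mR : 0 < m%:R :> R by rewrite ltr0n.
pose e := Num.sqrt (x / m%:R) / 2.
have xm0 : 0 < x / m%:R by rewrite divr_gt0.
have e0 : 0 < e by rewrite divr_gt0// sqrtr_gt0.
have e2 : (2 * e) ^+ 2 = x / m%:R by rewrite /e mulrC divfK// sqr_sqrtr// ltW.
pose hit i := [set w | exists2 l, (l < (2 ^ K).+1)%N &
  2 * e <= `|W i (dyadic s t K l) w - W i s w|].
have mG : measurable G := mF _ s0 _ FG.
have mhit i : measurable (hit i).
  rewrite (_ : hit i = \bigcup_(l in [set l | (l < (2 ^ K).+1)%N])
     [set w | 2 * e <= `|W i (dyadic s t K l) w - W i s w|]); last first.
    by apply/seteqP; split => w [l lK h]; exists l.
  apply: bigcup_measurable => l _; apply: measurable_norm_ge.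
  have ds := dyadic_ge K l st; have d0 := le_trans s0 ds.
  apply: measurable_funB; first exact: (sub_measurable_fun (mF _ d0) (FW i d0)).
  exact: (sub_measurable_fun (mF _ s0) (FW i s0)).
have t0 := le_trans s0 st.
have mV : measurable [set w | x <= block_max s t K w].
  apply: measurable_geset.
  exact: (sub_measurable_fun (mF _ t0) (block_max_sub_measurable K s0 st)).
apply: (@le_trans _ _ (P (\big[setU/set0]_(i < m) (G `&` hit i)))).
  apply: le_measure; rewrite ?inE.
  - exact: measurableI.
  - by apply: bigsetU_measurable => i _; exact: measurableI.
  move=> w [Gw /= /(running_max_exists x0)[l lK xl]].
  have [i hi] : exists i, 2 * e <= `|W i (dyadic s t K l) w - W i s w|.
    apply: contrapT => /forallNP no.
    have : sq_increment s (dyadic s t K l) w < x.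
      rewrite [ltRHS](_ : x = \sum_(i < m) x / m%:R); last first.
        by rewrite sumr_const card_ord -[RHS]mulr_natr divfK// gt_eqF.
      apply: ltr_sum => [|i _].
        by apply/hasP; exists (Ordinal m0) => //; rewrite mem_index_enum.
      rewrite -e2 -real_normK ?num_real// ltr_sqr ?nnegrE ?mulr_ge0// ?(ltW e0)//.
      by rewrite ltNge; apply/negP; exact: no.
    by move=> /lt_le_trans/(_ xl); rewrite ltxx.
  by rewrite (bigD1 i)//=; left; split => //; exists l.
apply: (le_trans (measure_bigsetU_le _ _ _)) => [i|]; first exact: measurableI.
apply: (@le_trans _ _ (\sum_(i < m) P G * (4 * expR (- (x / (96 * m%:R * v))))%:E)%E).
  apply: lee_sum => i _.
  have H := ottaviani FF (FW i) s0 st (fun u G e => @tail i u G e) (@dyadic_nd _ s t K st)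
    (fun k => dyadic_ge K k st) (fun k => dyadic_le K k st) e0 (2 ^ K).+1 FG.
  apply: (le_trans H); apply: lee_wpmul2l => //; rewrite lee_fin.
  rewrite (_ : e ^+ 2 / (24 * v) = x / (96 * m%:R * v))//.
  have -> : e ^+ 2 = x / m%:R / 4 by rewrite -e2; field.
  by field; rewrite !gt_eqF.
rewrite -ge0_sume_distrr; last by move=> i _; rewrite lee_fin mulr_ge0// expR_ge0.
apply: lee_wpmul2l => //; rewrite sumEFin lee_fin sumr_const card_ord.
by rewrite -[leLHS]mulr_natr le_eqVlt; apply/orP; left; apply/eqP; ring.
Qed.

End dyadic_maximum.

(** * Oscillations over consecutive blocks *)

Section blocks.
Context d (T : measurableType d) (R : realType) (P : probability T R).
Variables (F : R -> set (set T)) (m : nat) (W : 'I_m -> R -> T -> R).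
Hypothesis FF : is_filtration F.
Hypothesis FW : forall i (t : R), 0 <= t -> sub_measurable (F t) (W i t).
Variables (h : R) (v : nat -> R).
Hypotheses (m0 : (0 < m)%N) (h0 : 0 < h) (v0 : forall n, 0 < v n).
Hypothesis tail : forall n i u G (e : R),
  n%:R * h <= u -> u <= n.+1%:R * h -> F u G -> 0 < e ->
  (P (G `&` [set w | (e <= `|W i (n.+1%:R * h) w - W i u w|)%R]) <=
   P G * (2 * expR (- (e ^+ 2 / (24 * v n))))%:E)%E.

Definition block n K w : R := block_max W (n%:R * h) (n.+1%:R * h) K w.

Let n0 (n : nat) : 0 <= n%:R * h :> R. Proof. by rewrite mulr_ge0// ltW. Qed.
Let nS (n : nat) : n%:R * h <= n.+1%:R * h :> R.
Proof. by rewrite ler_wpM2r ?ler_nat// ltW. Qed.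
Let sF (u : R) : 0 <= u -> sigma_algebra setT (F u). Proof. by case: FF => + _ _; apply. Qed.
Let mF (u : R) : 0 <= u -> F u `<=` measurable. Proof. by case: FF => _ + _; apply. Qed.
Let FT (u : R) : 0 <= u -> F u setT.
Proof. by move=> u0; case: (sF u0) => h1 h2 _; rewrite -(setD0 setT); exact: h2. Qed.

Lemma block_ge0 n K w : 0 <= block n K w. Proof. exact: block_max_ge0. Qed.

Lemma block_nd n w : {homo (block n)^~ w : K L / (K <= L)%N >-> K <= L}.
Proof. by move=> K L KL; exact: block_max_nd. Qed.

Lemma block_sub_measurable n K : sub_measurable (F (n.+1%:R * h)) (block n K).
Proof. exact: block_max_sub_measurable. Qed.

Lemma measurable_block n K : measurable_fun setT (block n K).
Proof. exact: (sub_measurable_fun (mF (n0 n.+1)) (block_sub_measurable n K)). Qed.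

Let kap n : R := 96 * m%:R * v n.
Let kap0 n : 0 < kap n. Proof. by rewrite !mulr_gt0// ltr0n. Qed.

Lemma block_tail n K G (x : R) : F (n%:R * h) G -> 0 < x ->
  (P (G `&` [set w | (x <= block n K w)%R]) <=
   P G * (4 * m%:R * expR (- (x / kap n)))%:E)%E.
Proof. by move=> FG x0; apply: (block_max_tail FF FW m0) => //; exact: tail. Qed.

(** The bound of each block does not depend on K, so it passes to the increasing
    union over K before Borel-Cantelli is applied. *)
Lemma blocks_eventually_small (x : R) : 0 < x ->
  (\sum_(0 <= n <oo) (expR (- (x / kap n)))%:E < +oo)%E ->
  {ae P, forall w, \forall n \near \oo, forall K, block n K w < x}.
Proof.
move=> x0 fin.
pose E n := \bigcup_K [set w | x <= block n K w].
have mE1 n K : measurable [set w | x <= block n K w].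
  by apply: measurable_geset; exact: measurable_block.
have mE n : measurable (E n) by exact: bigcup_measurable.
have C0 : (0 <= 4 * m%:R :> R) by rewrite mulr_ge0.
have EP n : (P (E n) <= (4 * m%:R * expR (- (x / kap n)))%:E)%E.
  have cvg : P \o (fun K => [set w | x <= block n K w]) @ \oo --> P (E n).
    apply: nondecreasing_cvg_mu => //; first exact: bigcup_measurable.
    move=> K L KL; apply/subsetPset => w /= /le_trans.
    by apply; exact: block_nd.
  rewrite -(cvg_lim _ cvg)//; apply: lime_le; first by apply/cvg_ex; exists (P (E n)).
  apply: nearW => K /=; have := block_tail K (FT (n0 n)) x0.
  by rewrite setTI probability_setT mul1e.
have : {ae P, forall w, \forall n \near \oo, ~ E n w}.
  apply: (borel_cantelli_ae mE EP).
  rewrite (eq_eseriesr (g := fun n => ((4 * m%:R)%:E * (expR (- (x / kap n)))%:E)%E)).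
    rewrite nneseriesZl//.
    by rewrite lte_mul_pinfty.
  by move=> n _; rewrite EFinM.
apply: filterS => w; apply: filterS => n nE K; rewrite ltNge; apply/negP => xb.
by apply: nE; exists K.
Qed.

(** Given the past, each block multiplies the exponential moment by at most
    exp (2 dl). *)
Lemma exp_moment_blocks (n1 : nat) (dl : R) K N : 0 < dl ->
  (forall n, (n1 <= n)%N -> expR (dl - dl / kap n) <= dl / (4 * m%:R + dl)) ->
  (\int[P]_w (expR (\sum_(0 <= k < N) block (n1 + k)%N K w))%:E <= (expR (2 * dl * N%:R))%:E)%E.
Proof.
move=> dl0 small; elim: N => [|N IH].
  under eq_integral do rewrite big_geq// expR0.
  by rewrite integral_cst//= probability_setT mulr0 expR0 mule1.
pose Z w := expR (\sum_(0 <= k < N) block (n1 + k)%N K w).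
pose W1 w := expR (block (n1 + N)%N K w).
pose c := expR (2 * dl).
have c0 : 0 <= c by exact: expR_ge0.
have mW1 : measurable_fun setT W1.
  by apply: measurableT_comp => //; exact: measurable_block.
have u0 := n0 (n1 + N).
have FZ : sub_measurable (F ((n1 + N)%:R * h)) Z.
  apply/(sub_measurableP (sF u0)); apply: measurableT_comp => //.
  rewrite (_ : (fun w => _) = (fun w => \sum_(0 <= k < N) (if (k < N)%N then block (n1 + k) K w else 0))); last first.
    by apply/funext => w; rewrite big_nat [RHS]big_nat; apply: eq_bigr => k /andP[_ ->].
  apply: measurable_sum => k; have [kN|_] := boolP (k < N)%N; last exact: measurable_cst.
  apply/(sub_measurableP (sF u0)).
  apply: (sub_measurable_le FF (n0 (n1 + k).+1)); last exact: block_sub_measurable.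
  by rewrite ler_wpM2r ?(ltW h0)// ler_nat -addnS leq_add2l.
have mZ : measurable_fun setT Z := sub_measurable_fun (mF u0) FZ.
rewrite (eq_integral (fun w => (Z w * W1 w)%:E)); last first.
  by move=> w _; rewrite big_nat_recr//= expRD.
apply: (@le_trans _ _ (\int[P]_w (Z w * cst c w)%:E)%E).
  apply: (sub_integral_mul_le (sF u0) (mF u0)) => //.
  - by move=> w; exact: expR_ge0.
  - move=> G FG; rewrite [leRHS](_ : _ = (P G * c%:E)%E); last first.
      by rewrite muleC; exact: (integral_cst P (mF u0 FG) c%:E).
    apply: (@exp_moment_of_tail _ _ _ _ _ _ (4 * m%:R) (kap (n1 + N)%N)) => //.
    + exact: mF FG.
    + exact: measurable_block.
    + by move=> w; exact: block_ge0.
    + by rewrite mulr_gt0// ltr0n.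
    + by move=> x x0; exact: block_tail.
    + by apply: small; rewrite leq_addr.
  - by move=> w; exact: expR_ge0.
rewrite (eq_integral (fun w => c%:E * (Z w)%:E)%E); last first.
  by move=> w _; rewrite -EFinM mulrC.
rewrite ge0_integralZl ?lee_fin//; last 2 first.
- exact/measurable_EFinP.
- by move=> w _; rewrite lee_fin expR_ge0.
rewrite -[N.+1%:R]natr1 mulrDr mulr1 expRD [leRHS]EFinM muleC.
by apply: lee_wpmul2r; rewrite ?lee_fin.
Qed.

(** Markov's inequality for the exponential of the sum gives the probability
    exp (- 2 dl N), which is summable in N. *)
Lemma blocks_average_small (n1 : nat) (dl : R) : 0 < dl ->
  (forall n, (n1 <= n)%N -> expR (dl - dl / kap n) <= dl / (4 * m%:R + dl)) ->
  {ae P, forall w, \forall N \near \oo, forall K,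
    \sum_(0 <= k < N) block (n1 + k)%N K w < 4 * dl * N%:R}.
Proof.
move=> dl0 small.
pose S N K w := \sum_(0 <= k < N) block (n1 + k)%N K w.
have mS N K : measurable_fun setT (S N K) by apply: measurable_sum => k; exact: measurable_block.
pose E N := \bigcup_K [set w | 4 * dl * N%:R <= S N K w].
have mE1 N K : measurable [set w | 4 * dl * N%:R <= S N K w] by exact: measurable_geset.
have mE N : measurable (E N) by exact: bigcup_measurable.
pose q := expR (- (2 * dl)).
have EP N : (P (E N) <= (q ^+ N)%:E)%E.
  have cvg : P \o (fun K => [set w | 4 * dl * N%:R <= S N K w]) @ \oo --> P (E N).
    apply: nondecreasing_cvg_mu => //; first exact: bigcup_measurable.
    move=> K L KL; apply/subsetPset => w /= /le_trans.
    by apply; apply: ler_sum => k _; exact: block_nd.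
  rewrite -(cvg_lim _ cvg)//; apply: lime_le; first by apply/cvg_ex; exists (P (E N)).
  apply: nearW => K /=.
  have := exp_moment_blocks K N dl0 small.
  rewrite -/(S N K _) => H.
  rewrite -(setIT [set w | _]) -integral_indic//.
  apply: (@le_trans _ _ (\int[P]_w ((expR (- (4 * dl * N%:R)))%:E * (expR (S N K w))%:E))%E).
    apply: ge0_le_integral => //.
    - by apply/measurable_EFinP; exact: measurable_indic.
    - apply: emeasurable_funM => //; apply/measurable_EFinP; exact: measurableT_comp.
    move=> w _; rewrite -EFinM -expRD lee_fin indicE.
    have [|_] := boolP (w \in _); last exact: expR_ge0.
    rewrite inE/= => Sw; rewrite -[leLHS]expR0 ler_expR addrC subr_ge0//.
  rewrite ge0_integralZl ?lee_fin ?expR_ge0//; last first.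
    by apply/measurable_EFinP; exact: measurableT_comp.
  apply: (@le_trans _ _ ((expR (- (4 * dl * N%:R)))%:E * (expR (2 * dl * N%:R))%:E)%E).
    by apply: lee_wpmul2l => //; rewrite lee_fin expR_ge0.
  rewrite -EFinM -expRD lee_fin /q -expRM_natl ler_expR.
  by rewrite le_eqVlt; apply/orP; left; apply/eqP; ring.
have : {ae P, forall w, \forall N \near \oo, ~ E N w}.
  apply: (borel_cantelli_ae mE EP).
  have q0 : 0 < q by exact: expR_gt0.
  have q1 : q < 1 by rewrite -expR0 ltr_expR oppr_lt0 mulr_gt0.
  apply: (@le_lt_trans _ _ (1 + q / (1 - q))%:E); last exact: ltry.
  apply: lime_le; first by apply: is_cvg_nneseries => n _ _; rewrite lee_fin exprn_ge0// ltW.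
  apply: nearW => [[|N]].
    by rewrite big_geq// lee_fin addr_ge0// divr_ge0 ?ltW// subr_gt0.
  rewrite sumEFin lee_fin big_nat_recl//= expr0 lerD2l.
  exact: (geometric_partial_sum_le _ (ltW q0) q1).
apply: filterS => w; apply: filterS => N nE K; rewrite ltNge; apply/negP => xb.
by apply: nE; exists K.
Qed.

End blocks.

(** * A conditional Borel-Cantelli lemma *)

Section conditional_borel_cantelli.
Context d (T : measurableType d) (R : realType) (P : probability T R).
Variables (S : nat -> set (set T)) (E : nat -> set T) (p : nat -> R) (n1 : nat).
Hypothesis sS : forall n, sigma_algebra setT (S n).
Hypothesis mS : forall n, S n `<=` measurable.
Hypothesis leS : forall n, S n `<=` S n.+1.
Hypothesis SE : forall n, S n.+1 (E n).
Hypothesis p0 : forall n, 0 <= p n.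
Hypothesis pE : forall n G, (n1 <= n)%N -> S n G -> (P G * (p n)%:E <= P (G `&` E n))%E.

Let miss N k := \bigcap_(n in [set n | (N <= n < k)%N]) ~` E n.

Let missS N k : (N <= k)%N -> miss N k.+1 = miss N k `\` E k.
Proof.
move=> Nk; apply/seteqP; split => w /=.
  move=> H; split => [n /andP[Nn nk]|]; last by apply: (H k); rewrite /= Nk ltnSn.
  by apply: H; rewrite /= Nn ltnW.
move=> [H nE] n /= /andP[Nn]; rewrite ltnS leq_eqVlt => /orP[/eqP->//|nk].
by apply: H; rewrite /= Nn.
Qed.

Let S_miss N k : S k (miss N k).
Proof.
elim: k => [|k IH].
  rewrite (_ : miss N 0 = setT); last by apply/seteqP; split => // w _ n /=; rewrite ltn0 andbF.
  by case: (sS 0%N) => h1 h2 _; rewrite -(setD0 setT); exact: h2.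
have [Nk|kN] := leqP N k.
  have SM A : S k.+1 A <-> (measurable : set (set (g_sigma_algebraType (S k.+1)))) A.
    by rewrite /measurable/= (sigma_algebra_id (sS k.+1)).
  rewrite missS//; apply/SM; apply: measurableD; apply/SM => //; exact: leS.
rewrite (_ : miss N k.+1 = setT).
  by case: (sS k.+1) => h1 h2 _; rewrite -(setD0 setT); exact: h2.
by apply/seteqP; split => // w _ n /= /andP[Nn]; rewrite ltnS => nk; have := leq_trans kN (leq_trans Nn nk); rewrite ltnn.
Qed.

(** Each further event, given the past, is avoided with probability at most
    1 - p <= exp (- p). *)
Let P_miss N k : (n1 <= N)%N ->
  fine (P (miss N (N + k))) <= expR (- \sum_(0 <= i < k) p (N + i)%N).
Proof.
move=> nN; elim: k => [|k IH].
  rewrite big_geq// oppr0 expR0 -lee_fin fineK ?fin_num_measure//.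
    by apply: probability_le1; exact: mS (S_miss _ _).
  exact: mS (S_miss _ _).
have mM := mS (S_miss N (N + k)).
have mE := mS (SE (N + k)).
have mME : measurable (miss N (N + k) `&` E (N + k)%N) by exact: measurableI.
have := pE (leq_trans nN (leq_addr k N)) (S_miss N (N + k)).
rewrite addnS missS ?leq_addr// measureD//; last by rewrite ltey_eq fin_num_measure.
rewrite fineB ?fin_num_measure// -(fineK (fin_num_measure P _ mM)).
rewrite -(fineK (fin_num_measure P _ mME)) -EFinM lee_fin => H.
rewrite big_nat_recr//= opprD expRD.
set M := fine (P (miss N (N + k))) in H IH *.
have M0 : 0 <= M by exact: fine_ge0.
apply: (@le_trans _ _ (M * (1 - p (N + k)%N))).
  by rewrite mulrBr mulr1; apply: lerB.
apply: (@le_trans _ _ (M * expR (- p (N + k)%N))).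
  by apply: ler_wpM2l => //; exact: expR_ge1Dx.
by apply: ler_wpM2r => //; exact: expR_ge0.
Qed.

(** A divergent series of conditional lower bounds replaces the independence of
    the second Borel-Cantelli lemma. *)
Lemma conditional_borel_cantelli : (\sum_(0 <= n <oo) (p n)%:E = +oo)%E ->
  {ae P, forall w, forall N, exists2 n, (N <= n)%N & E n w}.
Proof.
move=> pinf.
have null N : P (\bigcap_(n in [set n | (n1 + N <= n)%N]) ~` E n) = 0%E.
  set A := \bigcap_(n in _) _.
  have mA : measurable A.
    by apply: bigcap_measurableType => n _; apply: measurableC; exact: mS (SE n).
  rewrite -(fineK (fin_num_measure P _ mA)); congr EFin.
  apply/eqP; rewrite eq_le fine_ge0// andbT.
  apply/ler_addgt0Pr => e e0; rewrite add0r.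
  have [k hk] : exists k, - ln e <= \sum_(0 <= i < k) p (n1 + N + i)%N.
    apply: contrapT => /forallNP no.
    have : (\sum_(0 <= n <oo) (p n)%:E <= (\sum_(0 <= n < n1 + N) p n + - ln e)%:E)%E.
      apply: lime_le; first by apply: is_cvg_nneseries => n _ _; rewrite lee_fin.
      apply: nearW => k; rewrite sumEFin lee_fin.
      apply: (@le_trans _ _ (\sum_(0 <= n < n1 + N + k) p n)).
        by rewrite [leRHS](@big_cat_nat _ _ _ k)//= ?leq_addl// lerDl sumr_ge0.
      rewrite (@big_cat_nat _ _ _ (n1 + N))//= ?leq_addr//; apply: lerD => //.
      rewrite -{1}[(n1 + N)%N]add0n big_addn addKn.
      under eq_bigr do rewrite addnC.
      by rewrite leNgt; apply/negP => /ltW; exact: no.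
    by rewrite pinf leye_eq.
  apply: (@le_trans _ _ (fine (P (miss (n1 + N) (n1 + N + k))))).
    have mM := mS (S_miss (n1 + N) (n1 + N + k)).
    apply: fine_le; rewrite ?fin_num_measure//.
    apply: le_measure; rewrite ?inE//.
    by move=> w H n /= /andP[Nn _]; exact: H.
  apply: (le_trans (P_miss _ (leq_addr N n1))).
  by rewrite -[leRHS]lnK ?posrE// ler_expR lerNl.
have : {ae P, forall w, forall N, ~ (\bigcap_(n in [set n | (n1 + N <= n)%N]) ~` E n) w}.
  apply/ae_foralln => N; exists (\bigcap_(n in [set n | (n1 + N <= n)%N]) ~` E n).
  split; [|exact: null|by move=> w /contrapT].
  by apply: bigcap_measurableType => n _; apply: measurableC; exact: mS (SE n).
apply: filterS => w H N; apply: contrapT => /forall2NP no.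
apply: (H N) => n /= nN; have [nNN|//] := no n.
by exfalso; apply: nNN; rewrite (leq_trans _ nN)// leq_addl.
Qed.

End conditional_borel_cantelli.

(** * From the integral criterion to a series *)

Lemma le_three_last (R : realFieldType) (r a b e : R) :
  r <= a + b + e -> 3 * a < r -> 3 * b < r -> r <= 3 * e.
Proof. lra. Qed.

(** Shifting a nonnegative series only drops terms. *)
Lemma nneseries_three_shifts (R : realType) (f : nat -> \bar R) :
  (forall n, 0 <= f n)%E ->
  (\sum_(0 <= n <oo) (f n + f n.+1 + f n.+2)
     <= \sum_(0 <= n <oo) f n + \sum_(0 <= n <oo) f n + \sum_(0 <= n <oo) f n)%E.
Proof.
move=> f0.
have shift k : (\sum_(0 <= n <oo) f (n + k)%N <= \sum_(0 <= n <oo) f n)%E.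
  rewrite nneseries_addn//; rewrite [leRHS](nneseries_split 0 k)//.
  by rewrite add0n leeDr// sume_ge0.
rewrite nneseriesD//; last by move=> n _; rewrite adde_ge0.
rewrite nneseriesD//.
apply: leeD; [apply: leeD => //|].
  by under eq_eseriesr do rewrite -addn1; exact: shift.
by under eq_eseriesr do rewrite -addn2; exact: shift.
Qed.

Section running_integral.
Context (R : realType) (g : R -> R).
Local Notation mu := (@lebesgue_measure R).
Hypothesis g0 : forall x, 0 <= g x.
Hypothesis gI : forall b, mu.-integrable `[0, b] (EFin \o g).

Definition mass (a b : R) : R := Rintegral mu `[a, b] g.

Lemma integrable_itv (a b : R) : 0 <= a -> mu.-integrable `[a, b] (EFin \o g).
Proof.
move=> a0; apply: (integrableS _ _ _ (gI b)) => //.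
by apply: subset_itvr; rewrite bnd_simp.
Qed.

Lemma massE (a b : R) : 0 <= a ->
  ((mass a b)%:E = \int[mu]_(x in `[a, b]) (g x)%:E)%E.
Proof.
move=> a0; rewrite /mass /Rintegral fineK//.
exact: (integrable_fin_num _ (integrable_itv b a0)).
Qed.

Lemma mass_ge0 (a b : R) : 0 <= mass a b.
Proof. exact: Rintegral_ge0. Qed.

Lemma le_mass (a a' b' b : R) : 0 <= a -> a <= a' -> b' <= b -> mass a' b' <= mass a b.
Proof.
move=> a0 aa' bb'; rewrite -lee_fin !massE//; last exact: le_trans aa'.
apply: ge0_subset_integral => //.
- by have /integrableP[] := integrable_itv b a0.
- by move=> x _; rewrite lee_fin.
- by apply: subset_itv; rewrite bnd_simp.
Qed.

Lemma massD (a b e : R) : 0 <= a -> a <= b -> b <= e -> mass a e = mass a b + mass b e.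
Proof.
move=> a0 ab be; apply: EFin_inj; rewrite EFinD !massE//; last exact: le_trans ab.
have /integrableP[mg _] := integrable_itv e a0.
rewrite (@itv_bndbnd_setU _ _ (BLeft a) (BRight b) (BRight e))//.
rewrite ge0_integral_setU//=.
- congr (_ + _)%E; rewrite -integral_itv_obnd_cbnd//.
  by apply: measurable_funS mg => //; apply: subset_itvr; rewrite bnd_simp.
- rewrite -itv_bndbnd_setU//; rewrite bnd_simp//.
- by move=> x _; rewrite lee_fin.
- apply/disj_setPS => x /=; rewrite !in_itv/= => -[/andP[_ xt] /andP[tx _]].
  by have := lt_le_trans tx xt; rewrite ltxx.
Qed.

Variable c : R.
Hypothesis c0 : 0 < c.

Definition root_mass t : R := Num.sqrt (mass t (t + c)).

(** The mass of a window is a difference of two monotone functions of t. *)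
Lemma measurable_root_mass : measurable_fun (`[0, +oo[ : set R) root_mass.
Proof.
(* Clamping at 0 makes the running integral monotone on the whole line. *)
pose A (t : R) := mass 0 (Num.max t 0).
have mA (D : set R) (mD : measurable D) : measurable_fun D A.
  apply: nondecreasing_measurable => // s t st; apply: le_mass => //.
  by rewrite ge_max !le_max st lexx !orbT.
pose A' (t : R) := Num.sqrt (A (t + c) - A t).
suff : measurable_fun (`[0, +oo[ : set R) A'.
  apply: eq_measurable_fun => t /set_mem/=; rewrite in_itv/= andbT => t0.
  have tc0 : 0 <= t + c by rewrite addr_ge0// ltW.
  rewrite /root_mass /A' /A !max_l// (@massD 0 t (t + c))//; last by rewrite lerDl ltW.
  by rewrite addrC addKr.
apply: (@measurableT_comp _ _ _ _ _ _ (@Num.sqrt R)).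
  by apply: nondecreasing_measurable => // x y; exact: ler_wsqrtr.
apply: measurable_funB => //; last exact: mA.
apply: (measurable_comp measurableT) => //; first exact: mA.
exact: measurable_funD.
Qed.

Definition gauss_weight (eps x : R) : R :=
  x * expR (- (eps ^+ 2 / 2 / x ^+ 2)) * \1_(`]0%R, +oo[) x.

Lemma gauss_weight_ge0 eps x : 0 <= gauss_weight eps x.
Proof.
rewrite /gauss_weight indicE mem_setE in_itv/= andbT.
by case: ltP => x0; rewrite ?mulr0// mulr1 mulr_ge0 ?expR_ge0// ltW.
Qed.

Lemma gauss_weight_nd eps x y : x <= y -> gauss_weight eps x <= gauss_weight eps y.
Proof.
move=> xy; have [x0|x0] := leP x 0.
  by rewrite [leLHS]/gauss_weight indicE mem_setE in_itv/= ltNge x0/= mulr0 gauss_weight_ge0.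
have y0 := lt_le_trans x0 xy.
rewrite /gauss_weight !indicE !mem_setE !in_itv/= x0 y0 !mulr1.
apply: ler_pM => //; [exact: ltW|rewrite ler_expR lerN2].
apply: ler_wpM2l; first by rewrite divr_ge0// sqr_ge0.
by rewrite lef_pV2 ?posrE ?exprn_gt0// ler_sqr// nnegrE ltW.
Qed.

(** The term exp (- eps2 / y) of the series, with value zero at y = 0 as suggested by
    the limit. *)
Definition gauss_tail (eps2 y : R) : R := if 0 < y then expR (- (eps2 / y)) else 0.

Lemma gauss_tail_ge0 eps2 y : 0 <= gauss_tail eps2 y.
Proof. by rewrite /gauss_tail; case: ifP => // _; exact: expR_ge0. Qed.

Lemma gauss_weight_le_tail (eps y Y : R) : 0 <= y -> y <= Y ->
  gauss_weight eps (Num.sqrt y) <= Num.sqrt Y * gauss_tail (eps ^+ 2 / 2) y.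
Proof.
move=> y0 yY; rewrite /gauss_weight /gauss_tail indicE mem_setE in_itv/= andbT sqrtr_gt0.
case: ltP => y_gt0; last by rewrite mulr0 mulr0.
by rewrite mulr1 sqr_sqrtr// ler_wpM2r ?expR_ge0// ler_wsqrtr.
Qed.

(** Half of the exponent is spent on z * exp (- z) <= 1, which supplies the
    factor sqrt y of the integrand. *)
Lemma gauss_tail_le_weight (eps y Y : R) : 0 < eps -> y <= Y ->
  gauss_tail (eps ^+ 2) y <= 2 * Num.sqrt Y / eps ^+ 2 * gauss_weight eps (Num.sqrt y).
Proof.
move=> eps0 yY; rewrite /gauss_weight /gauss_tail indicE mem_setE in_itv/= andbT sqrtr_gt0.
case: ltP => y0; last by rewrite !mulr0.
have sy : Num.sqrt y ^+ 2 = y by rewrite sqr_sqrtr// ltW.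
rewrite mulr1 sy.
have e20 : 0 < eps ^+ 2 by rewrite exprn_gt0.
rewrite (_ : - (eps ^+ 2 / y) = - (eps ^+ 2 / 2 / y) + - (eps ^+ 2 / 2 / y)); last first.
  by field; rewrite gt_eqF.
rewrite expRD mulrA; apply: ler_wpM2r; first exact: expR_ge0.
set z := eps ^+ 2 / 2 / y.
have z0 : 0 < z by rewrite !divr_gt0.
apply: (@le_trans _ _ z^-1).
  rewrite expRN lef_pV2 ?posrE ?expR_gt0//.
  by apply: le_trans (expR_ge1Dx z); rewrite lerDr.
rewrite (_ : z^-1 = 2 * Num.sqrt y / eps ^+ 2 * Num.sqrt y).
  apply: ler_wpM2r; first exact: sqrtr_ge0.
  by rewrite ler_wpM2r ?invr_ge0 ?(ltW e20)// ler_wpM2l// ler_wsqrtr.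
rewrite /z -[in LHS]sy; field; rewrite !gt_eqF//= ?sqrtr_gt0//.
Qed.

Let h := c / 2.
Let h0 : 0 < h. Proof. by rewrite divr_gt0. Qed.
Let nh0 (n : nat) : 0 <= n%:R * h. Proof. by rewrite mulr_ge0// ltW. Qed.
Let le_nh (k n : nat) : (k <= n)%N -> k%:R * h <= n%:R * h.
Proof. by move=> kn; rewrite ler_wpM2r ?ler_nat// ltW. Qed.

(** The blocks are half as long as the window c: a window that starts in block n
    contains block n + 1 and is contained in the blocks n, n + 1 and n + 2. *)
Definition half_mass (n : nat) : R := mass (n%:R * (c / 2)) (n.+1%:R * (c / 2)).

Definition weight_integral (eps : R) : \bar R :=
  (\int[mu]_(t in `[0%R, +oo[) (gauss_weight eps (root_mass t))%:E)%E.

Let cell n : set R := `[n%:R * h, n.+1%:R * h[.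

Let bigcup_cell : \bigcup_n cell n = `[0, +oo[%classic.
Proof.
apply/seteqP; split => t /=.
  move=> [n _]; rewrite /cell/= !in_itv/= andbT => /andP[nt _].
  exact: le_trans nt.
rewrite in_itv/= andbT => t0; have th0 : 0 <= t / h by rewrite divr_ge0// ltW.
exists (Num.truncn (t / h)) => //; rewrite /cell/= in_itv/=.
by have /andP[] := truncn_itv th0; rewrite ler_pdivlMr// ltr_pdivrMr// => -> ->.
Qed.

Let trivIset_cell : trivIset setT cell.
Proof.
apply: ltn_trivIset => k n kn; apply/seteqP; split => // t /=.
rewrite /cell/= !in_itv/= => -[/andP[_ tk] /andP[nt _]].
by have := lt_le_trans tk (le_trans (le_nh kn) nt); rewrite ltxx.
Qed.

Let mweight eps : measurable_fun (`[0, +oo[ : set R)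
  (fun t => (gauss_weight eps (root_mass t))%:E : \bar R).
Proof.
apply/measurable_EFinP; apply: (@measurable_comp _ _ _ _ _ _ setT) => //.
  by apply: nondecreasing_measurable => // x y; exact: gauss_weight_nd.
exact: measurable_root_mass.
Qed.

Let weight_integralE eps : (weight_integral eps = \sum_(0 <= n <oo)
  \int[mu]_(t in cell n) (gauss_weight eps (root_mass t))%:E)%E.
Proof.
rewrite /weight_integral -bigcup_cell ge0_integral_bigcup//.
- by move=> k; exact: measurable_itv.
- by rewrite bigcup_cell; exact: mweight.
- by move=> t _; rewrite lee_fin gauss_weight_ge0.
Qed.

Let mu_cell n : mu (cell n) = h%:E.
Proof.
rewrite /cell lebesgue_measure_itv/= lte_fin ltr_pM2r// ltr_nat ltnSn -EFinB.
by rewrite -mulrBl -natr1 addrAC subrr add0r mul1r.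
Qed.

Let sub_cell n : cell n `<=` `[0, +oo[%classic.
Proof. by rewrite -bigcup_cell => t nt; exists n. Qed.

Let mcell n eps : measurable_fun (cell n) (fun t => (gauss_weight eps (root_mass t))%:E : \bar R).
Proof. by apply: measurable_funS (mweight eps) => //; exact: sub_cell. Qed.

Let ch : c = 2 * h. Proof. by rewrite /h; field. Qed.

Let nS (n : nat) : n.+1%:R * h = n%:R * h + h. Proof. by rewrite -natr1 mulrDl mul1r. Qed.

Lemma half_mass_ge0 n : 0 <= half_mass n. Proof. exact: mass_ge0. Qed.

Lemma half_mass_le_root n t : n%:R * h <= t -> t <= n.+1%:R * h ->
  half_mass n.+1 <= root_mass t ^+ 2.
Proof.
move=> nt tn; rewrite sqr_sqrtr ?mass_ge0//; apply: le_mass => //.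
- exact: le_trans nt.
- by rewrite -/h [in leRHS]ch (nS n.+1) (nS n); lra.
Qed.

Lemma root_le_half_mass n t : n%:R * h <= t -> t <= n.+1%:R * h ->
  root_mass t ^+ 2 <= half_mass n + half_mass n.+1 + half_mass n.+2.
Proof.
move=> nt tn; rewrite sqr_sqrtr ?mass_ge0// /half_mass -/h.
rewrite -massD ?le_nh// -massD ?le_nh// ; last exact: leq_trans (leqnSn _).
apply: le_mass => //.
by rewrite [in leLHS]ch (nS n.+2) (nS n.+1); lra.
Qed.

(** On block n the integrand of the criterion is at least its value for the mass of
    block n + 1. *)
Lemma tail_sum_fin (eps Y : R) : 0 < eps -> (forall n, half_mass n <= Y) ->
  (weight_integral eps < +oo)%E ->
  (\sum_(0 <= n <oo) (gauss_tail (eps ^+ 2) (half_mass n))%:E < +oo)%E.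
Proof.
move=> eps0 hY fin.
pose C := 2 * Num.sqrt Y / eps ^+ 2.
have C0 : 0 <= C by rewrite divr_ge0 ?sqr_ge0// mulr_ge0// sqrtr_ge0.
have cellE n : (h%:E * (gauss_weight eps (Num.sqrt (half_mass n.+1)))%:E <=
    \int[mu]_(t in cell n) (gauss_weight eps (root_mass t))%:E)%E.
  rewrite -(mu_cell n) muleC -integral_cst; last exact: measurable_itv.
  apply: ge0_le_integral => //.
  - exact: measurable_itv.
  - by move=> t _; rewrite /= lee_fin gauss_weight_ge0.
  - exact: mcell.
  move=> t; rewrite /cell/= in_itv/= => /andP[nt tn]; rewrite lee_fin.
  apply: gauss_weight_nd; rewrite -[leRHS]ger0_norm ?sqrtr_ge0// -sqrtr_sqr.
  by rewrite ler_wsqrtr// half_mass_le_root// ltW.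
rewrite nneseries_recl//; last by move=> k _; rewrite lee_fin gauss_tail_ge0.
apply: lte_add_pinfty; first exact: ltry.
apply: (@le_lt_trans _ _ ((C / h)%:E * weight_integral eps)%E); last first.
  by apply: lte_mul_pinfty => //; rewrite lee_fin divr_ge0// ltW.
rewrite weight_integralE -nneseriesZl; last first.
  by move=> n _; apply: integral_ge0 => t _; rewrite lee_fin gauss_weight_ge0.
rewrite -(nneseries_addn 1); last by move=> k; rewrite lee_fin gauss_tail_ge0.
apply: lee_nneseries => n; first by rewrite lee_fin gauss_tail_ge0.
move=> _; rewrite addn1.
apply: (@le_trans _ _ ((C / h)%:E * (h%:E * (gauss_weight eps (Num.sqrt (half_mass n.+1)))%:E))%E).
  rewrite muleA -!EFinM divfK ?gt_eqF// lee_fin.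
  exact: gauss_tail_le_weight.
by apply: lee_wpmul2l => //; rewrite lee_fin divr_ge0// ltW.
Qed.

(** On block n the window has at most three times the mass of the heaviest of the
    blocks n, n + 1, n + 2, so the integrand is at most a multiple of the sum of
    three terms of the series, with eps^2 / 2 divided by three. *)
Lemma tail_sum_inf (eps Y : R) : (forall n, half_mass n <= Y) ->
  weight_integral eps = +oo%E ->
  (\sum_(0 <= n <oo) (gauss_tail (eps ^+ 2 / 6) (half_mass n))%:E = +oo)%E.
Proof.
move=> hY inf; apply/eqP; rewrite -leye_eq leNgt; apply/negP => fin.
pose f n : \bar R := (gauss_tail (eps ^+ 2 / 6) (half_mass n))%:E.
have f0 n : (0 <= f n)%E by rewrite lee_fin gauss_tail_ge0.
pose C := Num.sqrt (3 * Y).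
have C0 : 0 <= C by exact: sqrtr_ge0.
have tail3 n : gauss_weight eps (Num.sqrt (3 * half_mass n)) <= C * gauss_tail (eps ^+ 2 / 6) (half_mass n).
  have -> : gauss_tail (eps ^+ 2 / 6) (half_mass n) = gauss_tail (eps ^+ 2 / 2) (3 * half_mass n).
    rewrite /gauss_tail pmulr_rgt0//; case: ifP => // m0; congr (expR (- _)).
    by field; rewrite gt_eqF.
  by apply: gauss_weight_le_tail; rewrite ?mulr_ge0 ?half_mass_ge0// ler_wpM2l.
have cellE n : (\int[mu]_(t in cell n) (gauss_weight eps (root_mass t))%:E <=
    (h * C)%:E * (f n + f n.+1 + f n.+2))%E.
  apply: (@le_trans _ _ (\int[mu]_(t in cell n) (cst (C%:E * (f n + f n.+1 + f n.+2)) t))%E); last first.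
    rewrite integral_cst; last exact: measurable_itv.
    by rewrite [X in (_ * X <= _)%E]mu_cell muleAC -EFinM (mulrC C h).
  apply: ge0_le_integral => //.
  - exact: measurable_itv.
  - by move=> t _; rewrite lee_fin gauss_weight_ge0.
  - exact: mcell.
  move=> t; rewrite /cell/= in_itv/= => /andP[nt tn].
  have Hle := root_le_half_mass nt (ltW tn).
  rewrite -!EFinD -EFinM lee_fin.
  have w0 k : 0 <= C * gauss_tail (eps ^+ 2 / 6) (half_mass k).
    by rewrite mulr_ge0 ?gauss_tail_ge0.
  have le_one k : root_mass t ^+ 2 <= 3 * half_mass k ->
      gauss_weight eps (root_mass t) <= C * gauss_tail (eps ^+ 2 / 6) (half_mass k).
    move=> rk; apply: le_trans (tail3 k); apply: gauss_weight_nd.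
    by rewrite -[leLHS]ger0_norm ?sqrtr_ge0// -sqrtr_sqr ler_wsqrtr.
  have [h1|h1] := leP (root_mass t ^+ 2) (3 * half_mass n).
    by apply: (le_trans (le_one _ h1)); rewrite !mulrDr -addrA lerDl addr_ge0.
  have [h2|h2] := leP (root_mass t ^+ 2) (3 * half_mass n.+1).
    by apply: (le_trans (le_one _ h2)); rewrite !mulrDr addrAC lerDr addr_ge0.
  have h3 : root_mass t ^+ 2 <= 3 * half_mass n.+2.
    exact: (le_three_last Hle h1 h2).
  by apply: (le_trans (le_one _ h3)); rewrite !mulrDr lerDr addr_ge0.
have : (weight_integral eps <= (h * C)%:E * (\sum_(0 <= n <oo) f n + \sum_(0 <= n <oo) f n
    + \sum_(0 <= n <oo) f n))%E.
  rewrite weight_integralE.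
  apply: (@le_trans _ _ (\sum_(0 <= n <oo) (h * C)%:E * (f n + f n.+1 + f n.+2))%E).
    apply: lee_nneseries => // n _.
    by move=> _; apply: integral_ge0 => t _; rewrite lee_fin gauss_weight_ge0.
  rewrite nneseriesZl; last by move=> n _; rewrite !adde_ge0.
  apply: lee_wpmul2l; first by rewrite lee_fin mulr_ge0// ltW.
  exact: nneseries_three_shifts.
rewrite inf leye_eq => /eqP.
have -> : (\sum_(0 <= n <oo) f n)%E = (fine (\sum_(0 <= n <oo) f n))%:E.
  by rewrite fineK// ge0_fin_numE// nneseries_ge0.
by rewrite -!EFinD -EFinM.
Qed.

End running_integral.

(** * A quadratic Lyapunov function for a stable matrix *)

Section euclidean.
Variable R : realType.

Definition dot n (x y : 'cV[R]_n) : R := \sum_i x i ord0 * y i ord0.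
Definition sqnorm n (x : 'cV[R]_n) : R := \sum_i x i ord0 ^+ 2.

Lemma sqnorm_ge0 n (x : 'cV[R]_n) : 0 <= sqnorm x.
Proof. by apply: sumr_ge0 => i _; exact: sqr_ge0. Qed.

Lemma cauchy_schwarz n (a b : 'I_n -> R) :
  (\sum_i a i * b i) ^+ 2 <= (\sum_i a i ^+ 2) * \sum_i b i ^+ 2.
Proof.
rewrite expr2 [leLHS]mulr_suml.
have -> : (\sum_i a i ^+ 2) * (\sum_j b j ^+ 2)
    = \sum_i \sum_j (a i ^+ 2 * b j ^+ 2 + a j ^+ 2 * b i ^+ 2) / 2.
  rewrite [LHS]splitr; under [RHS]eq_bigr do rewrite -mulr_suml big_split/=.
  rewrite -mulr_suml big_split/= [X in _ = (_ + X) / 2]exchange_big/= -mulrDl.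
  by congr ((_ + _) / 2); rewrite mulr_suml; apply: eq_bigr => i _; rewrite mulr_sumr.
apply: ler_sum => i _; rewrite mulr_sumr; apply: ler_sum => j _.
by have := sqr_ge0 (a i * b j - a j * b i); nra.
Qed.

Lemma sqnorm_mulmx m n (M : 'M[R]_(m, n)) (x : 'cV[R]_n) :
  sqnorm (M *m x) <= (\sum_i \sum_j M i j ^+ 2) * sqnorm x.
Proof.
rewrite /sqnorm mulr_suml; apply: ler_sum => i _; rewrite mxE.
exact: cauchy_schwarz.
Qed.

Lemma sqnormD_le n k (x y : 'cV[R]_n) : 0 < k ->
  sqnorm (x + y) <= (1 + k) * sqnorm x + (1 + k^-1) * sqnorm y.
Proof.
move=> k0; rewrite /sqnorm !mulr_sumr -big_split/=; apply: ler_sum => i _.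
rewrite mxE; set a := x i _; set b := y i _.
rewrite -subr_ge0 (_ : _ - _ = k * (a - b / k) ^+ 2); last by field; rewrite gt_eqF.
by rewrite mulr_ge0 ?sqr_ge0// ltW.
Qed.

Lemma dot_le n k (x y : 'cV[R]_n) : 0 < k ->
  2 * dot x y <= k * sqnorm x + k^-1 * sqnorm y.
Proof.
move=> k0; rewrite /sqnorm /dot !mulr_sumr -big_split/=; apply: ler_sum => i _.
set a := x i _; set b := y i _.
rewrite -subr_ge0 (_ : _ - _ = k * (a - b / k) ^+ 2); last by field; rewrite gt_eqF.
by rewrite mulr_ge0 ?sqr_ge0// ltW.
Qed.

Lemma dotDr n (x y z : 'cV[R]_n) : dot x (y + z) = dot x y + dot x z.
Proof. by rewrite -big_split; apply: eq_bigr => i _; rewrite mxE mulrDr. Qed.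

End euclidean.

Lemma finite_lower_bound (R : realFieldType) n (f : 'I_n -> R) : (forall i, 0 < f i) ->
  exists2 b, 0 < b & forall i, b <= f i.
Proof.
elim: n f => [|n IH] f f0; first by exists 1 => // -[].
have [b b0 bf] := IH (fun i => f (lift ord0 i)) (fun i => f0 _).
exists (Num.min b (f ord0)); first by rewrite lt_min b0 f0.
by move=> i; case: (unliftP ord0 i) => [j|] ->; rewrite ge_min ?bf ?lexx ?orbT.
Qed.

(** An off-diagonal entry l1 + i l2 of a complex matrix, applied to a + i b and
    a' + i b', contributes at most its size times the mean of the squared moduli. *)
Lemma dominant_pair (R : realFieldType) (l1 l2 a b a' b' eta : R) :
  `|l1| + `|l2| <= eta ->
  l1 * (a * a' + b * b') + l2 * (b * a' - a * b')
    <= eta * ((a ^+ 2 + b ^+ 2) + (a' ^+ 2 + b' ^+ 2)) / 2.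
Proof.
move=> le.
set r := (a ^+ 2 + b ^+ 2 + (a' ^+ 2 + b' ^+ 2)) / 2.
have r0 : 0 <= r by rewrite /r divr_ge0// !addr_ge0 ?sqr_ge0.
have H u v : `|v| <= r -> u * v <= `|u| * r.
  by move=> vr; apply: (le_trans (ler_norm _)); rewrite normrM ler_wpM2l.
apply: (@le_trans _ _ (`|l1| * r + `|l2| * r)).
  apply: lerD; apply: H; rewrite ler_norml /r; apply/andP; split.
  - by have := sqr_ge0 (a + a'); have := sqr_ge0 (b + b'); nra.
  - by have := sqr_ge0 (a - a'); have := sqr_ge0 (b - b'); nra.
  - by have := sqr_ge0 (b + a'); have := sqr_ge0 (a - b'); nra.
  - by have := sqr_ge0 (b - a'); have := sqr_ge0 (a + b'); nra.
by rewrite -mulrDl -mulrA ler_wpM2r.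
Qed.

Section lyapunov.
Variable R : realType.
Local Notation C := (complex R).

(** The Schur form of A over the complex numbers, P A = U P with U lower triangular,
    written in real and imaginary parts; N is the inverse of P.  The diagonal of
    U consists of eigenvalues of A. *)
Lemma stable_trigonalization d (A : 'M[R]_d) : (0 < d)%N -> stable_mx A ->
  exists (S1 S2 U1 U2 N1 N2 : 'M[R]_d),
    [/\ S1 *m A = U1 *m S1 - U2 *m S2, S2 *m A = U1 *m S2 + U2 *m S1,
        N1 *m S1 - N2 *m S2 = 1%:M
      & forall i j : 'I_d, (U1 i i < 0) /\ ((i < j)%N -> U1 i j = 0 /\ U2 i j = 0)].
Proof.
move=> d0 Ast; set AC := map_mx (real_complex R) A.
have [P Pu trig] := Schur AC d0.
have {}Pu := unitarymx_unit Pu.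
pose U := P *m AC *m invmx P.
have UE : P *m AC = U *m P by rewrite /U mulmxKV.
have {}trig : is_trig_mx U by move: trig; rewrite /similar_to conjumx.
have eigU i : eigenvalue AC (U i i).
  rewrite eigenvalue_root_char.
  have -> : char_poly AC = char_poly U.
    rewrite /char_poly /char_poly_mx /U.
    have -> : 'X%:M - map_mx polyC (P *m AC *m invmx P) =
      map_mx polyC P *m ('X%:M - map_mx polyC AC) *m map_mx polyC (invmx P).
      have PK : map_mx polyC P *m map_mx polyC (invmx P) = 1%:M.
        by rewrite -map_mxM mulmxV// map_mx1.
      by rewrite mulmxBr mulmxBl !map_mxM scalar_mxC -(mulmxA 'X%:M) PK mulmx1.
    by rewrite !det_mulmx mulrAC -det_mulmx -map_mxM mulmxV// map_mx1 det1 mul1r.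
  rewrite char_poly_trig//.
  by rewrite (bigD1 i)//= rootM root_XsubC eqxx.
pose re (M : 'M[C]_d) : 'M[R]_d := map_mx (@complex.Re R) M.
pose im (M : 'M[C]_d) : 'M[R]_d := map_mx (@complex.Im R) M.
have reM M M' : re (M *m M') = re M *m re M' - im M *m im M'.
  apply/matrixP => i j; rewrite !mxE (raddf_sum (@complex.Re R : {additive C -> R})) -sumrB.
  by apply: eq_bigr => k _; rewrite !mxE; case: (M i k) (M' k j) => ? ? [].
have imM M M' : im (M *m M') = re M *m im M' + im M *m re M'.
  apply/matrixP => i j; rewrite !mxE (raddf_sum (@complex.Im R : {additive C -> R})) -big_split/=.
  by apply: eq_bigr => k _; rewrite !mxE; case: (M i k) (M' k j) => ? ? [].
have reA : re AC = A by apply/matrixP => i j; rewrite !mxE.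
have imA : im AC = 0 by apply/matrixP => i j; rewrite !mxE.
exists (re P), (im P), (re U), (im U), (re (invmx P)), (im (invmx P)); split.
- by rewrite -reM -UE reM reA imA mulmx0 subr0.
- by rewrite -imM -UE imM reA imA mulmx0 add0r.
- rewrite -reM mulVmx//; apply/matrixP => i j; rewrite !mxE.
  by case: (i == j).
- move=> i j; split; first by rewrite mxE; apply: Ast; exact: eigU.
  by move=> ij; rewrite /re /im [_ i j]mxE [X in _ /\ X = _]mxE (is_trig_mxP trig).
Qed.

(** Stack the real and imaginary parts of D P, where P brings A to lower triangular
    form and D is the diagonal matrix with entries de^i.  Conjugation by D
    multiplies the entry (i, j) of the triangular matrix by de^(i - j), so for
    small de the off-diagonal part is dominated by the diagonal, whose real part
    is negative.  The quadratic form is the squared norm of S x. *)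
Lemma stable_lyapunov d (A : 'M[R]_d) : (0 < d)%N -> stable_mx A ->
  exists (S : 'M[R]_(d + d, d)) (N : 'M[R]_(d, d + d)) (b : R),
    [/\ 0 < b, N *m S = 1%:M
      & forall x, dot (S *m x) (S *m (A *m x)) <= - b * sqnorm (S *m x)].
Proof.
move=> d0 Ast.
have [S1 [S2 [U1 [U2 [N1 [N2 [SA1 SA2 NS tri]]]]]]] := stable_trigonalization d0 Ast.
have [b b0 bU] := @finite_lower_bound _ _ (fun i => - U1 i i)
  (fun i => ltac:(by rewrite oppr_gt0; have [] := tri i i)).
pose tot := 1 + \sum_i \sum_j (`|U1 i j| + `|U2 i j|).
have tot0 : 0 < tot by rewrite ltr_pwDl// !sumr_ge0// => i _; rewrite sumr_ge0// => j _; rewrite addr_ge0.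
pose eta := b / (2 * d%:R).
have dR0 : 0 < d%:R :> R by rewrite ltr0n.
have eta0 : 0 < eta by rewrite divr_gt0// mulr_gt0.
(* de * |U i j| <= eta for all entries. *)
pose de := Num.min 1 (eta / tot).
have de0 : 0 < de by rewrite lt_min ltr01 divr_gt0.
have de1 : de <= 1 by rewrite ge_min lexx.
have deN0 : de != 0 by rewrite gt_eqF.
pose T1 := \matrix_(i, j) (de ^+ i * S1 i j).
pose T2 := \matrix_(i, j) (de ^+ i * S2 i j).
pose L1 := \matrix_(i, j) (de ^+ i / de ^+ j * U1 i j) : 'M[R]_d.
pose L2 := \matrix_(i, j) (de ^+ i / de ^+ j * U2 i j) : 'M[R]_d.
pose M1 := \matrix_(i, j) (N1 i j / de ^+ j).
pose M2 := \matrix_(i, j) (N2 i j / de ^+ j).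
pose S := col_mx T1 T2.
have LS (U V : 'M[R]_d) i j : ((\matrix_(i, j) (de ^+ i / de ^+ j * U i j)) *m
    (\matrix_(i, j) (de ^+ i * V i j))) i j = de ^+ i * (U *m V) i j.
  rewrite !mxE mulr_sumr; apply: eq_bigr => k _; rewrite !mxE.
  by field; rewrite expf_neq0.
have SA (V : 'M[R]_d) i j : ((\matrix_(i, j) (de ^+ i * V i j)) *m A) i j = de ^+ i * (V *m A) i j.
  by rewrite !mxE mulr_sumr; apply: eq_bigr => k _; rewrite !mxE mulrA.
have MS (U V : 'M[R]_d) i j : ((\matrix_(i, j) (U i j / de ^+ j)) *m
    (\matrix_(i, j) (de ^+ i * V i j))) i j = (U *m V) i j.
  rewrite !mxE; apply: eq_bigr => k _; rewrite !mxE.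
  by field; rewrite expf_neq0.
have TA1 : T1 *m A = L1 *m T1 - L2 *m T2.
  apply/matrixP => i j; rewrite SA SA1 [in RHS]mxE [X in _ = _ + X]mxE !LS -mulrBr.
  by rewrite [in LHS]mxE [X in _ * (_ + X) = _]mxE.
have TA2 : T2 *m A = L1 *m T2 + L2 *m T1.
  by apply/matrixP => i j; rewrite SA SA2 [in RHS]mxE !LS -mulrDr [in LHS]mxE.
have small i j : i != j -> `|L1 i j| + `|L2 i j| <= eta.
  move=> ij; rewrite !mxE ![`|_ * _|]normrM -mulrDr.
  have [lt|ge] := ltnP i j.
    by have [_ /(_ lt)[-> ->]] := tri i j; rewrite normr0 addr0 mulr0 ltW.
  have {ge}lt : (j < i)%N by rewrite ltn_neqAle ge andbT eq_sym.
  have U0 k l : 0 <= `|U1 k l| + `|U2 k l| by rewrite addr_ge0.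
  have leU : `|U1 i j| + `|U2 i j| <= tot.
    rewrite /tot (bigD1 i)//= (bigD1 j)//=.
    have n1 : 0 <= \sum_(k < d | k != j) (`|U1 i k| + `|U2 i k|) by exact: sumr_ge0.
    have n2 : 0 <= \sum_(k < d | k != i) \sum_(l < d) (`|U1 k l| + `|U2 k l|).
      by apply: sumr_ge0 => k _; exact: sumr_ge0.
    by move: n1 n2 (U0 i j); clear; lra.
  rewrite -[leRHS](divfK (lt0r_neq0 tot0)).
  apply: ler_pM; rewrite ?mulr_ge0 ?normr_ge0//.
  rewrite -normrM; apply: (@le_trans _ _ de); last by rewrite ge_min lexx orbT.
  rewrite -(subnK (ltnW lt)) exprD mulfK ?expf_neq0// ger0_norm ?exprn_ge0 ?(ltW de0)//.
  by rewrite -[leRHS]expr1 ler_wiXn2l ?subn_gt0// ltW.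
exists S, (row_mx M1 (- M2)), (b / 2); split; first by rewrite divr_gt0.
  rewrite mul_row_col mulNmx -NS; apply/matrixP => i j.
  by rewrite [in LHS]mxE [X in _ + X = _]mxE !MS [in RHS]mxE [X in _ = _ + X]mxE.
move=> x; rewrite /S mulmxA !mul_col_mx TA1 TA2.
rewrite mulmxBl mulmxDl -!mulmxA.
move: (T1 *m x) (T2 *m x) => p q.
rewrite /dot /sqnorm !big_split_ord/=.
under eq_bigr do rewrite !col_mxEu.
under [X in _ + X <= _]eq_bigr do rewrite !col_mxEd.
under [X in _ <= _ * (X + _)]eq_bigr do rewrite col_mxEu.
under [X in _ <= _ * (_ + X)]eq_bigr do rewrite col_mxEd.
pose r i := p i ord0 ^+ 2 + q i ord0 ^+ 2.
have r0 i : 0 <= r i by rewrite addr_ge0 ?sqr_ge0.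
rewrite -!big_split/=.
apply: (@le_trans _ _ (\sum_i \sum_j ((if i == j then - b * r i else 0) + eta * (r i + r j) / 2))).
  apply: ler_sum => i _; rewrite !mxE -!sumrB -big_split/= !mulr_sumr -big_split/=.
  apply: ler_sum => j _.
  have [<-|ij] := eqVneq i j.
    rewrite (_ : _ + _ = L1 i i * r i); last by rewrite /r !mxE; ring.
    apply: (@le_trans _ _ (- b * r i)); last first.
      by rewrite lerDl divr_ge0// mulr_ge0 ?(ltW eta0) ?(addr_ge0 (r0 i) (r0 i)).
    rewrite ler_wpM2r// !mxE divff ?expf_neq0// mul1r.
    by have := bU i; rewrite lerNr.
  rewrite add0r (_ : _ + _ = L1 i j * (p i ord0 * p j ord0 + q i ord0 * q j ord0)
     + L2 i j * (q i ord0 * p j ord0 - p i ord0 * q j ord0)); last by rewrite !mxE; ring.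
  exact/dominant_pair/small.
set tr := \sum_(i < d) (_ + _).
have inner i : \sum_j ((if i == j then - b * r i else 0) + eta * (r i + r j) / 2)
    = - b * r i + eta / 2 * (d%:R * r i + tr).
  rewrite big_split/= -big_mkcond/= (big_pred1 i); last by move=> j; rewrite eq_sym.
  congr (_ + _); rewrite -mulr_suml -mulr_sumr big_split/= sumr_const card_ord.
  by rewrite -/tr mulr_natl; ring.
rewrite (eq_bigr _ (fun i _ => inner i)) big_split/= -!mulr_sumr [\sum_(i < d) (d%:R * _ + _)]big_split/= -mulr_sumr.
have -> : \sum_(i < d) r i = tr by [].
rewrite sumr_const card_ord -/tr -[tr *+ d]mulr_natl.
rewrite (_ : _ + _ = - (b / 2) * tr)//.
by rewrite /eta; field; rewrite gt_eqF.
Qed.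

End lyapunov.

(** * Contraction over one block *)

Section block_dynamics.
Variable R : realType.
Local Notation mu := (@lebesgue_measure R).

(** Extending a path by its value at 0 to negative times removes the boundary at 0
    from all questions of continuity and differentiability. *)
Lemma extend_continuous (V : topologicalType) (f : R -> V) :
  {within `[0, +oo[, continuous f} -> continuous (fun t : R => f (Num.max t 0)).
Proof.
move=> /subspace_continuousP cf t.
have m0 : `[0, +oo[%classic (Num.max t 0) by rewrite /= in_itv/= andbT le_max lexx orbT.
have cm : (fun s : R => Num.max s 0) @ t --> Num.max t 0.
  by apply: continuous_max; [exact: cvg_id|exact: cvg_cst].
move=> U HU; have {}HU := cf _ m0 _ HU.
have : nbhs t [set s : R | `[0, +oo[%classic (Num.max s 0) -> U (f (Num.max s 0))].
  exact: (cm _ HU).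
apply: filterS => s; apply.
by rewrite /= in_itv/= andbT le_max lexx orbT.
Qed.

Lemma continuous_coord (d r : nat) (f : R -> 'M[R]_(d, r)) i j : continuous f ->
  continuous (fun t => f t i j).
Proof.
move=> cf t; apply: (@continuous_comp _ _ _ f (fun M : 'M[R]_(d, r) => M i j)).
  exact: cf.
exact: coord_continuous.
Qed.

Lemma continuous_integrable (f : R -> R) (a b : R) : continuous f ->
  mu.-integrable `[a, b] (EFin \o f).
Proof.
move=> cf; apply: continuous_compact_integrable; first exact: segment_compact.
exact: continuous_subspaceT.
Qed.

Lemma extension_integrable (g : R -> R) b : continuous (fun s : R => g (Num.max s 0)) ->
  mu.-integrable `[0, b] (EFin \o g).
Proof.
move=> cg; pose g' s := g (Num.max s 0).
apply: (@eq_integrable _ _ _ mu `[0, b] _ (EFin \o g')) => //.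
  by move=> s /set_mem/=; rewrite in_itv/= => /andP[s0 _]; rewrite /g' max_l.
exact: continuous_integrable.
Qed.

(** The integral from -1 is differentiable on both sides of 0. *)
Lemma primitive (f : R -> R) : continuous f -> exists F : R -> R,
  (forall t : R, 0 <= t -> is_derive t 1 F (f t)) /\
  (forall t : R, 0 <= t -> Rintegral mu `[0, t] f = F t).
Proof.
move=> cf; pose G (t : R) : R := Rintegral mu `[-1, t] f.
exists (G - cst (G 0)); split => t t0.
  have [dG G't] : derivable G t 1 /\ derive1 G t = f t.
    apply: (@continuous_FTC1_closed _ f (-1) t (t + 1)) => //.
    - by rewrite ltrDl.
    - exact: continuous_integrable.
    - by apply: lt_le_trans t0; rewrite ltrN10.
    - exact: cf.
  have dGt : is_derive t 1 G (f t) by split => //; rewrite -G't derive1E.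
  by rewrite -[f t]subr0; apply: is_deriveB.
have N0 : (-1 : R) <= 0 by rewrite lerN10.
rewrite fctE/= /G (@Rintegral_itvB _ f (BLeft (-1)) (BRight t) 0) ?bnd_simp//.
- rewrite Rintegral_itv_obnd_cbnd//.
  apply: (integrableS _ _ _ (continuous_integrable 0 t cf)) => //.
  by apply: subset_itvr; rewrite bnd_simp.
- exact: continuous_integrable.
Qed.

(** The function exp (b u) (f u - k / b) is nonincreasing. *)
Lemma linear_gronwall (f : R -> R) (df : R -> R) (s t b k : R) : 0 < b -> s <= t ->
  (forall u : R, s <= u -> is_derive u 1 f (df u)) ->
  (forall u, s <= u -> u <= t -> df u <= - b * f u + k) -> 0 <= k ->
  f t <= expR (- (b * (t - s))) * f s + k / b.
Proof.
move=> b0 st fd le k0.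
pose phi := fun u => expR (b * u) * (f u - k / b).
have dphi u : s <= u -> is_derive u 1 phi (expR (b * u) * (b * f u - k + df u)).
  move=> su; have fu := fd _ su.
  have -> : expR (b * u) * (b * f u - k + df u) =
     expR (b * u) *: (df u - 0) + (f u - k / b) *: (expR (b * u) * (b * 1)).
    by rewrite /GRing.scale/=; field; rewrite gt_eqF.
  apply: (@is_deriveM _ _ (expR \o (fun v => b * v)) (f - cst (k / b))).
have mono : phi t <= phi s.
  apply: (@ler0_derive1_le_cc _ phi s t) => //; rewrite ?in_itv/= ?lexx ?st//.
  - by move=> u; rewrite in_itv/= => /andP[/ltW /dphi[]].
  - move=> u; rewrite in_itv/= => /andP[/ltW su /ltW ut].
    have [_ du] := dphi _ su; rewrite derive1E du.
    rewrite mulr_ge0_le0 ?expR_ge0//; have := le _ su ut; lra.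
  - apply: derivable_within_continuous => u; rewrite in_itv/= => /andP[su _].
    by have [] := dphi _ su.
have : expR (b * t) * (f t - k / b) <= expR (b * s) * (f s - k / b) := mono.
rewrite (_ : expR (b * s) = expR (b * t) * expR (- (b * (t - s)))); last first.
  by rewrite -expRD; congr expR; ring.
rewrite -mulrA ler_pM2l ?expR_gt0// lerBlDr => /le_trans; apply.
by rewrite lerD2r ler_wpM2l ?expR_ge0// gerBl divr_ge0// ltW.
Qed.

Lemma is_derive_sqnorm n (z dz : R -> 'cV[R]_n) (u : R) :
  (forall i, is_derive u 1 (fun v => z v i ord0) (dz u i ord0)) ->
  is_derive u 1 (fun v => sqnorm (z v)) (2 * dot (z u) (dz u)).
Proof.
move=> dzi.
rewrite (_ : (fun v => sqnorm (z v)) = \sum_(i < n) (fun v => z v i ord0) ^+ 2); last first.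
  by apply/funext => v; rewrite /sqnorm fct_sumE; apply: eq_bigr => i _.
rewrite /dot mulr_sumr; apply: is_derive_sum => i.
rewrite (_ : 2 * _ = (2%:R * z u i ord0 ^+ 1) *: dz u i ord0); last by rewrite expr1 mulrA.
exact: is_deriveX.
Qed.

Lemma is_derive_mulmx m n (S : 'M[R]_(m, n)) (z dz : R -> 'cV[R]_n) (u : R) :
  (forall i, is_derive u 1 (fun v => z v i ord0) (dz u i ord0)) ->
  forall k, is_derive u 1 (fun v => (S *m z v) k ord0) ((S *m dz u) k ord0).
Proof.
move=> dzi k.
rewrite (_ : (fun v => _) = \sum_(i < n) (S k i *: (fun v => z v i ord0))); last first.
  by apply/funext => v; rewrite mxE fct_sumE; apply: eq_bigr => i _.
by rewrite mxE; apply: is_derive_sum => i; exact: is_deriveZ.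
Qed.

Variables (d : nat) (A : 'M[R]_d) (x : R -> 'cV[R]_d).
Hypothesis cx : {within `[0, +oo[, continuous x}.

Definition drift (t : R) : 'cV[R]_d :=
  \col_i Rintegral mu `[0, t] (fun s => (A *m x s) i ord0).

(** For a solution of the equation this is xi plus the integral of sigma dB, so its
    increments are those of the Wiener integrals. *)
Definition noise (t : R) : 'cV[R]_d := x t - drift t.

Lemma drift_primitive : exists F : R -> 'cV[R]_d,
  (forall t : R, 0 <= t -> forall i, is_derive t 1 (fun s => F s i ord0) ((A *m x t) i ord0)) /\
  (forall t, 0 <= t -> drift t = F t).
Proof.
pose y (t : R) := x (Num.max t 0).
have cy : continuous y := extend_continuous cx.
have cAy i : continuous (fun t => (A *m y t) i ord0).
  rewrite (_ : (fun t => _) = (fun t => \sum_j A i j * y t j ord0)); last first.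
    by apply/funext => t; rewrite mxE.
  apply: continuous_big => [|j _ t]; first exact: add_continuous.
  by apply: cvgM; [exact: cvg_cst|exact: continuous_coord].
have /choice[F HF] : forall i, exists F : R -> R,
  (forall t : R, 0 <= t -> is_derive t 1 F ((A *m y t) i ord0)) /\
  (forall t : R, 0 <= t -> Rintegral mu `[0, t] (fun s => (A *m y s) i ord0) = F t).
  by move=> i; exact: primitive.
exists (fun t => \col_i F i t); split => [t t0 i|t t0].
  rewrite (_ : (fun s => _) = F i); last by apply/funext => s; rewrite mxE.
  have [/(_ t t0)] := HF i; by rewrite /y max_l.
apply/matrixP => i j; rewrite !mxE; have [_ /(_ t t0) <-] := HF i.
apply: eq_Rintegral => s /set_mem/=; rewrite in_itv/= => /andP[s0 _].
by rewrite /y max_l.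
Qed.

(** Let z start from x s and follow the drift of x, so that x = z + e where e is the
    increment of the noise.  Then z' = A z + A e, and the Lyapunov function of z
    decays up to a multiple of the bound U of the squared size of e. *)
Lemma noise_increment_bound (S : 'M[R]_(d + d, d)) (b : R) : 0 < b ->
  (forall y, dot (S *m y) (S *m (A *m y)) <= - b * sqnorm (S *m y)) ->
  forall (s U t : R), 0 <= s -> s <= t ->
    (forall u, s <= u -> u <= t -> sqnorm (noise u - noise s) <= U) ->
    exists z e : 'cV[R]_d, [/\ x t = z + e, sqnorm e <= U
      & sqnorm (S *m z) <= expR (- (b * (t - s))) * sqnorm (S *m x s)
          + (\sum_i \sum_j (S *m A) i j ^+ 2) / b / b * U].
Proof.
move=> b0 lyap.
set CA := \sum_i \sum_j (S *m A) i j ^+ 2.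
have CA0 : 0 <= CA by apply: sumr_ge0 => i _; apply: sumr_ge0 => j _; exact: sqr_ge0.
move=> s U t s0 st HU.
have [F [dF FE]] := drift_primitive.
pose z (u : R) : 'cV[R]_d := x s + (F u - F s).
have U0 : 0 <= U by apply: le_trans (HU s _ _) => //; exact: sqnorm_ge0.
have xz u : s <= u -> x u = z u + (noise u - noise s).
  move=> su; rewrite /z /noise !FE//; last exact: le_trans su.
  by apply/matrixP => i j; rewrite !mxE; ring.
exists (z t), (noise t - noise s); split; [exact: xz|exact: HU|].
have dz u : s <= u -> forall i, is_derive u 1 (fun v => z v i ord0) ((A *m x u) i ord0).
  move=> su i; have := dF u (le_trans s0 su) i => dFu.
  rewrite (_ : (fun v => _) = cst (x s i ord0 - F s i ord0) + (fun v => F v i ord0)); last first.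
    by apply/funext => v; rewrite !fctE /cst /z !mxE; ring.
  by rewrite -[X in is_derive _ _ _ X]add0r; apply: is_deriveD.
have dV u : s <= u -> is_derive u 1 (fun v => sqnorm (S *m z v))
    (2 * dot (S *m z u) (S *m (A *m x u))).
  move=> su; apply: (@is_derive_sqnorm _ (fun v => S *m z v) (fun v => S *m (A *m x v))).
  exact: (@is_derive_mulmx _ _ S z (fun v => A *m x v) u (dz u su)).
have zs : z s = x s by rewrite /z subrr addr0.
have := @linear_gronwall (fun v => sqnorm (S *m z v))
  (fun u => 2 * dot (S *m z u) (S *m (A *m x u))) s t b (CA / b * U) b0 st dV.
rewrite zs [CA / b * U / b]mulrAC => G; apply: G; last by rewrite mulr_ge0// divr_ge0// ltW.
move=> u su ut /=; rewrite (xz u su); set e := noise u - noise s.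
rewrite (mulmxDr A (z u) e) (mulmxDr S (A *m z u)) dotDr mulrDr.
have le1 := lyap (z u).
have le2 := dot_le (S *m z u) (S *m (A *m e)) b0.
have le3 : sqnorm (S *m (A *m e)) <= CA * U.
  rewrite mulmxA; apply: (le_trans (sqnorm_mulmx _ _)).
  by apply: ler_pM; rewrite ?sqnorm_ge0 ?HU.
have le4 : b^-1 * sqnorm (S *m (A *m e)) <= CA / b * U.
  by rewrite mulrAC mulrC ler_wpM2r// invr_ge0 ltW.
by move: le1 le2 le4; clear; lra.
Qed.

End block_dynamics.

(** The arithmetic of the next proof, in which z and e stand for the Lyapunov
    function of the two parts of the path. *)
Lemma split_square_bound (R : realFieldType) (k k' r rho z e V U K0 CS K1 K2 : R) :
  0 <= k -> 0 <= k' -> 0 <= U -> z <= r * V + K0 * U -> e <= CS * U ->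
  (1 + k) * r = rho -> K1 = (1 + k) * K0 + (1 + k') * CS -> 0 <= K2 ->
  (1 + k) * z + (1 + k') * e <= rho * V + (1 + K1 + K2) * U.
Proof.
move=> k0 k'0 U0 zV eU <- -> K20.
have z1 : (1 + k) * z <= (1 + k) * (r * V + K0 * U) by rewrite ler_wpM2l// addr_ge0.
have e1 : (1 + k') * e <= (1 + k') * (CS * U) by rewrite ler_wpM2l// addr_ge0.
apply: le_trans (lerD z1 e1) _; rewrite -subr_ge0 (_ : _ - _ = (1 + K2) * U); last by ring.
by rewrite mulr_ge0// addr_ge0.
Qed.

(** The squared norm of x = z + e is at most 1 + k times that of z plus a multiple
    of that of e; k is chosen so that (1 + k) exp (- b h) is still below 1. *)
Lemma block_contraction (R : realType) d (A : 'M[R]_d) (h : R) :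
  (0 < d)%N -> stable_mx A -> 0 < h ->
  exists (V : 'cV[R]_d -> R) (rho K : R),
    [/\ 0 <= rho, rho < 1, 0 < K, (forall y, 0 <= V y)
      & forall x : R -> 'cV[R]_d, {within `[0, +oo[, continuous x} -> forall s U, 0 <= s ->
          (forall u, s <= u -> u <= s + h -> sqnorm (noise A x u - noise A x s) <= U) ->
          V (x (s + h)) <= rho * V (x s) + K * U /\
          (forall t, s <= t -> t <= s + h -> sqnorm (x t) <= K * (V (x s) + U))].
Proof.
move=> d0 Ast h0; have [S [N [b [b0 NS lyap]]]] := stable_lyapunov d0 Ast.
pose frob m n (M : 'M[R]_(m, n)) := \sum_i \sum_j M i j ^+ 2.
have frob0 m n (M : 'M[R]_(m, n)) : 0 <= frob m n M.
  by apply: sumr_ge0 => i _; apply: sumr_ge0 => j _; exact: sqr_ge0.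
pose r := expR (- (b * h)).
have r0 : 0 < r by exact: expR_gt0.
have r1 : r < 1 by rewrite expR_lt1 oppr_lt0 mulr_gt0.
(* (1 + k) * r is the midpoint of r and 1. *)
pose k := (r^-1 - 1) / 2.
have k0 : 0 < k by rewrite divr_gt0// subr_gt0 invf_gt1.
pose K0 := frob _ _ (S *m A) / b / b.
have K00 : 0 <= K0 by rewrite !divr_ge0// ltW.
pose K1 := (1 + k) * K0 + (1 + k^-1) * frob _ _ S.
have K10 : 0 <= K1 by rewrite addr_ge0// mulr_ge0// addr_ge0// ltW// invr_gt0.
pose K2 := frob _ _ N * (2 + 2 * K0 + 2 * frob _ _ S).
have K20 : 0 <= K2 by rewrite mulr_ge0// !addr_ge0// mulr_ge0.
exists (fun y => sqnorm (S *m y)), ((1 + r) / 2), (1 + K1 + K2); split.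
- by rewrite divr_ge0// addr_ge0// ltW.
- by rewrite ltr_pdivrMr// mul1r (_ : 2 = 1 + 1)// ltrD2l.
- by rewrite -addrA ltr_pwDl// addr_ge0.
- by move=> y; exact: sqnorm_ge0.
move=> x cx s U s0 HU.
have U0 : 0 <= U by apply: le_trans (HU s _ _); rewrite ?sqnorm_ge0// lerDl ltW.
have V0 := sqnorm_ge0 (S *m x s).
have bound t : s <= t -> t <= s + h -> exists z e : 'cV[R]_d,
    [/\ x t = z + e, sqnorm (S *m e) <= frob _ _ S * U
      & sqnorm (S *m z) <= expR (- (b * (t - s))) * sqnorm (S *m x s) + K0 * U].
  move=> st tsh; have [|z [e [xze eU zV]]] := @noise_increment_bound _ _ _ _ cx S b b0 lyap s U t s0 st.
    by move=> u su ut; apply: HU => //; exact: le_trans tsh.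
  exists z, e; split => //.
  by apply: (le_trans (sqnorm_mulmx _ _)); apply: ler_wpM2l eU; exact: frob0.
split.
  have ssh : s <= s + h by rewrite lerDl ltW.
  have [z [e [-> eU zV]]] := bound (s + h) ssh (lexx _).
  rewrite mulmxDr; apply: (le_trans (sqnormD_le _ _ k0)).
  have kr : (1 + k) * r = (1 + r) / 2 by rewrite /k; field; rewrite gt_eqF.
  rewrite (addrC s h) addrK -/r in zV.
  apply: (split_square_bound (ltW k0) _ U0 zV eU kr _ K20) => //.
  by rewrite invr_ge0 ltW.
move=> t st tsh; have [//|//|z [e [xE eU zV]]] := bound t _ _.
rewrite -[x t]mul1mx -NS -mulmxA; apply: (le_trans (sqnorm_mulmx _ _)); rewrite -/(frob _ _ N).
have le1 : sqnorm (S *m x t) <= (2 + 2 * K0 + 2 * frob _ _ S) * (sqnorm (S *m x s) + U).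
  rewrite xE mulmxDr; apply: (le_trans (sqnormD_le _ _ ltr01)); rewrite invr1.
  have rt : expR (- (b * (t - s))) * sqnorm (S *m x s) <= sqnorm (S *m x s).
    by rewrite ler_piMl// expR_le1 oppr_le0 mulr_ge0 ?subr_ge0// ltW.
  have p1 : 0 <= K0 * sqnorm (S *m x s) by rewrite mulr_ge0.
  have p2 : 0 <= frob _ _ S * sqnorm (S *m x s) by rewrite mulr_ge0.
  by move: zV eU rt p1 p2 U0; clear; lra.
apply: (@le_trans _ _ (K2 * (sqnorm (S *m x s) + U))).
  by rewrite /K2 -mulrA ler_wpM2l// frob0.
by rewrite ler_wpM2r ?addr_ge0// lerDr addr_ge0.
Qed.

(** * Deterministic asymptotics of a path *)

Lemma contraction_eventually (R : realType) (v : nat -> R) (rho k y : R) :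
  0 <= rho -> rho < 1 -> 0 <= k -> 0 < y -> (forall n, 0 <= v n) ->
  (\forall n \near \oo, v n.+1 <= rho * v n + k * y) ->
  \forall n \near \oo, v n <= (1 + k / (1 - rho)) * y.
Proof.
move=> rho0 rho1 k0 y0 v0 [n0 _ H].
have r1 : 0 < 1 - rho by rewrite subr_gt0.
have iter m : v (n0 + m)%N <= rho ^+ m * v n0 + k / (1 - rho) * y.
  elim: m => [|m IH]; first by rewrite addn0 expr0 mul1r lerDl !mulr_ge0// ?invr_ge0 ltW.
  rewrite addnS; apply: (le_trans (H (n0 + m)%N (leq_addr _ _))).
  apply: (@le_trans _ _ (rho * (rho ^+ m * v n0 + k / (1 - rho) * y) + k * y)).
    by rewrite lerD2r ler_wpM2l.
  by rewrite exprS -subr_ge0 (_ : _ - _ = 0)//; field; rewrite gt_eqF.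
have /cvgrPdist_le/(_ _ y0)[m0 _ Hm] : (fun m => rho ^+ m * v n0) @ \oo --> (0 : R).
  rewrite -[X in _ --> X](mul0r (v n0)); apply: cvgMl; apply: cvg_expr.
  by rewrite ger0_norm.
exists (n0 + m0)%N => // n /= mn.
have := iter (n - n0)%N; rewrite subnKC; last by apply: leq_trans mn; rewrite leq_addr.
move=> /le_trans; apply; rewrite mulrDl mul1r lerD2r.
have := Hm (n - n0)%N; rewrite /= leq_subRL; last by apply: leq_trans mn; rewrite leq_addr.
by move=> /(_ mn); rewrite sub0r normrN; apply: le_trans; exact: ler_norm.
Qed.

(** Summing the recursion telescopes. *)
Lemma contraction_sum (R : realFieldType) (v u : nat -> R) (rho k : R) :
  (forall n, v n.+1 <= rho * v n + k * u n) ->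
  forall N, (1 - rho) * (\sum_(0 <= n < N) v n) + v N <= v 0%N + k * \sum_(0 <= n < N) u n.
Proof.
move=> H; elim=> [|N IH]; first by rewrite !big_geq// !mulr0 add0r addr0.
rewrite !big_nat_recr//=; have := H N.
set a := \sum_(0 <= n < N) v n in IH *; set b := \sum_(0 <= n < N) u n in IH *.
by move: IH; clear; nra.
Qed.

Section path_asymptotics.
Context (R : realType) (d : nat) (A : 'M[R]_d) (h : R).
Hypotheses (d0 : (0 < d)%N) (Ast : stable_mx A) (h0 : 0 < h).
Local Notation mu := (@lebesgue_measure R).
Local Notation node n := (n%:R * h).

Let nodeS (n : nat) : node n.+1 = node n + h. Proof. by rewrite -[n.+1%:R]natr1 mulrDl mul1r. Qed.
Let node_ge0 (n : nat) : 0 <= node n. Proof. by rewrite mulr_ge0// ltW. Qed.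

Definition noise_bound (x : R -> 'cV[R]_d) (n : nat) (y : R) : Prop :=
  forall t, node n <= t -> t <= node n.+1 -> sqnorm (noise A x t - noise A x (node n)) <= y.

Let in_block (t : R) : 0 <= t -> node (Num.truncn (t / h)) <= t /\ t < node (Num.truncn (t / h)).+1.
Proof.
move=> t0; have th0 : 0 <= t / h by rewrite divr_ge0// ltW.
by have /andP[] := truncn_itv th0; rewrite ler_pdivlMr// ltr_pdivrMr// => -> ->.
Qed.

(** The constant C depends on A and h only, hence neither on the path nor on y. *)
Lemma path_eventually_bounded : exists2 C, 0 < C & forall x : R -> 'cV[R]_d,
  {within `[0, +oo[, continuous x} -> forall y, 0 < y ->
  (\forall n \near \oo, noise_bound x n y) ->
  \forall t \near +oo, sqnorm (x t) <= C * y.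
Proof.
have [V [rho [k [rho0 rho1 k0 V0 HV]]]] := block_contraction d0 Ast h0.
have r1 : 0 < 1 - rho by rewrite subr_gt0.
exists (k * (2 + k / (1 - rho))); first by rewrite mulr_gt0// addr_gt0// divr_gt0.
move=> x cx y y0 Hy.
have : \forall n \near \oo, V (x (node n)) <= (1 + k / (1 - rho)) * y.
  apply: (@contraction_eventually _ (fun n => V (x (node n)))) => //; first exact: ltW.
  apply: filterS Hy => n Hn; rewrite nodeS.
  apply: (proj1 (HV x cx (node n) y (node_ge0 n) _)) => u u1 u2.
  by apply: Hn => //; rewrite nodeS.
move: Hy => [n1 _ H1] [n2 _ H2].
exists (node (maxn n1 n2)); split; first exact: num_real.
move=> t tn; have t0 : 0 <= t by exact: le_trans (ltW tn).
have [tl tr] := in_block t0; set n := Num.truncn _ in tl tr.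
have nn : (maxn n1 n2 <= n)%N.
  rewrite -ltnS -(ltr_nat R); have := lt_trans tn tr.
  by rewrite ltr_pM2r.
have := H1 n; rewrite /= (leq_trans (leq_maxl _ _) nn) => /(_ isT) N1.
have := H2 n; rewrite /= (leq_trans (leq_maxr _ _) nn) => /(_ isT) N2.
have [_ /(_ t tl)] := HV x cx (node n) y (node_ge0 n)
  (fun u u1 u2 => N1 u u1 (ltac:(rewrite nodeS; exact: u2))).
rewrite -nodeS => /(_ (ltW tr)) /le_trans; apply.
rewrite -mulrA ler_pM2l//; move: N2; set q := k / _; clear; lra.
Qed.

(** If the path stays in the ball of radius b, its values at the ends of a block differ
    by at most 2 b in each coordinate, and the drift over the block is at most a
    multiple of b.  The contrapositive makes the path large whenever the
    noise has large increments. *)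
Lemma noise_increment_small : exists2 C, 0 < C & forall x : R -> 'cV[R]_d,
  {within `[0, +oo[, continuous x} -> forall b,
  (\forall t \near +oo, sqnorm (x t) <= b ^+ 2) -> 0 <= b ->
  \forall n \near \oo, forall i,
    `|noise A x (node n.+1) i ord0 - noise A x (node n) i ord0| <= C * b.
Proof.
pose a := \sum_i \sum_j `|A i j|.
have a0 : 0 <= a by apply: sumr_ge0 => i _; apply: sumr_ge0.
exists (2 + a * h); first by rewrite ltr_pwDl// mulr_ge0// ltW.
move=> x cx b [M [_ HM]] b0.
have coord t i : M < t -> `|x t i ord0| <= b.
  move=> Mt; rewrite -(ler_sqr (normr_ge0 _) b0) real_normK ?num_real//.
  apply: le_trans (HM t Mt); rewrite /sqnorm (bigD1 i)//= lerDl.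
  by apply: sumr_ge0 => j _; exact: sqr_ge0.
have [F [dF FE]] := drift_primitive A cx.
exists (Num.truncn (Num.max M 0 / h)).+1 => // n /= nM i.
have Mn : M < node n.
  have Mm : 0 <= Num.max M 0 by rewrite le_max lexx orbT.
  have [_ lt] := in_block Mm.
  have le : node (Num.truncn (Num.max M 0 / h)).+1 <= node n by rewrite ler_pM2r// ler_nat.
  by apply: le_lt_trans (lt_le_trans lt le); rewrite le_max lexx.
have Mn1 : M < node n.+1 by rewrite nodeS ltr_wpDr// ltW.
have -> : noise A x (node n.+1) i ord0 - noise A x (node n) i ord0 =
    x (node n.+1) i ord0 - x (node n) i ord0 - (F (node n.+1) i ord0 - F (node n) i ord0).
  by rewrite /noise !FE// !mxE; ring.
have nn : node n < node n.+1 by rewrite nodeS ltrDl.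
have [e ein ->] : exists2 e, e \in `[node n, node n.+1] &
    F (node n.+1) i ord0 - F (node n) i ord0 = (A *m x e) i ord0 * (node n.+1 - node n).
  apply: (@MVT_segment _ (fun s => F s i ord0) (fun s => (A *m x s) i ord0)); first exact: ltW.
    by move=> s; rewrite in_itv/= => /andP[ns _]; apply: dF; exact: le_trans (ltW ns).
  apply: derivable_within_continuous => s; rewrite in_itv/= => /andP[ns _].
  by have [] := dF s (le_trans (node_ge0 n) ns) i.
have Me : M < e by move: ein; rewrite in_itv/= => /andP[ne _]; exact: lt_le_trans ne.
have drift_le : `|(A *m x e) i ord0| <= a * b.
  rewrite mxE /a [X in _ <= X * b](bigD1 i)//= mulrDl.
  apply: (@le_trans _ _ ((\sum_j `|A i j|) * b)).
    rewrite mulr_suml; apply: (le_trans (ler_norm_sum _ _ _)); apply: ler_sum => j _.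
    by rewrite normrM ler_wpM2l// coord.
  by rewrite lerDl mulr_ge0//; apply: sumr_ge0 => k _; apply: sumr_ge0.
apply: (le_trans (ler_normB _ _)); rewrite mulrDl lerD//.
  by apply: (le_trans (ler_normB _ _)); rewrite (_ : 2 * b = b + b) ?lerD ?coord//; ring.
rewrite normrM nodeS (addrC (node n)) addrK (ger0_norm (ltW h0)) mulrAC.
by rewrite ler_wpM2r// ltW.
Qed.

Lemma integrable_sqnorm_path (x : R -> 'cV[R]_d) : {within `[0, +oo[, continuous x} ->
  forall b, mu.-integrable `[0, b] (EFin \o (fun s => sqnorm (x s))).
Proof.
move=> cx b; have cy := extend_continuous cx.
apply: extension_integrable.
apply: continuous_big => [|i _ t]; first exact: add_continuous.
have ci := @continuous_coord R d 1 _ i ord0 cy.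
by apply: continuousM; exact: ci.
Qed.

(** Over block n the squared norm is at most a multiple of v n + u n, where v is the
    Lyapunov function at the start of the block, and the sums of v are bounded
    by those of u since the recursion for v is a contraction. *)
Lemma path_average_small (x : R -> 'cV[R]_d) (u : nat -> R) : {within `[0, +oo[, continuous x} ->
  (forall n, noise_bound x n (u n)) ->
  (forall y, 0 < y -> \forall N \near \oo, \sum_(0 <= n < N) u n <= y * N%:R) ->
  t^-1 * Rintegral mu `[0, t] (fun s => sqnorm (x s)) @[t --> +oo] --> 0.
Proof.
move=> cx Hu av.
have [V [rho [k [rho0 rho1 k0 V0 HV]]]] := block_contraction d0 Ast h0.
have r1 : 0 < 1 - rho by rewrite subr_gt0.
have gI := integrable_sqnorm_path cx.
have g0 s : 0 <= sqnorm (x s) by exact: sqnorm_ge0.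
pose I a b := mass (fun s => sqnorm (x s)) a b.
have blockI n : I (node n) (node n.+1) <= h * (k * (V (x (node n)) + u n)).
  have [_ Hb] := HV x cx (node n) (u n) (node_ge0 n)
    (fun v v1 v2 => Hu n v v1 (ltac:(rewrite nodeS; exact: v2))).
  rewrite -nodeS in Hb.
  have nn : node n < node n.+1 by rewrite nodeS ltrDl.
  rewrite /I -lee_fin (massE gI)//.
  apply: (@le_trans _ _ (\int[mu]_(s in `[node n, node n.+1]) (cst (k * (V (x (node n)) + u n))%:E s))%E).
    apply: ge0_le_integral => //.
    - by move=> s _; rewrite lee_fin.
    - by have /integrableP[] := integrable_itv gI (node n.+1) (node_ge0 n).
    - by move=> s /=; rewrite in_itv/= lee_fin => /andP[]; exact: Hb.
  rewrite integral_cst//= lebesgue_measure_itv/= lte_fin nn -EFinB -EFinM lee_fin.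
  by rewrite nodeS (addrC (node n)) addrK mulrC.
pose a := h * k * V (x (node 0%N)) / (1 - rho).
pose b := h * k * (1 + k / (1 - rho)).
have sumI N : I 0 (node N) <= a + b * \sum_(0 <= n < N) u n.
  have step : I 0 (node N) <= h * k * (\sum_(0 <= n < N) V (x (node n)) + \sum_(0 <= n < N) u n).
    elim: N => [|N IH].
      by rewrite !big_geq// addr0 mulr0 mul0r /I /mass set_itv1 Rintegral_set1.
    rewrite /I (massD g0 gI (lexx 0) (node_ge0 N)); last by rewrite nodeS lerDl ltW.
    rewrite !big_nat_recr//=; apply: (le_trans (lerD IH (blockI N))).
    by rewrite -subr_ge0 (_ : _ - _ = 0)//; ring.
  apply: (le_trans step).
  have rec n : V (x (node n.+1)) <= rho * V (x (node n)) + k * u n.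
    rewrite nodeS; apply: (proj1 (HV x cx (node n) (u n) (node_ge0 n) _)) => v v1 v2.
    by apply: Hu => //; rewrite nodeS.
  have cs := contraction_sum rec N.
  set sV := \sum_(0 <= n < N) V (x (node n)) in cs *.
  set su := \sum_(0 <= n < N) u n in cs *.
  have le : sV <= (V (x (node 0%N)) + k * su) / (1 - rho).
    rewrite ler_pdivlMr// mulrC; apply: le_trans cs; rewrite lerDl; exact: V0.
  apply: (@le_trans _ _ (h * k * ((V (x (node 0%N)) + k * su) / (1 - rho) + su))).
    by rewrite ler_pM2l ?mulr_gt0// lerD2r.
  by rewrite -subr_ge0 (_ : _ - _ = 0)// /a /b; field; rewrite gt_eqF.
have a0 : 0 <= a by rewrite divr_ge0 ?mulr_ge0// ltW.
have b0 : 0 < b by rewrite !mulr_gt0// addr_gt0// divr_gt0.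
apply/cvgrPdist_le => e e0.
pose y := e * h / (4 * b).
have y0 : 0 < y by rewrite divr_gt0// mulr_gt0.
have [N0 _ HN] := av _ y0.
exists (Num.max (Num.max (node N0) h) (2 * a / e)); split; first exact: num_real.
move=> t; rewrite !gt_max => /andP[/andP[tN th] ta].
have t0 : 0 < t by exact: lt_trans th.
have [tl tr] := in_block (ltW t0); set n := Num.truncn _ in tl tr.
rewrite sub0r normrN ger0_norm; last by rewrite mulr_ge0 ?invr_ge0 ?(ltW t0)//; apply: Rintegral_ge0 => s _; exact: g0.
rewrite mulrC ler_pdivrMr//.
have nN : (N0 <= n.+1)%N.
  by rewrite -(ler_nat R) -(ler_pM2r h0) ltW// (lt_trans tN).
have s1 : Rintegral mu `[0, t] (fun s => sqnorm (x s)) <= I 0 (node n.+1).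
  by apply: le_mass => //; exact: ltW.
have s2 := sumI n.+1; have s3 := HN _ nN; rewrite /= in s3.
have s4 : b * \sum_(0 <= n0 < n.+1) u n0 <= b * (y * n.+1%:R) by rewrite ler_pM2l.
have s5 : b * (y * n.+1%:R) <= e / 2 * t.
  have -> : b * (y * n.+1%:R) = e / 4 * node n.+1 by rewrite /y; field; rewrite gt_eqF.
  rewrite nodeS (_ : e / 2 * t = e / 4 * (t + t)); last by field.
  by rewrite ler_pM2l ?divr_gt0// lerD// ltW.
have s6 : a <= e / 2 * t.
  by move: ta; rewrite ltr_pdivrMr// => /ltW; clear; lra.
by move: s1 s2 s4 s5 s6; clear; lra.
Qed.

(** A path that stays away from 0 has a mean square bounded below. *)
Lemma average_liminf (x : R -> 'cV[R]_d) : {within `[0, +oo[, continuous x} ->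
  t^-1 * Rintegral mu `[0, t] (fun s => sqnorm (x s)) @[t --> +oo] --> 0 ->
  forall y M, 0 < y -> exists2 t, M < t & sqnorm (x t) < y.
Proof.
move=> cx av y M y0; apply: contrapT => no.
have ge t : M < t -> y <= sqnorm (x t).
  by move=> Mt; rewrite leNgt; apply/negP => lt; apply: no; exists t.
have gI := integrable_sqnorm_path cx.
have g0 s : 0 <= sqnorm (x s) by exact: sqnorm_ge0.
have y4 : 0 < y / 4 by rewrite divr_gt0.
have /cvgrPdist_le/(_ _ y4)[M' [_ HM']] := av.
pose m := Num.max M 0.
pose t := Num.max (m + m) (Num.max M' 0) + 1.
have m0 : 0 <= m by rewrite le_max lexx orbT.
have tM' : M' < t by rewrite ltr_pwDr// !le_max lexx !orbT.
have tm : m + m < t by rewrite ltr_pwDr// !le_max lexx.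
have t0 : 0 < t by rewrite (le_lt_trans _ tm)// addr_ge0.
have mt : m < t by rewrite (le_lt_trans _ tm)// lerDl.
have := HM' t tM'; rewrite sub0r normrN ger0_norm; last first.
  by rewrite mulr_ge0 ?invr_ge0 ?(ltW t0)//; apply: Rintegral_ge0 => s _; exact: g0.
rewrite mulrC ler_pdivrMr// leNgt => /negP; apply.
apply: (@lt_le_trans _ _ (y * (t - m))).
  have q : t / 4 < t - m by move: tm t0; clearbody t m; lra.
  by rewrite (_ : y / 4 * t = y * (t / 4)) ?ltr_pM2l//; ring.
apply: (@le_trans _ _ (mass (fun s => sqnorm (x s)) m t)); last by apply: le_mass.
rewrite -lee_fin (massE gI)//.
apply: (@le_trans _ _ (\int[mu]_(s in `]m, t]) (cst y%:E s))%E).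
  by rewrite integral_cst//= lebesgue_measure_itv/= lte_fin mt -EFinB -EFinM lee_fin.
have /integrableP[mg _] := integrable_itv gI t m0.
rewrite -integral_itv_obnd_cbnd; last first.
  by apply: measurable_funS mg => //; apply: subset_itvr; rewrite bnd_simp.
apply: ge0_le_integral => //.
- by move=> s _; rewrite /= lee_fin ltW.
- by apply: measurable_funS mg => //; apply: subset_itvr; rewrite bnd_simp.
- move=> s /=; rewrite in_itv/= lee_fin => /andP[ms _]; apply: ge.
  by apply: le_lt_trans ms; rewrite le_max lexx.
Qed.

End path_asymptotics.

(** * From dyadic times to whole blocks *)

Section tracking.
Context (R : realType) (d : nat) (A : 'M[R]_d) (h : R).
Hypothesis h0 : 0 < h.
Context (x : R -> 'cV[R]_d) dT (T : measurableType dT) (W : 'I_d -> R -> T -> R) (w : T).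
Hypothesis cx : {within `[0, +oo[, continuous x}.
Local Notation node n := (n%:R * h).

Let nodeS (n : nat) : node n.+1 = node n + h. Proof. by rewrite -[n.+1%:R]natr1 mulrDl mul1r. Qed.
Let node_ge0 (n : nat) : 0 <= node n. Proof. by rewrite mulr_ge0// ltW. Qed.
Let node_le (n : nat) : node n <= node n.+1. Proof. by rewrite nodeS lerDl ltW. Qed.

(** The noise of the path x and the process W at w have the same increments at the dyadic
    points of all blocks: countably many times, so that this holds almost surely
    for a solution. *)
Definition tracks : Prop := forall n K k i,
  noise A x (dyadic (node n) (node n.+1) K k) i ord0 - noise A x (node n) i ord0 =
  W i (dyadic (node n) (node n.+1) K k) w - W i (node n) w.

Hypothesis trk : tracks.

Let sq n t := sqnorm (noise A x (Num.max t 0) - noise A x (node n)).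

Let cont_sq n : continuous (sq n).
Proof.
have [F [dF FE]] := drift_primitive A cx.
have -> : sq n = fun t => sqnorm (x (Num.max t 0) - F (Num.max t 0) - noise A x (node n)).
  by apply/funext => t; rewrite /sq [in noise A x (Num.max t 0)]/noise FE// le_max lexx orbT.
apply: continuous_big => [|i _ t]; first exact: add_continuous.
have cy := extend_continuous cx.
have cF : {for t, continuous (fun t : R => F (Num.max t 0) i ord0)}.
  apply: (@continuous_comp _ _ _ (fun s : R => Num.max s 0) (fun s => F s i ord0)).
    by apply: continuous_max; [exact: cvg_id|exact: cvg_cst].
  apply: differentiable_continuous; apply/derivable1_diffP.
  by have [] := dF (Num.max t 0) (ltac:(by rewrite le_max lexx orbT)) i.
have ci := @continuous_coord R d 1 _ i ord0 cy t.
have cg : {for t, continuous (fun s : R => x (Num.max s 0) i ord0 - F (Num.max s 0) i ord0 - noise A x (node n) i ord0)}.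
  by apply: continuousB; [apply: continuousB|exact: cst_continuous].
rewrite (_ : (fun s => _) = (fun s : R => (x (Num.max s 0) i ord0 - F (Num.max s 0) i ord0 - noise A x (node n) i ord0) ^+ 2)); last first.
  by apply/funext => s; rewrite !mxE.
exact: (continuousM cg cg).
Qed.

Let sq_dyadic n K k : sqnorm (noise A x (dyadic (node n) (node n.+1) K k) - noise A x (node n))
  = sq_increment W (node n) (dyadic (node n) (node n.+1) K k) w.
Proof. by apply: eq_bigr => i _; rewrite -trk !mxE. Qed.

(** The oscillation is continuous in time and dyadic points are dense. *)
Lemma noise_bound_dyadic n y : (forall K, block W h n K w <= y) -> noise_bound A h x n y.
Proof.
move=> Hy t tl tr; rewrite leNgt; apply/negP => lt.
have t0 : 0 <= t by exact: le_trans tl.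
have : \forall s \near t, y < sq n s.
  have lt' : y < sq n t by rewrite /sq max_l.
  exact: (cvgr_gt _ (@cont_sq n t) _ lt').
move=> /nbhs_ballP[e /= e0 He].
have [K HK] : exists K, h / 2 ^+ K < e.
  have /cvgrPdist_lt/(_ _ e0)[K _ HK] : (fun K => h / 2 ^+ K) @ \oo --> (0 : R).
    rewrite -[X in _ --> X](mulr0 h); apply: cvgMr.
    under eq_fun do rewrite -exprVn.
    by apply: cvg_expr; rewrite ger0_norm ?invr_ge0// invf_lt1 ?ltr1n.
  exists K; have := HK K (leqnn _); rewrite sub0r normrN ger0_norm//.
  by rewrite divr_ge0 ?exprn_ge0 ?ltW.
have p0 : 0 < 2 ^+ K :> R by rewrite exprn_gt0.
pose k := Num.truncn ((t - node n) / h * 2 ^+ K).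
have q0 : 0 <= (t - node n) / h * 2 ^+ K.
  by rewrite mulr_ge0 ?(ltW p0)// divr_ge0 ?subr_ge0// ltW.
have /andP[k1 k2] := truncn_itv q0; rewrite -/k in k1 k2.
have q1 : (t - node n) / h <= 1 by rewrite ler_pdivrMr// mul1r lerBlDl -nodeS.
have kK : (k <= 2 ^ K)%N.
  rewrite -(ler_nat R) natrX; apply: (le_trans k1).
  by rewrite ler_piMl// ltW.
pose s := dyadic (node n) (node n.+1) K k.
have sE : s = node n + h * (k%:R / 2 ^+ K).
  by rewrite /s /dyadic (minn_idPl kK) (_ : node n.+1 - node n = h)// nodeS; ring.
have st : s <= t.
  by rewrite sE -lerBrDl mulrA ler_pdivrMr// mulrC -ler_pdivlMr// mulrAC.
have ts : t < s + h / 2 ^+ K.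
  have -> : s + h / 2 ^+ K = node n + h * (k.+1%:R / 2 ^+ K).
    by rewrite sE -[k.+1%:R]natr1; ring.
  rewrite -ltrBlDl mulrA ltr_pdivlMr//.
  by rewrite [ltRHS]mulrC -ltr_pdivrMr// mulrAC.
have s0 : 0 <= s by apply: le_trans (dyadic_ge _ _ (node_le n)).
have tse : t < s + e by apply: (lt_trans ts); rewrite ltrD2l.
have := He s; rewrite /ball/= ger0_norm ?subr_ge0// ltrBlDl => /(_ tse).
rewrite /sq max_l// sq_dyadic ltNge => /negP; apply; apply: le_trans (Hy K).
exact: (@running_max_ge _ (fun k => sq_increment W (node n) (dyadic (node n) (node n.+1) K k) w)).
Qed.

Lemma block_bounded n : exists M, forall K, block W h n K w <= M.
Proof.
have [e _ He] := @EVT_max R (sq n) _ _ (node_le n) (continuous_subspaceT (@cont_sq n)).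
exists (sq n e) => K; apply: running_max_le => [|k _]; first exact: sqnorm_ge0.
rewrite -sq_dyadic; set t := dyadic _ _ _ _.
have t0 : 0 <= t by apply: le_trans (dyadic_ge _ _ (node_le n)).
have := He t; rewrite /sq max_l//; apply.
by rewrite in_itv/= dyadic_ge ?dyadic_le.
Qed.

(** The supremum of the squared oscillation over block n, obtained as the increasing
    limit of the maxima over dyadic points. *)
Definition block_sup n : R := limn (fun K => block W h n K w).

Lemma block_sup_cvg n : (fun K => block W h n K w) @ \oo --> block_sup n.
Proof.
have [M HM] := block_bounded n.
apply: (@nondecreasing_is_cvgn R (fun K => block W h n K w)).
  exact: block_nd.
by exists M => _ [K _ <-].
Qed.

Lemma noise_bound_block_sup n : noise_bound A h x n (block_sup n).
Proof.
apply: noise_bound_dyadic => K.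
apply: (nondecreasing_cvgn_le (u_ := fun K => block W h n K w)).
  exact: block_nd.
by apply/cvg_ex; exists (block_sup n); exact: block_sup_cvg.
Qed.

Lemma block_sup_average :
  (forall k, exists n1, \forall N \near \oo, forall K,
     \sum_(0 <= j < N) block W h (n1 + j)%N K w < 4 * k.+1%:R^-1 * N%:R) ->
  forall y, 0 < y -> \forall N \near \oo, \sum_(0 <= n < N) block_sup n <= y * N%:R.
Proof.
move=> av y y0.
pose k := Num.truncn (8 / y).
have ky : 4 * k.+1%:R^-1 <= y / 2.
  rewrite ler_pdivrMr ?ltr0n// mulrAC ler_pdivlMr// mulrC -ler_pdivrMl// mulrC.
  have /andP[_ /ltW] := truncn_itv (divr_ge0 (ler0n R 8) (ltW y0)).
  by rewrite (_ : y^-1 * (4 * 2) = 8 / y)//; ring.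
have [n1 [N1 _ HN1]] := av k.
pose C := \sum_(0 <= n < n1) block_sup n.
exists (maxn (n1 + N1) (Num.truncn (2 * `|C| / y)).+1) => //.
move=> N /=; rewrite geq_max => /andP[nN tN].
have n1N : (n1 <= N)%N by apply: leq_trans nN; rewrite leq_addr.
rewrite (@big_cat_nat _ _ _ n1 0%N N)//= -/C.
have tail : \sum_(n1 <= n < N) block_sup n <= y / 2 * N%:R.
  rewrite -{1}[n1]add0n big_addn.
  apply: (@le_trans _ _ (4 * k.+1%:R^-1 * (N - n1)%:R)); last first.
    by apply: ler_pM => //; rewrite ler_nat leq_subr.
  have cv : (fun K => \sum_(0 <= j < N - n1) block W h (n1 + j)%N K w) @ \oo -->
      \sum_(0 <= j < N - n1) block_sup (j + n1)%N.
    apply: cvg_big => [|j _]; first exact: add_continuous.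
    by rewrite addnC; exact: block_sup_cvg.
  apply: (cvgr_to_le cv); apply: nearW => K; apply: ltW; apply: HN1 => /=.
  by rewrite leq_subRL.
have : C <= y / 2 * N%:R.
  apply: (le_trans (ler_norm C)).
  rewrite mulrAC ler_pdivlMr// -ler_pdivrMl// mulrC (mulrC _ 2).
  have /andP[_ /ltW] := truncn_itv (divr_ge0 (mulr_ge0 (ler0n R 2) (normr_ge0 C)) (ltW y0)).
  by move=> /le_trans; apply; rewrite ler_nat.
by move=> HC; apply: (le_trans (lerD HC tail)); rewrite -mulrDl -splitr.
Qed.

End tracking.

(** * Energy of the coefficient on the blocks *)

Lemma frobenius_normE (R : realType) m n (M : 'M[R]_(m, n)) :
  frobenius_norm M ^+ 2 = \sum_i \sum_j M i j ^+ 2.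
Proof.
by rewrite sqr_sqrtr// sumr_ge0// => i _; rewrite sumr_ge0// => j _; exact: sqr_ge0.
Qed.

Section coefficient_mass.
Context (R : realType) (d r : nat) (sigma : R -> 'M[R]_(d, r)) (c : R).
Hypotheses (d0 : (0 < d)%N) (c0 : 0 < c).
Hypothesis csigma : {within `[0, +oo[, continuous sigma}.
Local Notation mu := (@lebesgue_measure R).
Local Notation h := (c / 2).
Local Notation node n := (n%:R * h).

Let h0 : 0 < h. Proof. by rewrite divr_gt0. Qed.
Let node_ge0 (n : nat) : 0 <= node n. Proof. by rewrite mulr_ge0// ltW. Qed.
Let node_le (n : nat) : node n <= node n.+1.
Proof. by rewrite ler_wpM2r ?ler_nat// ltW. Qed.

Definition intensity (s : R) : R := frobenius_norm (sigma s) ^+ 2.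
Definition block_energy (n : nat) : R := half_mass intensity c n.

Let entry i j (s : R) := sigma s i j ^+ 2.

Lemma intensity_ge0 s : 0 <= intensity s. Proof. exact: sqr_ge0. Qed.

Let cy := extend_continuous csigma.

Let centry i j : continuous (fun s : R => entry i j (Num.max s 0)).
Proof.
move=> t; have ci := @continuous_coord R d r _ i j cy t.
exact: (continuousM ci ci).
Qed.

Let entryI i j b : mu.-integrable `[0, b] (EFin \o entry i j).
Proof. exact: extension_integrable. Qed.

Lemma intensity_integrable b : mu.-integrable `[0, b] (EFin \o intensity).
Proof.
apply: extension_integrable.
rewrite (_ : (fun s : R => _) = (fun s : R => \sum_i \sum_j entry i j (Num.max s 0))); last first.
  by apply/funext => s; rewrite /intensity frobenius_normE.
apply: continuous_big => [|i _]; first exact: add_continuous.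
by apply: continuous_big => [|j _]; [exact: add_continuous|exact: centry].
Qed.

Lemma measurable_sigma i j (t : R) : measurable_fun `[0, t] (fun s => sigma s i j).
Proof.
apply/measurable_EFinP.
have /integrableP[] : mu.-integrable `[0, t] (EFin \o (fun s => sigma s i j)); last by [].
exact: (extension_integrable (g := fun s => sigma s i j)) (@continuous_coord R d r _ i j cy).
Qed.

Definition row_mass i (s t : R) : R := \sum_j mass (entry i j) s t.

Lemma row_mass_ge0 i s t : 0 <= row_mass i s t.
Proof. by apply: sumr_ge0 => j _; apply: mass_ge0 => x; exact: sqr_ge0. Qed.

Lemma energyE i (s t : R) : 0 <= s ->
  energy (fun j s => sigma s i j) s t = (row_mass i s t)%:E.
Proof.
move=> s0; rewrite /energy /row_mass -sumEFin; apply: eq_bigr => j _.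
rewrite (massE (@entryI i j))// integral_itv_obnd_cbnd//.
have /integrableP[+ _] := integrable_itv (@entryI i j) t s0.
by apply: measurable_funS => //; apply: subset_itvr; rewrite bnd_simp.
Qed.

Lemma mass_intensity (s t : R) : 0 <= s -> mass intensity s t = \sum_i row_mass i s t.
Proof.
move=> s0; apply: EFin_inj; rewrite (massE intensity_integrable)// -sumEFin.
under [RHS]eq_bigr do rewrite -sumEFin.
under [RHS]eq_bigr do under eq_bigr do rewrite (massE (@entryI _ _))//.
have mE i j : measurable_fun `[s, t] (fun x => (entry i j x)%:E).
  by have /integrableP[+ _] := integrable_itv (@entryI i j) t s0.
transitivity (\int[mu]_(x in `[s, t]) \sum_i \sum_j (entry i j x)%:E)%E.
  apply: eq_integral => x _; rewrite /intensity frobenius_normE -sumEFin.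
  by apply: eq_bigr => i _; rewrite -sumEFin.
rewrite ge0_integral_sum//.
- have n0 k j x : `[s, t]%classic x -> (0 <= (entry k j x)%:E)%E by move=> _; rewrite lee_fin sqr_ge0.
  apply: eq_bigr => i _.
  exact: (@ge0_integral_sum _ _ R mu `[s, t] (measurable_itv _) _ (fun j x => (entry i j x)%:E) (mE i) (n0 i)).
- by move=> i; apply: emeasurable_sum => j; exact: mE.
- by move=> i x _; apply: sume_ge0 => j _; rewrite lee_fin sqr_ge0.
Qed.

Lemma energy_le_block_energy i n (u : R) : node n <= u -> u <= node n.+1 ->
  (energy (fun j s => sigma s i j) u (node n.+1) <= (block_energy n)%:E)%E.
Proof.
move=> nu un; have u0 : 0 <= u := le_trans (node_ge0 n) nu.
rewrite energyE// lee_fin; apply: (@le_trans _ _ (mass intensity u (node n.+1))).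
  rewrite mass_intensity// (bigD1 i)//= lerDl.
  by apply: sumr_ge0 => k _; exact: row_mass_ge0.
exact: (le_mass intensity_ge0 intensity_integrable).
Qed.

(** The rows share the energy block_energy n, so one of the d rows gets a fraction 1 / d. *)
Lemma energetic_row n : exists2 i, block_energy n / d%:R <= row_mass i (node n) (node n.+1)
  & row_mass i (node n) (node n.+1) <= block_energy n.
Proof.
have thE : block_energy n = \sum_i row_mass i (node n) (node n.+1) by exact: mass_intensity.
have dR0 : 0 < d%:R :> R by rewrite ltr0n.
have le i : row_mass i (node n) (node n.+1) <= block_energy n.
  rewrite thE (bigD1 i)//= lerDl.
  by apply: sumr_ge0 => k _; exact: row_mass_ge0.
apply: contrapT => no.
have lt i : row_mass i (node n) (node n.+1) < block_energy n / d%:R.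
  by rewrite ltNge; apply/negP => ge; apply: no; exists i.
have : \sum_i row_mass i (node n) (node n.+1) < \sum_(i < d) block_energy n / d%:R.
  by apply: ltr_sum => //; apply/hasP; exists (Ordinal d0) => //; exact: mem_index_enum.
by rewrite -thE sumr_const card_ord -(mulr_natr (block_energy n / d%:R)) divfK ?gt_eqF// ltxx.
Qed.

Lemma block_energy_ge0 n : 0 <= block_energy n. Proof. exact: (half_mass_ge0 intensity_ge0). Qed.

Hypothesis vs0 : varsigma sigma c t @[t --> +oo] --> 0.

Lemma block_energy_cvg0 : block_energy @ \oo --> 0.
Proof.
apply/cvgrPdist_le => e e0.
have se0 : 0 < Num.sqrt e by rewrite sqrtr_gt0.
have /cvgrPdist_le/(_ _ se0)[M [_ HM]] := vs0.
exists (Num.truncn (Num.max M 0 / h)).+2 => // -[//|n] /= nM.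
rewrite sub0r normrN ger0_norm ?block_energy_ge0//.
apply: (le_trans (half_mass_le_root intensity_ge0 intensity_integrable c0 (lexx _) (node_le n))).
have Mm : 0 <= Num.max M 0 / h by rewrite divr_ge0 ?le_max ?lexx ?orbT// ltW.
have Mn : M < node n.
  have /andP[_ ] := truncn_itv Mm; rewrite ltr_pdivrMr// => lt.
  apply: (@le_lt_trans _ _ (Num.max M 0)); first by rewrite le_max lexx.
  by apply: (lt_le_trans lt); rewrite ler_pM2r// ler_nat.
have := HM _ Mn; rewrite sub0r normrN ger0_norm ?sqrtr_ge0// => le.
by rewrite -[leRHS]sqr_sqrtr ?(ltW e0)// ler_sqr ?nnegrE ?sqrtr_ge0//.
Qed.

Lemma block_energy_bounded : exists Y, forall n, block_energy n <= Y.
Proof.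
have /cvgrPdist_le/(_ _ ltr01)[N _ HN] := block_energy_cvg0.
exists (1 + \sum_(n < N) block_energy n) => n.
have [nN|Nn] := ltnP n N.
  rewrite (bigD1 (Ordinal nN))//= addrCA lerDl addr_ge0// sumr_ge0// => k _.
  exact: block_energy_ge0.
apply: (@le_trans _ _ 1); last by rewrite lerDl sumr_ge0// => k _; exact: block_energy_ge0.
by have := HN n Nn; rewrite sub0r normrN; apply: le_trans; exact: ler_norm.
Qed.

(** A positive majorant of block_energy: the tail bounds divide by the variance, and the added
    1 / (n + 1) contributes only a convergent geometric series. *)
Definition level n : R := Num.max (block_energy n) n.+1%:R^-1.

Lemma level_gt0 n : 0 < level n. Proof. by rewrite lt_max invr_gt0 ltr0n orbT. Qed.

Lemma block_energy_le_level n : block_energy n <= level n. Proof. by rewrite le_max lexx. Qed.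

Lemma level_cvg0 : level @ \oo --> 0.
Proof.
apply/cvgrPdist_le => e e0.
have /cvgrPdist_le/(_ _ e0) Ht := block_energy_cvg0.
have /cvgrPdist_le/(_ _ e0) Hn := @cvg_harmonic R.
apply: filterS2 Ht Hn => n; rewrite !sub0r !normrN => h1 h2.
rewrite ger0_norm ?(ltW (level_gt0 n))// ge_max (le_trans (ler_norm _) h1)/=.
exact: (le_trans (ler_norm _) h2).
Qed.

Lemma level_summable (a : R) : 0 < a ->
  (\sum_(0 <= n <oo) (gauss_tail a (block_energy n))%:E < +oo)%E ->
  (\sum_(0 <= n <oo) (expR (- (a / level n)))%:E < +oo)%E.
Proof.
move=> a0 fin.
have geo : (\sum_(0 <= n <oo) (expR (- a) ^+ n.+1)%:E < +oo)%E.
  have q1 : expR (- a) < 1 by rewrite expR_lt1 oppr_lt0.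
  apply: (@le_lt_trans _ _ (expR (- a) / (1 - expR (- a)))%:E); last exact: ltry.
  apply: lime_le.
    by apply: is_cvg_nneseries => n _ _; rewrite lee_fin exprn_ge0// expR_ge0.
  by apply: nearW => N; rewrite sumEFin lee_fin; exact: (geometric_partial_sum_le _ (expR_ge0 _) q1).
apply: (@le_lt_trans _ _ (\sum_(0 <= n <oo) ((gauss_tail a (block_energy n))%:E + (expR (- a) ^+ n.+1)%:E))%E).
  apply: lee_nneseries => [n _|n _]; first by rewrite lee_fin expR_ge0.
  rewrite -EFinD lee_fin /level.
  have [lt|ge] := ltP (block_energy n) n.+1%:R^-1.
    by rewrite invrK -mulNr -expRM_natr lerDr gauss_tail_ge0.
  rewrite /gauss_tail ifT; last by apply: lt_le_trans ge; rewrite invr_gt0.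
  by rewrite lerDl exprn_ge0// expR_ge0.
rewrite nneseriesD; [exact: lte_add_pinfty| |].
  by move=> n _ _; rewrite lee_fin gauss_tail_ge0.
by move=> n _ _; rewrite lee_fin exprn_ge0// expR_ge0.
Qed.

End coefficient_mass.

(** * Almost sure behaviour of the noise *)

Section solutions.
Context (R : realType) dT (T : measurableType dT) (P : probability T R).
Variables (F : R -> set (set T)) (d r : nat) (B : R -> T -> 'cV[R]_r).
Variables (sigma : R -> 'M[R]_(d, r)) (A : 'M[R]_d) (h : R).
Hypotheses (FF : is_filtration F) (BB : brownian_motion P F B) (h0 : 0 < h).
Local Notation FA := (approximable P F).

Lemma wiener_adapted (f : 'I_r -> R -> R) (M : 'I_r -> R -> T -> R) (t : R) :
  (forall j t, 0 <= t -> is_ito_integral P (fun s w => B s w j ord0) (f j) t (M j t)) ->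
  0 <= t -> sub_measurable (FA t) (wiener M t).
Proof.
move=> itoM t0; have [psi [onp cv]] := wiener_limit_of_steps FF BB itoM t0.
apply: (sub_measurable_prob_limit FF t0 _ _ cv).
  exact: (measurable_wiener itoM).
have [sF _ _] := FF.
move=> q; apply/(sub_measurableP (sF t t0)); apply: measurable_sum => j.
by apply/(sub_measurableP (sF t t0)); exact: (step_integral_sub_measurable FF BB).
Qed.

(** Both sides of the equation agree almost surely at each time, hence at countably
    many times simultaneously. *)
Lemma solution_tracks (xi : 'cV[R]_d) (X : R -> T -> 'cV[R]_d) :
  sde_solution P F B A sigma xi X ->
  exists M : 'I_d -> 'I_r -> R -> T -> R,
    (forall i j t, 0 <= t ->
       is_ito_integral P (fun s w => B s w j ord0) (fun s => sigma s i j) t (M i j t)) /\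
    {ae P, forall w, {within `[0, +oo[, continuous (fun t => X t w)} /\
       tracks A h (fun t => X t w) (fun i => wiener (M i)) w}.
Proof.
move=> [_ cX [M [itoM eqX]]]; exists M; split => //.
pose u n K k := dyadic (n%:R * h) (n.+1%:R * h) K k.
have n0 n : 0 <= n%:R * h by rewrite mulr_ge0// ltW.
have u0 n K k : 0 <= u n K k.
  apply: (le_trans (n0 n)); apply: dyadic_ge.
  by rewrite ler_wpM2r ?ler_nat// ltW.
have trk : {ae P, forall w, tracks A h (fun t => X t w) (fun i => wiener (M i)) w}.
  apply/ae_foralln => n; apply/ae_foralln => K; apply/ae_foralln => k.
  apply: filterS2 (eqX _ (u0 n K k)) (eqX _ (n0 n)) => w e1 e2 i.
  rewrite /noise !mxE e1 e2 /wiener; ring.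
by apply: filterS2 cX trk => w.
Qed.


Section solution_blocks.
Variable c : R.
Hypotheses (d0 : (0 < d)%N) (c0 : 0 < c) (hc : h = c / 2).
Hypothesis csigma : {within `[0, +oo[, continuous sigma}.
Hypothesis vs0 : varsigma sigma c t @[t --> +oo] --> 0.
Variable M : 'I_d -> 'I_r -> R -> T -> R.
Hypothesis itoM : forall i j t, 0 <= t ->
  is_ito_integral P (fun s w => B s w j ord0) (fun s => sigma s i j) t (M i j t).
Local Notation W := (fun i => wiener (M i)).
Local Notation th := (block_energy sigma c).
Local Notation lv := (level sigma c).

Let FFA : is_filtration FA := is_filtration_approximable P FF.
Let BBA : brownian_motion P FA B := brownian_motion_approximable FF BB.
Let adapted i (t : R) : 0 <= t -> sub_measurable (FA t) (W i t).
Proof. by move=> t0; exact: (wiener_adapted (@itoM i)). Qed.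

Let mf i j (t : R) : 0 <= t -> measurable_fun `[0, t] (fun s => sigma s i j).
Proof. by move=> _; exact: measurable_sigma. Qed.

Let node_ge0 (n : nat) : 0 <= n%:R * h. Proof. by rewrite mulr_ge0// ltW. Qed.
Let node_le (n : nat) : n%:R * h <= n.+1%:R * h.
Proof. by rewrite ler_wpM2r ?ler_nat// ltW. Qed.

Let tail n i (u : R) G (e : R) : n%:R * h <= u -> u <= n.+1%:R * h -> FA u G -> 0 < e ->
  (P (G `&` [set w | (e <= `|W i (n.+1%:R * h) w - W i u w|)%R]) <=
   P G * (2 * expR (- (e ^+ 2 / (24 * lv n))))%:E)%E.
Proof.
move=> nu un FG e0.
apply: (wiener_tail FFA BBA (mf i) (@itoM i)) => //.
- exact: le_trans nu.
- exact: level_gt0.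
- apply: (@le_trans _ _ (th n)%:E); last by rewrite lee_fin block_energy_le_level.
  by rewrite hc; apply: energy_le_block_energy; rewrite -?hc.
Qed.

Lemma blocks_small y : 0 < y ->
  (\sum_(0 <= n <oo) (gauss_tail (y / (96 * d%:R)) (th n))%:E < +oo)%E ->
  {ae P, forall w, \forall n \near \oo, forall K, block W h n K w < y}.
Proof.
move=> y0 fin; have dR0 : 0 < d%:R :> R by rewrite ltr0n.
apply: (blocks_eventually_small FFA adapted d0 h0 (level_gt0 sigma c) tail y0).
have := level_summable _ fin; rewrite divr_gt0 ?mulr_gt0// => /(_ isT).
by under eq_eseriesr do rewrite -mulrA -invfM.
Qed.

(** As level n tends to 0, the hypothesis of the bound on averages holds from some n1 on,
    for each of the thresholds 1 / (k + 1). *)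
Lemma blocks_average : {ae P, forall w, forall k, exists n1, \forall N \near \oo, forall K,
   \sum_(0 <= j < N) block W h (n1 + j)%N K w < 4 * k.+1%:R^-1 * N%:R}.
Proof.
apply/ae_foralln => k; set dl := k.+1%:R^-1.
have dl0 : 0 < dl by rewrite invr_gt0 ltr0n.
have dR0 : 0 < d%:R :> R by rewrite ltr0n.
have [n1 small] : exists n1, forall n, (n1 <= n)%N ->
    expR (dl - dl / (96 * d%:R * lv n)) <= dl / (4 * d%:R + dl).
  have q0 : 0 < dl / (4 * d%:R + dl) by rewrite divr_gt0// addr_gt0// mulr_gt0.
  pose b := 1 + `|dl - ln (dl / (4 * d%:R + dl))|.
  have b0 : 0 < b by rewrite ltr_pwDl.
  have e0 : 0 < dl / (96 * d%:R * b) by rewrite divr_gt0// !mulr_gt0.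
  have /cvgrPdist_le/(_ _ e0)[n1 _ Hn] := level_cvg0 c0 csigma vs0.
  exists n1 => n nn; have := Hn n nn; rewrite sub0r normrN ger0_norm ?(ltW (level_gt0 _ _ _))// => le.
  rewrite -[leRHS](lnK q0) ler_expR.
  have : b <= dl / (96 * d%:R * lv n).
    rewrite ler_pdivlMr ?mulr_gt0 ?level_gt0// mulrCA.
    move: le; rewrite ler_pdivlMr ?mulr_gt0//; lra.
  have := ler_norm (dl - ln (dl / (4 * d%:R + dl))).
  by rewrite /b; lra.
have := blocks_average_small FFA adapted d0 h0 (level_gt0 sigma c) tail dl0 small.
by apply: filterS => w Hw; exists n1.
Qed.

(** In each block a row with a fraction 1 / d of the energy has an increment of size at least e
    with conditional probability at least a quarter of the term of the series. *)
Lemma large_increments e : 0 < e ->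
  (\sum_(0 <= n <oo) (gauss_tail (256 * e ^+ 2 * d%:R) (th n))%:E = +oo)%E ->
  {ae P, forall w, forall N, exists2 n, (N <= n)%N &
     exists i, e <= `|W i (n.+1%:R * h) w - W i (n%:R * h) w|}.
Proof.
move=> e0 inf; have dR0 : 0 < d%:R :> R by rewrite ltr0n.
have [sF _ _] := FFA.
have e20 : 0 < e ^+ 2 by rewrite exprn_gt0.
have /cvgrPdist_le/(_ _ e20)[n1 _ Hn] := block_energy_cvg0 c0 csigma vs0.
pose E n : set T := \big[setU/set0]_(i < d) [set w | e <= `|W i (n.+1%:R * h) w - W i (n%:R * h) w|].
have EP n w : E n w -> exists i, e <= `|W i (n.+1%:R * h) w - W i (n%:R * h) w|.
  by rewrite /E -bigcup_seq => -[i _ ?]; exists i.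
have [_ mF leF] := FFA.
have incr i n : sub_measurable (FA (n.+1%:R * h))
    (fun w => `|W i (n.+1%:R * h) w - W i (n%:R * h) w|).
  have sS := sF _ (node_ge0 n.+1).
  apply/(sub_measurableP sS); apply: measurableT_comp => //; apply: measurable_funB.
    by apply/(sub_measurableP sS); exact: (adapted i (node_ge0 n.+1)).
  apply/(sub_measurableP sS) => U mU.
  apply: (leF _ _ (node_ge0 n) (node_le n)); exact: (adapted i (node_ge0 n) mU).
pose p n := gauss_tail (256 * e ^+ 2 * d%:R) (th n) / 4.
suff : {ae P, forall w N, exists2 n, (N <= n)%N & E n w}.
  by apply: filterS => w Hw N; have [n Nn /EP ?] := Hw N; exists n.
apply: (@conditional_borel_cantelli _ _ _ P (fun n => FA (n%:R * h)) E p n1).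
- by move=> n; exact: sF.
- by move=> n; exact: mF.
- by move=> n; apply: leF.
- move=> n; have sS := sF _ (node_ge0 n.+1).
  suff : measurable (E n : set (g_sigma_algebraType (FA (n.+1%:R * h)))).
    by rewrite /measurable/= (sigma_algebra_id sS).
  by apply: bigsetU_measurable => i _; apply: measurable_geset; exact/(sub_measurableP sS).
- by move=> n; rewrite divr_ge0// gauss_tail_ge0.
- move=> n G nn FG.
  have [i thi ith] := energetic_row d0 c0 csigma n.
  rewrite -hc in thi ith.
  have mE k : measurable [set w | e <= `|W k (n.+1%:R * h) w - W k (n%:R * h) w|].
    apply: measurable_geset.
    exact: (sub_measurable_fun (mF _ (node_ge0 n.+1)) (incr k n)).
  apply: (@le_trans _ _ (P (G `&` [set w | e <= `|W i (n.+1%:R * h) w - W i (n%:R * h) w|]))); last first.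
    apply: le_measure; rewrite ?inE.
    + by apply: measurableI => //; exact: mF FG.
    + apply: measurableI; first exact: mF FG.
      by apply: bigsetU_measurable => k _.
    + by apply: setIS; rewrite /E => w Hw; rewrite -bigcup_seq; exists i => //=; exact: mem_index_enum.
  rewrite /p /gauss_tail; case: ifPn => [th0|_]; last by rewrite mul0r mule0.
  have row0 : 0 < row_mass sigma i (n%:R * h) (n.+1%:R * h).
    by apply: lt_le_trans thi; rewrite divr_gt0.
  have := wiener_anticoncentration FFA BBA (mf i) (@itoM i) (node_ge0 n) (node_le n) FG e0 row0.
  rewrite energyE// => /(_ _ erefl).
  have re : row_mass sigma i (n%:R * h) (n.+1%:R * h) <= e ^+ 2.
    apply: (le_trans ith); have := Hn n nn; rewrite sub0r normrN.
    by apply: le_trans; exact: ler_norm.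
  move=> /(_ re); apply: le_trans; apply: lee_wpmul2l => //; rewrite lee_fin ler_pM2r// ler_expR lerN2.
  rewrite -[leRHS]mulrA; apply: ler_wpM2l; first by rewrite mulr_ge0// ltW.
  by rewrite -[leRHS]invf_div lef_pV2 ?posrE ?divr_gt0.
have -> : (\sum_(0 <= n <oo) (p n)%:E = 4^-1%:E *
    \sum_(0 <= n <oo) (gauss_tail (256 * e ^+ 2 * d%:R) (th n))%:E)%E.
  rewrite -nneseriesZl; last by move=> n _; rewrite lee_fin gauss_tail_ge0.
  by apply: eq_eseriesr => n _; rewrite -EFinM mulrC.
by rewrite inf gt0_muley// lte_fin.
Qed.

End solution_blocks.
End solutions.

(** * The trichotomy *)

Section limsup_at_infinity.
Context (R : realType) (f : R -> R).

Lemma limsup_ge b : (forall M, exists2 t, M < t & b <= f t) ->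
  (b%:E <= limf_esup (fun t => (f t)%:E) +oo%R)%E.
Proof.
move=> Hb; apply: le_ereal_inf_tmp => _ [V [M [_ HM]] <-].
have [t Mt bt] := Hb M.
apply: (@le_trans _ _ (f t)%:E); first by rewrite lee_fin.
by apply: ereal_sup_ubound; exists t => //; exact: HM.
Qed.

Lemma limsup_le b : (\forall t \near +oo, f t <= b) ->
  (limf_esup (fun t => (f t)%:E) +oo%R <= b%:E)%E.
Proof.
move=> Hb; apply: (@le_trans _ _ (ereal_sup [set (f t)%:E | t in [set t | f t <= b]])).
  by apply: ereal_inf_lbound; exists [set t | f t <= b].
by apply: ge_ereal_sup => _ [t /= ft <-]; rewrite lee_fin.
Qed.

Lemma limsup_infty : (forall b M, exists2 t, M < t & b <= f t) ->
  limf_esup (fun t => (f t)%:E) +oo%R = +oo%E.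
Proof.
by move=> Hb; apply/eqyP => b _; apply: limsup_ge; exact: Hb.
Qed.

Lemma liminf_eq0 : (forall t, 0 <= f t) -> (forall y M, 0 < y -> exists2 t, M < t & f t < y) ->
  limf_einf (fun t => (f t)%:E) +oo%R = 0%E.
Proof.
move=> f0 Hy; rewrite /limf_einf; apply/eqP; rewrite oppe_eq0 eq_le; apply/andP; split.
  apply: (@le_trans _ _ (ereal_sup ((\- (fun t => (f t)%:E))%E @` setT))).
    by apply: ereal_inf_lbound; exists setT => //; exact: filterT.
  by apply: ge_ereal_sup => _ [t _ <-]; rewrite leeNl oppe0 lee_fin.
apply: le_ereal_inf_tmp => _ [V [M [_ HM]] <-].
apply/lee_addgt0Pr => e e0; have [t Mt te] := Hy e M e0.
apply: (@le_trans _ _ ((- f t)%:E + e%:E)%E); first by rewrite -EFinD lee_fin addrC subr_ge0 ltW.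
by rewrite leeD2r//; apply: ereal_sup_ubound; exists t => //; exact: HM.
Qed.

End limsup_at_infinity.

Section dichotomy.
Context (R : realType) dT (T : measurableType dT) (P : probability T R).
Variables (F : R -> set (set T)) (d r : nat) (B : R -> T -> 'cV[R]_r).
Variables (sigma : R -> 'M[R]_(d, r)) (A : 'M[R]_d) (c : R).
Hypotheses (d0 : (0 < d)%N) (FF : is_filtration F) (BB : brownian_motion P F B).
Hypothesis csigma : {within `[0, +oo[, continuous sigma}.
Hypotheses (Ast : stable_mx A) (c0 : 0 < c).
Hypothesis vs0 : varsigma sigma c t @[t --> +oo] --> 0.
Local Notation th := (block_energy sigma c).
Local Notation sol := (sde_solution P F B A sigma).

Let h := c / 2.
Let h0 : 0 < h. Proof. by rewrite divr_gt0. Qed.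

Lemma solution_small : exists2 C, 0 < C & forall y, 0 < y ->
  (\sum_(0 <= n <oo) (gauss_tail (y / (96 * d%:R)) (th n))%:E < +oo)%E ->
  forall xi X, sol xi X -> {ae P, forall w, \forall t \near +oo, sqnorm (X t w) <= C * y}.
Proof.
have [C C0 HC] := path_eventually_bounded d0 Ast h0.
exists C => // y y0 fin xi X /(solution_tracks h0)[M [itoM good]].
have := blocks_small FF BB h0 d0 c0 erefl csigma itoM y0 fin.
apply: filterS2 good => w [cX trk] Hb.
apply: (HC _ cX y y0); apply: filterS Hb => n Hn.
by apply: (noise_bound_dyadic h0 cX trk) => K; exact: ltW.
Qed.

(** The level K = 0 of the dyadic points consists of the two ends of the block, which is
    where the increments are large. *)
Lemma solution_large : exists2 C, 0 < C & forall e, 0 < e ->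
  (\sum_(0 <= n <oo) (gauss_tail (256 * e ^+ 2 * d%:R) (th n))%:E = +oo)%E ->
  forall xi X, sol xi X -> {ae P, forall w, forall b M, 0 <= b -> C * b < e ->
    exists2 t, M < t & b < euclidean_norm (X t w)}.
Proof.
have [C C0 HC] := noise_increment_small A h0.
exists C => // e e0 inf xi X /(solution_tracks h0)[M [itoM good]].
have := large_increments FF BB h0 d0 c0 erefl csigma vs0 itoM e0 inf.
apply: filterS2 good => w [cX trk] Hb b m b0 Cb.
apply: contrapT => no.
have [] := HC _ cX b _ b0.
  exists m; split; first exact: num_real.
  move=> t mt; rewrite -[sqnorm _]sqr_sqrtr ?sqnorm_ge0//.
  rewrite ler_sqr ?nnegrE ?sqrtr_ge0// leNgt; apply/negP => lt.
  by apply: no; exists t.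
move=> N _ HN; have [n Nn [i ei]] := Hb N.
have := HN n Nn i; rewrite leNgt => /negP; apply; apply: (lt_le_trans Cb).
have := trk n 0%N 1%N i.
have -> : dyadic (n%:R * h) (n.+1%:R * h) 0 1 = n.+1%:R * h.
  by rewrite /dyadic expr0 expn0 minnn divr1 mulr1 addrC subrK.
by move=> ->.
Qed.

Lemma solution_average xi X : sol xi X -> {ae P, forall w,
  limf_einf (fun t => (euclidean_norm (X t w))%:E) +oo%R = 0%E /\
  t^-1 * Rintegral lebesgue_measure `[0, t] (fun s => euclidean_norm (X s w) ^+ 2)
    @[t --> +oo] --> 0}.
Proof.
move=> /(solution_tracks h0)[M [itoM good]].
have := blocks_average FF BB h0 d0 c0 erefl csigma vs0 itoM.
apply: filterS2 good => w [cX trk] Hb.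
have av := path_average_small d0 Ast h0 cX (noise_bound_block_sup h0 cX trk)
  (block_sup_average h0 cX trk Hb).
have eE s : euclidean_norm (X s w) ^+ 2 = sqnorm (X s w).
  by rewrite sqr_sqrtr// sqnorm_ge0.
split.
  apply: liminf_eq0 => [t|y m y0]; first exact: sqrtr_ge0.
  have y20 : 0 < y ^+ 2 by rewrite exprn_gt0.
  have [t mt lt] := average_liminf cX av m y20.
  exists t => //; rewrite -eE in lt.
  by rewrite ltr_sqr ?nnegrE ?sqrtr_ge0 ?ltW// in lt.
under eq_fun do under eq_Rintegral do rewrite eE.
exact: av.
Qed.

Let Y := cid (block_energy_bounded c0 csigma vs0).

(** By conversion, Ic sigma c eps is the weight_integral of the squared Frobenius norm of
    sigma. *)
Lemma Ic_finite eps : 0 < eps -> (Ic sigma c eps < +oo)%E ->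
  (\sum_(0 <= n <oo) (gauss_tail (eps ^+ 2) (th n))%:E < +oo)%E.
Proof.
move=> e0 fin.
exact: (tail_sum_fin (intensity_ge0 sigma) (intensity_integrable csigma) c0 e0 (projT2 Y)).
Qed.

Lemma Ic_infinite eps : Ic sigma c eps = +oo%E ->
  (\sum_(0 <= n <oo) (gauss_tail (eps ^+ 2 / 6) (th n))%:E = +oo)%E.
Proof.
move=> inf.
exact: (tail_sum_inf (intensity_ge0 sigma) (intensity_integrable csigma) c0 (projT2 Y)).
Qed.

End dichotomy.

Theorem theorem7 (R : realType) (dT : measure_display) (T : measurableType dT)
    (P : probability T R) (F : R -> set (set T)) (d r : nat)
    (B : R -> T -> 'cV[R]_r) (sigma : R -> 'M[R]_(d, r)) (A : 'M[R]_d) (c : R)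
    (d_gt0 : (0 < d)%N) (r_gt0 : (0 < r)%N)
    (F_filtration : is_filtration F)
    (B_brownian : brownian_motion P F B)
    (sigma_cont : {within `[0, +oo[, continuous sigma})
    (A_stable : stable_mx A)
    (c_gt0 : 0 < c)
    (varsigma_to0 : varsigma sigma c t @[t --> +oo] --> 0) :
  [/\
    ((forall eps, 0 < eps -> (Ic sigma c eps < +oo)%E) ->
     forall xi X, sde_solution P F B A sigma xi X ->
       {ae P, forall w, X t w @[t --> +oo] --> (0 : 'cV[R]_d)}),
    ((exists eps', [/\ 0 < eps',
        (forall eps, eps' < eps -> (Ic sigma c eps < +oo)%E)
      & (forall eps, 0 < eps -> eps < eps' -> Ic sigma c eps = +oo%E)]) ->
     (exists c1 c2 : R, [/\ 0 < c1, c1 <= c2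
      & forall xi X, sde_solution P F B A sigma xi X ->
          {ae P, forall w,
            (c1%:E <= limf_esup (fun t => (euclidean_norm (X t w))%:E) +oo%R
                   <= c2%:E)%E}]) /\
     (forall xi X, sde_solution P F B A sigma xi X ->
        {ae P, forall w,
          limf_einf (fun t => (euclidean_norm (X t w))%:E) +oo%R = 0%E /\
          t^-1 * Rintegral lebesgue_measure `[0, t]
                   (fun s => euclidean_norm (X s w) ^+ 2)
            @[t --> +oo] --> 0}))
  & ((forall eps, 0 < eps -> Ic sigma c eps = +oo%E) ->
     (forall xi X, sde_solution P F B A sigma xi X ->
        {ae P, forall w,
          limf_esup (fun t => (euclidean_norm (X t w))%:E) +oo%R = +oo%E}) /\
     (forall xi X, sde_solution P F B A sigma xi X ->
        {ae P, forall w,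
          limf_einf (fun t => (euclidean_norm (X t w))%:E) +oo%R = 0%E /\
          t^-1 * Rintegral lebesgue_measure `[0, t]
                   (fun s => euclidean_norm (X s w) ^+ 2)
            @[t --> +oo] --> 0}))].
Proof.
have [C1 C10 small] := solution_small d_gt0 F_filtration B_brownian sigma_cont A_stable c_gt0.
have [C2 C20 large] := solution_large A d_gt0 F_filtration B_brownian sigma_cont c_gt0 varsigma_to0.
have average := solution_average d_gt0 F_filtration B_brownian sigma_cont A_stable c_gt0 varsigma_to0.
have dR0 : 0 < d%:R :> R by rewrite ltr0n.
(* For e = eps / sqrt q, the exponent 256 e^2 d of large_increments is the exponent
   eps^2 / 6 for which the series diverges. *)
have [q q0 qE] : exists2 q : R, 0 < q & q = 6 * (256 * d%:R).
  by exists (6 * (256 * d%:R)) => //; rewrite mulr_gt0 ?ltr0n// mulr_gt0 ?ltr0n.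
have lower eps : 0 < eps -> Ic sigma c eps = +oo%E -> forall xi X,
    sde_solution P F B A sigma xi X -> {ae P, forall w, forall M,
    exists2 t, M < t & eps / Num.sqrt q / (2 * C2) <= euclidean_norm (X t w)}.
  move=> eps0 inf xi X solX.
  have e0 : 0 < eps / Num.sqrt q by rewrite divr_gt0// sqrtr_gt0.
  have := large _ e0 _ xi X solX.
  rewrite expr_div_n sqr_sqrtr ?(ltW q0)//.
  rewrite (_ : 256 * (eps ^+ 2 / q) * d%:R = eps ^+ 2 / 6); last first.
    by rewrite qE; field; rewrite gt_eqF.
  move=> /(_ (Ic_infinite sigma_cont c_gt0 varsigma_to0 inf)).
  apply: filterS => w Hw M; set b := _ / (2 * C2).
  have [||t Mt bt] := Hw b M; last by exists t => //; exact: ltW.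
    by rewrite divr_ge0 ?mulr_ge0// ltW.
  have -> : C2 * b = eps / Num.sqrt q / 2.
    by rewrite /b; field; rewrite !gt_eqF ?sqrtr_gt0.
  by rewrite ltr_pdivrMr// ltr_pMr// ltr1n.
have upper y : 0 < y -> (Ic sigma c (Num.sqrt (y / (96 * d%:R))) < +oo)%E -> forall xi X,
    sde_solution P F B A sigma xi X -> {ae P, forall w,
    \forall t \near +oo, sqnorm (X t w) <= C1 * y}.
  move=> y0 fin xi X solX; apply: (small y y0 _ xi X solX).
  have yd0 : 0 < y / (96 * d%:R) by rewrite divr_gt0// mulr_gt0.
  rewrite -[y / _]sqr_sqrtr ?(ltW yd0)//.
  by apply: (Ic_finite sigma_cont c_gt0 varsigma_to0) => //; rewrite sqrtr_gt0.
split.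
- move=> fin xi X solX.
  have : {ae P, forall w, forall k, \forall t \near +oo, sqnorm (X t w) <= C1 * k.+1%:R^-1}.
    apply/ae_foralln => k; apply: (upper _ _ _ xi X solX); first by rewrite invr_gt0 ltr0n.
    by apply: fin; rewrite sqrtr_gt0 divr_gt0 ?mulr_gt0// invr_gt0 ltr0n.
  apply: filterS => w Hw; apply/cvg_ballP => e e0.
  have e20 : 0 < e ^+ 2 by rewrite exprn_gt0.
  pose k := Num.truncn (C1 / e ^+ 2).
  apply: filterS (Hw k) => t le; split => // i j; rewrite (ord1 j) /ball/= mxE sub0r normrN.
  have : sqnorm (X t w) < e ^+ 2.
    apply: (le_lt_trans le); rewrite ltr_pdivrMr ?ltr0n// mulrC -ltr_pdivrMr//.
    by have /andP[] := truncn_itv (divr_ge0 (ltW C10) (ltW e20)).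
  apply: contraLR; rewrite -!leNgt => ge; apply: (@le_trans _ _ (X t w i ord0 ^+ 2)).
    by rewrite -[X t w i ord0 ^+ 2]real_normK ?num_real// ler_sqr ?nnegrE// ltW.
  rewrite /sqnorm (bigD1 i)//= lerDl.
  by apply: sumr_ge0 => l _; exact: sqr_ge0.
- move=> [eps' [eps'0 fin inf]]; split; last by move=> xi X; exact: average.
  pose b1 := eps' / 2 / Num.sqrt q / (2 * C2).
  have b10 : 0 < b1 by rewrite !divr_gt0 ?mulr_gt0// sqrtr_gt0.
  pose y := 96 * d%:R * (2 * eps') ^+ 2.
  have y0 : 0 < y by rewrite !mulr_gt0// exprn_gt0// mulr_gt0.
  exists b1, (Num.max b1 (Num.sqrt (C1 * y))); split => //; first by rewrite le_max lexx.
  move=> xi X solX.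
  have h0 : 0 < eps' / 2 by rewrite divr_gt0.
  have hl : eps' / 2 < eps' by rewrite ltr_pdivrMr// ltr_pMr// ltr1n.
  have low := lower _ h0 (inf _ h0 hl) xi X solX.
  have yE : Num.sqrt (y / (96 * d%:R)) = 2 * eps'.
    by rewrite /y mulrC mulKf ?gt_eqF ?mulr_gt0// sqrtr_sqr ger0_norm// mulr_ge0// ltW.
  have up : {ae P, forall w, \forall t \near +oo, sqnorm (X t w) <= C1 * y}.
    apply: (upper y y0 _ xi X solX); rewrite yE; apply: fin.
    by rewrite ltr_pMl// ltr1n.
  apply: filterS2 low up => w lw uw; apply/andP; split; first exact: limsup_ge.
  apply: limsup_le; apply: filterS uw => t le.
  by rewrite le_max ler_wsqrtr ?orbT.
- move=> inf; split; last by move=> xi X; exact: average.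
  move=> xi X solX.
  have low k : {ae P, forall w, forall M, exists2 t, M < t & k%:R <= euclidean_norm (X t w)}.
    pose eps := (k%:R + 1) * (2 * C2) * Num.sqrt q.
    have s0 : 0 < Num.sqrt q by rewrite sqrtr_gt0.
    have eps0 : 0 < eps by rewrite !mulr_gt0// ltr_wpDl.
    have := lower _ eps0 (inf _ eps0) xi X solX.
    rewrite /eps !mulfK ?gt_eqF ?mulr_gt0//.
    apply: filterS => w Hw M; have [t Mt le] := Hw M; exists t => //.
    by apply: le_trans le; rewrite lerDl.
  have /ae_foralln := low.
  apply: filterS => w Hw; apply: limsup_infty => b M.
  have [t Mt le] := Hw (Num.truncn `|b|).+1 M; exists t => //.
  apply: le_trans le; apply: (le_trans (ler_norm b)); apply: ltW.
  by have /andP[] := truncn_itv (normr_ge0 b).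
Qed.
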